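(* Let $K=E_1\cup E_2\cup E_3$ be a 3-component elliptic link in $\mathbb{R}^3$ in standard position, and for each $i$ let $D_i$ be the closed planar disk bounded by $E_i$. Then $K$ is a Borromean link if and only if $K$ has a triple point (that is, $D_1\cap D_2\cap D_3=\{p\}$ for some point $p$) and, after possibly relabeling $E_1,E_2,E_3$ (that is, for some permutation of the indices), $D_1\rightarrow D_2\rightarrow D_3\rightarrow D_1$, i.e. $D_1$ pierces $D_2$, $D_2$ pierces $D_3$, and $D_3$ pierces $D_1$.
   Context: A planar ellipse is a subset of the $xy$-plane in $\mathbb{R}^3$ of the form $\{(x,y,0) : \frac{x^2}{a^2}+\frac{y^2}{b^2}=1\}$ with $a,b$ fixed non-zero real constants. An ellipse is the image of a planar ellipse under a rigid transformation of $\mathbb{R}^3$ (a composition of rotations, translations and reflections). An elliptic link is a link in $\mathbb{R}^3$ (a disjoint union of smoothly embedded circles) each of whose components is an ellipse. For an ellipse $E_i$, $P_i$ denotes the plane containing $E_i$, and $D_i$ denotes the closed topological disk that $E_i$ bounds in $P_i$, so $\partial D_i=E_i$. Two ellipses $E_i,E_j$ are in standard position if $E_i$ intersects the plane $P_j$ transversely (possibly in the empty set), $E_j$ intersects the plane $P_i$ transversely (possibly in the empty set), and $E_i\cap E_j=\emptyset$. An elliptic link is in standard position if every two of its components are in standard position. For $E_i,E_j$ in standard position, $D_i$ pierces $D_j$, written $D_i\rightarrow D_j$, if $D_i\cap D_j$ is a line segment that is contained in the interior of $D_j$ (i.e. in $D_j\setminus E_j$) and is properly embedded in $D_i$ (i.e.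 its two endpoints lie on $E_i=\partial D_i$ and the rest of the segment lies in the interior of $D_i$). A triple point of $K=E_1\cup E_2\cup E_3$ is a point $p$ with $D_1\cap D_2\cap D_3=\{p\}$. A Borromean link is any link in $\mathbb{R}^3$ ambient isotopic (components unordered and unoriented) to the standard Borromean rings, for instance to the link formed by the three ellipses $\{z=0,\ \frac{x^2}{4}+y^2=1\}$, $\{x=0,\ \frac{y^2}{4}+z^2=1\}$, $\{y=0,\ \frac{z^2}{4}+x^2=1\}$. *)

(* Defs.v *)
From HB Require Import structures.
From mathcomp Require Import all_boot all_order all_algebra perm.
From mathcomp Require Import all_classical all_reals all_analysis.

Set Implicit Arguments.
Unset Strict Implicit.
Unset Printing Implicit Defensive.

Import Order.TTheory GRing.Theory Num.Theory numFieldNormedType.Exports.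

Local Open Scope classical_set_scope.
Local Open Scope ring_scope.

(* Points of R^3 are row vectors.  Their library topology comes from the sup
   norm; the Euclidean structure enters only through [dot] and orthogonal
   matrices.  The coordinates of p are p 0 0, p 0 1 and p 0 2. *)
Notation "''R3' R" := 'rV[R]_3 (at level 8, R at level 2, only parsing).

Definition dot (R : realType) (u v : 'R3 R) : R := \sum_(i < 3) u 0 i * v 0 i.

Inductive rigid (R : realType) : ('R3 R -> 'R3 R) -> Prop :=
| rigid_rotation (c : 'R3 R) (A : 'M[R]_3) :
    A *m A^T = 1%:M -> \det A = 1 -> rigid (fun x => (x - c) *m A + c)
| rigid_translation (v : 'R3 R) : rigid (fun x => x + v)
  (* reflection in the plane through c with unit normal u *)
| rigid_reflection (c u : 'R3 R) :
    dot u u = 1 -> rigid (fun x => x - (2 * dot (x - c) u) *: u)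
| rigid_composition (f g : 'R3 R -> 'R3 R) :
    rigid f -> rigid g -> rigid (f \o g).

Definition xy_plane (R : realType) : set ('R3 R) := [set p | p 0 2 = 0].

Definition planar_ellipse (R : realType) (a b : R) : set ('R3 R) :=
  [set p | p 0 2 = 0 /\ p 0 0 ^+ 2 / a ^+ 2 + p 0 1 ^+ 2 / b ^+ 2 = 1].

Definition planar_disk (R : realType) (a b : R) : set ('R3 R) :=
  [set p | p 0 2 = 0 /\ p 0 0 ^+ 2 / a ^+ 2 + p 0 1 ^+ 2 / b ^+ 2 <= 1].

(* An ellipse is given together with a presentation as a rigid image of a
   planar ellipse.  The sets [curve], [plane] and [disk] below depend only on
   the set [curve e], not on the presentation. *)
Record ellipse (R : realType) := Ellipse {
  axis1 : R;
  axis2 : R;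
  motion : 'R3 R -> 'R3 R;
  axis1_neq0 : axis1 != 0;
  axis2_neq0 : axis2 != 0;
  motion_rigid : rigid motion
}.

Definition curve (R : realType) (e : ellipse R) : set ('R3 R) :=
  motion e @` planar_ellipse (axis1 e) (axis2 e).

Definition plane (R : realType) (e : ellipse R) : set ('R3 R) :=
  motion e @` @xy_plane R.

Definition disk (R : realType) (e : ellipse R) : set ('R3 R) :=
  motion e @` planar_disk (axis1 e) (axis2 e).

(* Velocities at p of curves lying in S.  For a smooth submanifold S this is
   the tangent space at p; it is applied only to ellipses and planes. *)
Definition tangent_space (R : realType) (S : set ('R3 R)) (p : 'R3 R) :
    set ('R3 R) :=
  [set v | exists c : R -> 'R3 R,
    [/\ c 0 = p, forall t : R, S (c t) & is_derive (0 : R) (1 : R) c v]].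

Definition transverse (R : realType) (S T : set ('R3 R)) : Prop :=
  forall p, S p -> T p ->
    forall w : 'R3 R, exists u v,
      [/\ tangent_space S p u, tangent_space T p v & w = u + v].

Definition standard_position2 (R : realType) (e f : ellipse R) : Prop :=
  [/\ transverse (curve e) (plane f),
      transverse (curve f) (plane e) &
      curve e `&` curve f = set0].

Definition elliptic_link (R : realType) (n : nat) (e : 'I_n -> ellipse R) :
    Prop :=
  forall i j, i != j -> curve (e i) `&` curve (e j) = set0.

Definition standard_position (R : realType) (n : nat) (e : 'I_n -> ellipse R) :
    Prop :=
  forall i j, i != j -> standard_position2 (e i) (e j).

Definition segment (R : realType) (p q : 'R3 R) : set ('R3 R) :=
  [set (1 - t) *: p + t *: q | t in `[0, 1]%classic].

(* The segment is nondegenerate; p and q are its endpoints. *)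
Definition pierces (R : realType) (e f : ellipse R) : Prop :=
  exists p q, [/\ p != q,
    disk e `&` disk f = segment p q,
    segment p q `<=` disk f `\` curve f,
    curve e p /\ curve e q &
    segment p q `\` [set p; q] `<=` disk e `\` curve e].

Definition has_triple_point (R : realType) (e : 'I_3 -> ellipse R) : Prop :=
  exists p, \bigcap_i disk (e i) = [set p].

Definition homeomorphism (T U : topologicalType) (f : T -> U) : Prop :=
  continuous f /\
  exists g : U -> T, [/\ cancel f g, cancel g f & continuous g].

Definition ambient_isotopy (R : realType) (H : R -> 'R3 R -> 'R3 R) : Prop :=
  [/\ {within `[0, 1]%classic `*` [set: 'R3 R],
        continuous (fun tx : R * 'R3 R => H tx.1 tx.2)},
      forall t : R, t \in `[0, 1] -> homeomorphism (H t) &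
      H 0 =1 id].

(* Links are compared as subsets of R^3, hence with unordered and unoriented
   components. *)
Definition ambient_isotopic (R : realType) (K L : set ('R3 R)) : Prop :=
  exists H, ambient_isotopy H /\ H 1 @` K = L.

Definition borromean_rings (R : realType) : set ('R3 R) :=
  [set p | p 0 2 = 0 /\ p 0 0 ^+ 2 / 4 + p 0 1 ^+ 2 = 1] `|`
  [set p | p 0 0 = 0 /\ p 0 1 ^+ 2 / 4 + p 0 2 ^+ 2 = 1] `|`
  [set p | p 0 1 = 0 /\ p 0 2 ^+ 2 / 4 + p 0 0 ^+ 2 = 1].

Definition borromean (R : realType) (K : set ('R3 R)) : Prop :=
  ambient_isotopic K (@borromean_rings R).

(* Main.v *)
Require Import Defs.
From mathcomp Require Import all_boot all_order all_algebra all_fingroup perm.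
From mathcomp Require Import all_classical all_reals all_analysis.
From mathcomp Require Import ring lra.

Set Implicit Arguments.
Unset Strict Implicit.
Unset Printing Implicit Defensive.

Import Order.TTheory GRing.Theory Num.Theory numFieldNormedType.Exports.

Local Open Scope classical_set_scope.
Local Open Scope ring_scope.

(** Sufficiency.  The triple point p is interior to the three disks, and in
    suitable linear coordinates about p the three planes are the coordinate
    planes, so that the curves are star-shaped about p.  On a ray that meets two
    of them, the piercing relations prescribe the order of the two radii, and
    this order is the one of the standard rings.  Hence a homeomorphism that
    preserves every ray moves the link to the rings, and the straight line from
    the identity to it is an isotopy.  The linear part is absorbed by a path in
    the general linear group ending at a diagonal matrix of signs, which
    preserves the rings.

    Necessity.  Contractibility of a component in the complement of others is
    transported by homeomorphisms.  Of any two rings one contracts in the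
    complement of the other, but no ring contracts in the complement of both
    others: while it goes round, it crosses alternately a disk bounded by one of
    them and the planar complement of a disk bounded by the other.  These walls are disjoint, and sending them
    to two transpositions gives a flat transport in the symmetric group S_3 with
    holonomy a nontrivial commutator.  For an elliptic link this excludes linked
    pairs (each crosses the disk of the other once), so a component meets the
    disk of another only when its own disk pierces that disk; every disk must be
    pierced, since otherwise its boundary contracts in it; hence the piercing
    relation is cyclic.  Without a triple point, E1 contracts: it shrinks in D1
    to a thin loop around the segment of D1 and D3, which slides off D3 along
    the half of D3 that D2 misses. *)

(** * Continuity and compactness *)

(** Every stage of an ambient isotopy must have a continuous inverse. For a map [x] to [g x *: x]
    this is a question in one variable: [k * g (k *: x)] has to increase strictly along each ray.
    The condition is convex in [g] and holds for [g = 1], which is why a straight line serves as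
    isotopy. In the other direction, each ring has linking number zero with the other two, so a
    transport with values in an abelian group cannot obstruct its contraction. Involutions make the
    sense of a crossing immaterial, and two that do not commute record the order of the crossings.
    Since a homeomorphism may permute the rings, only symmetric conclusions can be drawn from it.
    Each ellipse is treated as the unit circle of an affine frame, and what two disks have in common
    is read off the chord in which one of them meets the plane of the other. *)

Section Ord3.
Implicit Types i j : 'I_3.

Lemma ord3P (P : 'I_3 -> Prop) : P 0 -> P 1 -> P 2 -> forall i, P i.
Proof.
move=> P0 P1 P2 [[|[|[|//]]] hi].
- by rewrite (_ : Ordinal hi = 0)//; exact: val_inj.
- by rewrite (_ : Ordinal hi = 1)//; exact: val_inj.
- by rewrite (_ : Ordinal hi = 2)//; exact: val_inj.
Qed.

Lemma ord3_cover (i j : 'I_3) : i != j -> j = i + 1 \/ j = i - 1.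
Proof.
elim/ord3P: i; elim/ord3P: j; rewrite ?eqxx // => _;
  solve [left; exact: val_inj | right; exact: val_inj].
Qed.

Lemma ord3_idx i : ((i + 1 - 1 = i) * (i + 1 + 1 = i - 1)) *
  ((i - 1 - 1 = i + 1) * (i - 1 + 1 = i)).
Proof. by elim/ord3P: i; do ![split]; exact: val_inj. Qed.

Lemma ord3_neq i : ((i + 1 == i = false) * (i - 1 == i = false)) *
  (i - 1 == i + 1 = false).
Proof. by elim/ord3P: i. Qed.

Lemma ord3_num :
  ((0 - 1 = 2 :> 'I_3) * (1 - 1 = 0 :> 'I_3) * (2 - 1 = 1 :> 'I_3)) *
  ((0 + 1 = 1 :> 'I_3) * (1 + 1 = 2 :> 'I_3) * (2 + 1 = 0 :> 'I_3)).
Proof. by do ![split]; exact: val_inj. Qed.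

Lemma sum_ord3 (V : nmodType) (F : 'I_3 -> V) : \sum_i F i = F 0 + F 1 + F 2.
Proof.
rewrite !big_ord_recl big_ord0 addr0 addrA.
by congr (F _ + F _ + F _); exact: val_inj.
Qed.

End Ord3.

Section Continuity.
Variables (R : realType) (T : topologicalType).
Implicit Types (f g : T -> R).

Lemma cts_add (V : normedModType R) (f g : T -> V) :
  continuous f -> continuous g -> continuous (fun x => f x + g x).
Proof. by move=> cf cg x; apply: cvgD; [exact: cf|exact: cg]. Qed.

Lemma cts_opp (V : normedModType R) (f : T -> V) :
  continuous f -> continuous (fun x => - f x).
Proof. by move=> cf x; apply: cvgN; exact: cf. Qed.

Lemma cts_scale (V : normedModType R) f (g : T -> V) :
  continuous f -> continuous g -> continuous (fun x => f x *: g x).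
Proof. by move=> cf cg x; apply: cvgZ; [exact: cf|exact: cg]. Qed.

Lemma cts_mul f g :
  continuous f -> continuous g -> continuous (fun x => f x * g x).
Proof. by move=> cf cg x; apply: cvgM; [exact: cf|exact: cg]. Qed.

Lemma cts_exp f n : continuous f -> continuous (fun x => f x ^+ n).
Proof.
move=> cf; elim: n => [|n IHn].
  by under eq_fun do rewrite expr0; exact: cst_continuous.
by under eq_fun do rewrite exprS; exact: cts_mul.
Qed.

Lemma cts_inv f :
  (forall x, f x != 0) -> continuous f -> continuous (fun x => (f x)^-1).
Proof. by move=> f0 cf x; apply: cvgV; [exact: f0|exact: cf]. Qed.

Lemma cts_max f g :
  continuous f -> continuous g -> continuous (fun x => Num.max (f x) (g x)).
Proof. by move=> cf cg x; apply: continuous_max; [exact: cf|exact: cg]. Qed.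

Lemma cts_min f g :
  continuous f -> continuous g -> continuous (fun x => Num.min (f x) (g x)).
Proof. by move=> cf cg x; apply: continuous_min; [exact: cf|exact: cg]. Qed.

Lemma cts_abs f : continuous f -> continuous (fun x => `|f x|).
Proof. by move=> cf x; apply: cvg_norm; exact: cf. Qed.

Lemma cts_sqrt f : continuous f -> continuous (fun x => Num.sqrt (f x)).
Proof.
move=> cf x.
apply: (@continuous_comp _ _ _ f Num.sqrt); first exact: cf.
exact: sqrt_continuous.
Qed.

Lemma cts_mx m n (f : T -> 'M[R]_(m, n)) :
  (forall i j, continuous (fun x => f x i j)) -> continuous f.
Proof.
move=> cf x A [P nP PA].
apply: (@filterS _ _ _ [set y | forall i, forall j, P i j (f y i j)]).
  by move=> y Py; exact: PA.
apply: filter_forall => i; apply: filter_forall => j.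
exact: (cf i j x _ (nP i j)).
Qed.

Lemma cts_coord m n (f : T -> 'M[R]_(m, n)) i j :
  continuous f -> continuous (fun x => f x i j).
Proof.
move=> cf x.
apply: (@continuous_comp _ _ _ f (fun M : 'M[R]_(m, n) => M i j)).
  exact: cf.
exact: coord_continuous.
Qed.

Lemma cts_sum (I : finType) (f : I -> T -> R) :
  (forall i, continuous (f i)) -> continuous (fun x => \sum_i f i x).
Proof.
move=> cf; have: forall s : seq I, continuous (fun x => \sum_(i <- s) f i x).
  elim=> [|i s IHs].
    by under eq_fun do rewrite big_nil; exact: cst_continuous.
  by under eq_fun do rewrite big_cons; exact: cts_add.
exact.
Qed.

Lemma cts_mulmx m n p (f : T -> 'M[R]_(m, n)) (g : T -> 'M[R]_(n, p)) :
  continuous f -> continuous g -> continuous (fun x => f x *m g x).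
Proof.
move=> cf cg; apply: cts_mx => i j.
under eq_fun do rewrite mxE.
apply: cts_sum => k; apply: cts_mul; exact: cts_coord.
Qed.

End Continuity.

Lemma cts_comp (S T U : topologicalType) (f : S -> T) (g : T -> U) :
  continuous f -> continuous g -> continuous (fun x => g (f x)).
Proof. by move=> cf cg x; apply: continuous_comp; [exact: cf|exact: cg]. Qed.

Lemma cts_pair (S T U : topologicalType) (f : S -> T) (g : S -> U) :
  continuous f -> continuous g -> continuous (fun x => (f x, g x)).
Proof. by move=> cf cg x; apply: cvg_pair; [exact: cf|exact: cg]. Qed.

Lemma cts_fst (S T U : topologicalType) (f : S -> T * U) :
  continuous f -> continuous (fun x => (f x).1).
Proof. by move=> cf x; apply: cvg_comp (cf x) _; exact: cvg_fst. Qed.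

Lemma cts_snd (S T U : topologicalType) (f : S -> T * U) :
  continuous f -> continuous (fun x => (f x).2).
Proof. by move=> cf x; apply: cvg_comp (cf x) _; exact: cvg_snd. Qed.

Lemma cts_id (T : topologicalType) : continuous (fun x : T => x).
Proof. by move=> x; exact: cvg_id. Qed.

Lemma cts_cst (S T : topologicalType) (a : T) : continuous (fun _ : S => a).
Proof. exact: cst_continuous. Qed.

(** Partially applied operators occur as patterns because subterms often arrive eta-reduced.
    Inverses leave nonvanishing as a side goal. *)
Ltac cts_step :=
  lazymatch goal with
  | |- continuous (fun _ => ?a) => exact: cts_cst
  | |- continuous fst => exact: (cts_fst (@cts_id _))
  | |- continuous snd => exact: (cts_snd (@cts_id _))
  | |- continuous ( *%R ?a) => exact: (cts_mul (@cts_cst _ _ a) (@cts_id _))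
  | |- continuous (+%R ?a) => exact: (cts_add (@cts_cst _ _ a) (@cts_id _))
  | |- continuous -%R => exact: (cts_opp (@cts_id _))
  | |- continuous (fun x => x) => exact: cts_id
  | |- continuous (fun x => (@?f x + @?g x)%R) => apply: cts_add
  | |- continuous (fun x => (- (@?f x))%R) => apply: cts_opp
  | |- continuous (fun x => (@?f x * @?g x)%R) => apply: cts_mul
  | |- continuous (fun x => (@?f x *: @?g x)%R) => apply: cts_scale
  | |- continuous (fun x => ((@?f x) ^+ _)%R) => apply: cts_exp
  | |- continuous (fun x => (@?f x)^-1%R) => apply: cts_inv
  | |- continuous (fun x => `|@?f x|%R) => apply: cts_abs
  | |- continuous (fun x => Num.sqrt (@?f x)) => apply: cts_sqrt
  | |- continuous (fun x => Num.max (@?f x) (@?g x)) => apply: cts_max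
  | |- continuous (fun x => Num.min (@?f x) (@?g x)) => apply: cts_min
  | |- continuous (fun x => (@?f x *m @?g x)%R) => apply: cts_mulmx
  | |- continuous (fun x => fun_of_matrix (@?f x) _ _) => apply: cts_coord
  | |- continuous (fun x => (@?f x, @?g x)) => apply: cts_pair
  | |- continuous (fun x => (@?f x).1) => apply: cts_fst
  | |- continuous (fun x => (@?f x).2) => apply: cts_snd
  | |- continuous (fun x => ?h (@?f x)) =>
      apply: (@cts_comp _ _ _ f h); [|assumption]
  | |- continuous ?h => is_var h; assumption
  end.
Ltac cts := repeat (first
  [match goal with H : ?T |- ?U => constr_eq T U; exact: H end | cts_step]).

Lemma near_lt (R : realType) (T : topologicalType) (f : T -> R) x a :
  continuous f -> f x < a -> \forall y \near x, f y < a.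
Proof. by move=> cf fa; exact: (cf x _ (lt_nbhsl fa)). Qed.

Lemma near_gt (R : realType) (T : topologicalType) (f : T -> R) x a :
  continuous f -> a < f x -> \forall y \near x, a < f y.
Proof. by move=> cf fa; exact: (cf x _ (lt_nbhsr fa)). Qed.

Lemma near_cst_continuous (R : realType) (T : topologicalType) (f : T -> R) x l :
  (\forall y \near x, f y = l) -> {for x, continuous f}.
Proof.
move=> h; rewrite /prop_for /continuous_at. have fx : f x = l := nbhs_singleton h.
by rewrite fx; exact: cvg_near_cst h.
Qed.

Lemma closed_fun_eq (R : realType) (T : topologicalType) (f : T -> R) a :
  continuous f -> closed [set x | f x = a].
Proof.
move=> cf; apply: (@preimage_closed _ _ f [set x | x = a]); last exact: closed_eq.
by move=> x _; exact: cf.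
Qed.

Lemma closed_fun_le (R : realType) (T : topologicalType) (f : T -> R) a :
  continuous f -> closed [set x | f x <= a].
Proof.
move=> cf; apply: (@preimage_closed _ _ f [set x | x <= a]); last exact: closed_le.
by move=> x _; exact: cf.
Qed.

Section Compact.
Variable R : realType.

(** Near a zero of [G] the function [F] stays negative; elsewhere [F / G] is locally bounded.
    Compactness makes the bound uniform. All the large constants of the radial isotopy come from
    here. *)
Lemma compact_dominated (T : topologicalType) (K : set T) (F G : T -> R) :
  compact K -> continuous F -> continuous G -> (forall x, K x -> 0 <= G x) ->
  (forall x, K x -> G x = 0 -> F x < 0) ->
  exists2 C, 0 < C & forall D, C <= D -> forall x, K x -> F x <= D * G x.
Proof.
move=> cK cF cG G0 FG.
have [|n _ nP] := (compact_near_coveringP K).1 cK _ (\oo : set_system nat)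
    (fun n x => K x -> F x <= n%:R * G x).
  move=> x Kx; have [Gx|Gx] := eqVneq (G x) 0.
    exists ([set y | F y < 0], [set n | True]) => /=.
      split; last exact: filterT.
      by apply: near_lt => //; exact: FG.
    move=> -[y n] /= [Fy _] Ky; rewrite (le_trans (ltW Fy))//.
    by rewrite mulr_ge0// G0.
  have Gx0 : 0 < G x by rewrite lt0r Gx G0.
  pose N := Num.truncn ((`|F x| + 1) / (G x / 2)).
  exists ([set y | F y < `|F x| + 1 /\ G x / 2 < G y], [set n | (N.+1 <= n)%N]) => /=.
    split; last by exists N.+1.
    apply: filterI.
      apply: near_lt => //.
      by rewrite (le_lt_trans (ler_norm _))// ltrDl.
    by apply: near_gt => //; rewrite ltr_pdivrMr// ltr_pMr// ltr1n.
  move=> -[y n] /= [[Fy Gy] Nn] Ky; rewrite (le_trans (ltW Fy))//.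
  have Nn' : (`|F x| + 1) / (G x / 2) <= n%:R.
    apply: (le_trans (ltW (truncnS_gt _))).
    by rewrite ler_nat.
  rewrite ler_pdivrMr in Nn'; last by rewrite divr_gt0.
  apply: (le_trans Nn'); apply: ler_wpM2l; first exact: ler0n.
  exact: ltW.
(* The successor makes the constant positive. *)
exists n.+1%:R => // D nD x Kx.
apply: (@le_trans _ _ (n.+1%:R * G x)); last by apply: ler_wpM2r => //; exact: G0.
by apply: (nP n.+1) => //=.
Qed.

End Compact.

(** * Isotopies *)

Section Isotopic.
Variable R : realType.
Local Notation V := 'rV[R]_3.
Implicit Types K L : set V.

Lemma homeomorphism_comp (T : topologicalType) (f g : T -> T) :
  homeomorphism f -> homeomorphism g -> homeomorphism (fun x => g (f x)).
Proof.
move=> [cf [f' [ff' f'f cf']]] [cg [g' [gg' g'g cg']]].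
split; first exact: cts_comp cf cg.
exists (fun x => f' (g' x)); split; last exact: cts_comp cg' cf'.
- by move=> x /=; rewrite gg' ff'.
- by move=> x /=; rewrite f'f g'g.
Qed.

(** Continuity is asked at all real times, so that composites need no bookkeeping of the domain. *)
Definition isotopic K L := exists H : R -> V -> V,
  [/\ continuous (fun tx : R * V => H tx.1 tx.2),
      forall t, 0 <= t <= 1 -> homeomorphism (H t),
      H 0 =1 id & H 1 @` K = L].

Lemma isotopic_ambient K L : isotopic K L -> ambient_isotopic K L.
Proof.
move=> [H [cH hH H0 HKL]]; exists H; split=> //; split=> //.
exact: continuous_subspaceT.
Qed.

(** The two isotopies run simultaneously, not one after the other, so nothing has to be glued. *)
Lemma isotopic_trans K L M : isotopic K L -> isotopic L M -> isotopic K M.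
Proof.
move=> [H [cH hH H0 HKL]] [G [cG hG G0 GLM]].
exists (fun t x => G t (H t x)); split.
- apply: (@cts_comp _ _ _ (fun tx : R * V => (tx.1, H tx.1 tx.2)) _ _ cG).
  by cts.
- by move=> t t01; apply: homeomorphism_comp; [exact: hH|exact: hG].
- by move=> x; rewrite /= G0 H0.
- by rewrite -GLM -HKL -image_comp.
Qed.

Lemma isotopic_conj (f g : V -> V) K L :
  continuous f -> continuous g -> cancel f g -> cancel g f ->
  isotopic K L -> isotopic (f @` K) (f @` L).
Proof.
move=> cf cg fg gf [H [cH hH H0 HKL]].
exists (fun t x => f (H t (g x))); split.
- apply: (@cts_comp _ _ _ (fun tx : R * V => H tx.1 (g tx.2)) f) => //.
  apply: (@cts_comp _ _ _ (fun tx : R * V => (tx.1, g tx.2)) _ _ cH).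
  by cts.
- move=> t t01; apply: homeomorphism_comp; last by split=> //; exists g.
  by apply: homeomorphism_comp; [split=> //; exists f|exact: hH].
- by move=> x /=; rewrite H0 gf.
- rewrite -HKL; apply/seteqP; split=> y /=.
    by move=> [_ [x Kx <-] <-]; rewrite fg; exists (H 1 x) => //; exists x.
  by move=> [_ [x Kx <-] <-]; exists (f x); [exists x|rewrite fg].
Qed.

End Isotopic.

(** * Homeomorphisms preserving every ray *)

Section RadialHomeo.
Variables (R : realType) (V : normedModType R) (g : V -> R).
Hypothesis cg : continuous g.
Hypothesis g_incr : forall (y : V) (k l : R), 0 <= k -> k < l ->
  k * g (k *: y) < l * g (l *: y).
Hypothesis g_large : forall y : V, exists2 k, 0 <= k & 1 <= k * g (k *: y).

Let F (y : V) (k : R) := k * g (k *: y).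

Let F_inj y k l : 0 <= k -> 0 <= l -> F y k = F y l -> k = l.
Proof.
move=> k0 l0 kl; have [/(g_incr y k0)|/(g_incr y l0)|//] := ltgtP k l.
  by rewrite -[_ * _]/(F y k) kl ltxx.
by rewrite -[_ * _]/(F y l) -kl ltxx.
Qed.

Let cF y : continuous (F y).
Proof.
apply: cts_mul; first exact: cts_id.
by apply: cts_comp cg; apply: cts_scale; [exact: cts_id|exact: cts_cst].
Qed.

Let cF2 k : continuous (F^~ k).
Proof.
apply: cts_mul; first exact: cts_cst.
by apply: cts_comp cg; apply: cts_scale; [exact: cts_cst|exact: cts_id].
Qed.

Let F_solve y : exists k, 0 <= k /\ F y k = 1.
Proof.
have [k k0 k1] := g_large y.
have [|c /itvP c01 Fc] := @IVT R (F y) 0 k 1 k0 (continuous_subspaceT (@cF y)).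
  by rewrite /F mul0r min_l ?max_r ?(le_trans ler01)//= ler01.
by exists c; rewrite c01.
Qed.

Let kap y := projT1 (cid (F_solve y)).

Let kapP y : 0 <= kap y /\ F y (kap y) = 1.
Proof. exact: (projT2 (cid (F_solve y))). Qed.

Let kap_gt0 y : 0 < kap y.
Proof.
have [k0 Fk] := kapP y; rewrite lt0r k0 andbT; apply/eqP => k00.
by move: Fk; rewrite k00 /F mul0r => /esym/eqP; rewrite oner_eq0.
Qed.

Let cts_kap : continuous kap.
Proof.
move=> y; apply/cvgrPdist_lt => e e0.
have k0 := kap_gt0 y.
(* Strict growth traps [kap z] between [k1] and [k2] once [F z k1 < 1 < F z k2], an open condition
   on [z]. The cut at 0 is there because [g_incr] compares nonnegative factors. *)
pose k1 := Num.max 0 (kap y - e / 2); pose k2 := kap y + e / 2.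
have k1k : k1 < kap y by rewrite gt_max k0 ltrBlDr ltrDl divr_gt0.
have k1_ge0 : 0 <= k1 by rewrite le_max lexx.
have kk2 : kap y < k2 by rewrite ltrDl divr_gt0.
have F1 : F y k1 < 1 by rewrite -(kapP y).2; exact: g_incr.
have F2 : 1 < F y k2 by rewrite -(kapP y).2; exact/g_incr/kk2/ltW.
near=> z.
have F1z : F z k1 < 1 by near: z; exact: near_lt.
have F2z : 1 < F z k2 by near: z; exact: near_gt.
have [z0 Fz] := kapP z.
have k1z : k1 < kap z.
  rewrite ltNge; apply/negP; rewrite le_eqVlt => /predU1P[zk|].
    by move: F1z; rewrite -zk Fz ltxx.
  by move/(g_incr z z0); rewrite -[_ * _]/(F z (kap z)) Fz ltNge (ltW F1z).
have zk2 : kap z < k2.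
  rewrite ltNge; apply/negP; rewrite le_eqVlt => /predU1P[zk|].
    by move: F2z; rewrite zk Fz ltxx.
  have k20 : 0 <= k2 by rewrite (le_trans _ (ltW kk2))// ltW.
  by move/(g_incr z k20); rewrite -/(F z (kap z)) Fz ltNge (ltW F2z).
have : kap y - e / 2 <= k1 by rewrite le_max lexx orbT.
rewrite /k2 in zk2 *; rewrite ltr_norml; move=> ?; apply/andP; split; lra.
Unshelve. all: by end_near. Qed.

(** The inverse scales [y] by the root [kap y] of [k * g (k *: y) = 1], which exists by [g_large]
    and is unique by [g_incr]. *)
Lemma radial_homeomorphism : homeomorphism (fun x => g x *: x).
Proof.
split; first exact: cts_scale cg (@cts_id _).
exists (fun y => kap y *: y); split.
- move=> x; have [k0 Fk] := kapP (g x *: x).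
  have gx : 0 < g x.
    have := @g_incr x 0 1 (lexx _) ltr01.
    by rewrite mul0r mul1r scale1r.
  suff -> : kap (g x *: x) = (g x)^-1 by rewrite scalerA mulVf ?scale1r// gt_eqF.
  apply: (@F_inj (g x *: x)) => //; first by rewrite invr_ge0 ltW.
  by rewrite Fk /F scalerA mulVf ?gt_eqF// scale1r mulVf// gt_eqF.
- move=> y; have [k0 Fk] := kapP y.
  by rewrite scalerA mulrC -[_ * _]/(F y (kap y)) Fk scale1r.
- exact: cts_scale cts_kap (@cts_id _).
Qed.

End RadialHomeo.

(** * Moving three curves onto three others along rays *)

Section RadialIsotopy.
Variable R : realType.
Local Notation V := 'rV[R]_3.

Lemma fin_large (I : finType) (P : I -> R -> Prop) :
  (forall i, exists C, forall D, C <= D -> P i D) ->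
  exists C, forall D, C <= D -> forall i, P i D.
Proof.
move=> /choice[C PC]; exists (\sum_i `|C i|) => D CD i.
apply: PC; apply: le_trans CD; rewrite (bigD1 i)//=.
by rewrite (le_trans (ler_norm _))// lerDl sumr_ge0.
Qed.

(* Steep before 1 and flat after 1: on a ray through two of the curves, the
   term of the outer curve is negligible at the inner one, and the term of the
   inner curve stays below the radius wanted at the outer one. *)
Definition ramp (M n : R) : R :=
  Num.max 0 (Num.min (1 + M * (n - 1)) (1 + M^-1 * (n - 1))).

Lemma cts_ramp M : continuous (ramp M).
Proof. by rewrite /ramp; cts. Qed.

Lemma ramp1 M : ramp M 1 = 1.
Proof. by rewrite /ramp subrr !mulr0 addr0 minxx max_r. Qed.

Lemma ramp0 M n : 1 <= M * (1 - n) -> ramp M n = 0.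
Proof. by move=> Mn; apply: max_l; rewrite ge_min; apply/orP; left; lra. Qed.

Lemma ramp_le M n : 1 <= n -> 0 < M -> ramp M n <= 1 + M^-1 * (n - 1).
Proof.
move=> n1 M0; rewrite /ramp ge_max ge_min lexx orbT andbT.
by rewrite addr_ge0// mulr_ge0 ?invr_ge0 ?subr_ge0// ltW.
Qed.

Lemma ramp_ge0 M n : 0 <= ramp M n.
Proof. by rewrite /ramp le_max lexx. Qed.

Lemma ramp_incr M n p : 0 < M -> n < p ->
  ramp M n <= ramp M p /\ (0 < ramp M n -> ramp M n < ramp M p).
Proof.
move=> M0 np.
have h (N : R) : 0 < N -> 1 + N * (n - 1) < 1 + N * (p - 1).
  by move=> N0; rewrite ltrD2l ltr_pM2l// ltrD2r.
have hmin : Num.min (1 + M * (n - 1)) (1 + M^-1 * (n - 1)) <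
    Num.min (1 + M * (p - 1)) (1 + M^-1 * (p - 1)).
  by rewrite lt_min !gt_min !h ?invr_gt0 ?orbT.
rewrite /ramp; split; first by rewrite ge_max !le_max lexx (ltW hmin) !orbT.
rewrite lt_max ltxx /= => h0.
by rewrite (max_r (ltW h0)) lt_max hmin orbT.
Qed.

(** Strictness is restricted to positive values because [ramp] vanishes on an initial interval; in
    this form the property passes to maxima. *)
Definition ray_incr (f : R -> R) := forall k l, 0 <= k -> k < l ->
  f k <= f l /\ (0 < f k -> f k < f l).

Lemma ray_incr_max f g :
  ray_incr f -> ray_incr g -> ray_incr (fun k => Num.max (f k) (g k)).
Proof.
move=> hf hg k l k0 kl; have [f1 f2] := hf k l k0 kl.
have [g1 g2] := hg k l k0 kl; split.
  by rewrite ge_max !le_max f1 g1 orbT.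
case: (leP (f k) (g k)) => fg h; rewrite lt_max.
  by rewrite g2// orbT.
by rewrite f2.
Qed.

(** To be read as gauges of the given curves ([a]) and of the wanted ones ([b]), and as distances to
    their planes ([zeta]). *)
Variables (a b zeta : 'I_3 -> V -> R).
Hypotheses (ca : forall i, continuous (a i)) (cb : forall i, continuous (b i))
  (cz : forall i, continuous (zeta i)).
Hypotheses
  (ha : forall i k x, 0 <= k -> a i (k *: x) = k * a i x)
  (hb : forall i k x, 0 <= k -> b i (k *: x) = k * b i x)
  (hz : forall i k x, 0 <= k -> zeta i (k *: x) = k * zeta i x).
Hypotheses (b0 : forall i x, 0 <= b i x)
  (z0 : forall i x, 0 <= zeta i x).
Hypotheses (az0 : forall i x, x != 0 -> 0 < a i x + zeta i x)
  (bz0 : forall i x, x != 0 -> 0 < b i x + zeta i x).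

Let E i : set V := [set x | zeta i x = 0 /\ a i x = 1].
Let B i : set V := [set x | zeta i x = 0 /\ b i x = 1].

Hypothesis cE : forall i, compact (E i).
(** On a ray through both curves, the first alternative puts [E i] inside [E j]. The second puts it
    outside, and then its wanted radius [1 / b i x] must exceed [1 / b j x]. *)
Hypothesis order : forall i j, i != j ->
  (forall x, E i x -> zeta j x = 0 -> a j x < 1) \/
  (forall x, E i x -> zeta j x = 0 -> 1 < a j x /\ b i x < b j x).

Let a00 i : a i 0 = 0.
Proof. by rewrite -(scale0r 0) ha// mul0r. Qed.

Let b00 i : b i 0 = 0.
Proof. by rewrite -(scale0r 0) hb// mul0r. Qed.

Let z00 i : zeta i 0 = 0.
Proof. by rewrite -(scale0r 0) hz// mul0r. Qed.

Let E_neq0 i x : E i x -> x != 0.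
Proof.
move=> [_ ax]; apply/eqP => x0.
by move: ax; rewrite x0 a00 => /esym/eqP; rewrite oner_eq0.
Qed.

Let E_b i x : E i x -> 0 < b i x.
Proof. by move=> Ex; have := bz0 i (E_neq0 Ex); rewrite Ex.1 addr0. Qed.

(** For an inner curve, [a j] is bounded away from 1, so a steep ramp is already 0. For an outer
    one, the excess of the flat ramp over 1 is divided by [M], while [b j - b i] has a positive
    lower bound. *)
Let steep i j : i != j -> exists C, forall M, C <= M ->
  forall x, E i x -> zeta j x = 0 -> ramp M (a j x + zeta j x) * b i x < b j x.
Proof.
move=> /order ij.
have cS : compact (E i `&` [set x | zeta j x = 0]).
  apply: compact_closedI => //.
  exact: closed_fun_eq.
case: ij => ij.
- have [| | | |C C0 hC] := @compact_dominated R _ _ (fun=> 1) (fun x => 1 - a j x) cS.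
  + exact: cts_cst.
  + by cts; exact: ca.
  + by move=> x [/ij h /h]; lra.
  + by move=> x [/ij h /h]; lra.
  exists C => M CM x Ex zx.
  rewrite zx addr0 ramp0 ?mul0r; last by apply: hC.
  by have := bz0 j (E_neq0 Ex); rewrite zx addr0.
(* The added 1 turns the large inequality obtained by compactness into a strict one. *)
- have [| | | |C C0 hC] := @compact_dominated R _ _
      (fun x => (a j x - 1) * b i x + 1) (fun x => b j x - b i x) cS.
  + by cts; [exact: ca|exact: cb].
  + by cts; exact: cb.
  + by move=> x [/ij h /h]; lra.
  + by move=> x [/ij h /h]; lra.
  exists C => M CM x Ex zx; have M0 := lt_le_trans C0 CM.
  have [aj bij] := ij x Ex zx.
  have bi := E_b Ex.
  have := hC M CM x (conj Ex zx) => h.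
  rewrite zx addr0; apply: (@le_lt_trans _ _ ((1 + M^-1 * (a j x - 1)) * b i x)).
    by rewrite ler_pM2r// ramp_le// ltW.
  rewrite mulrDl mul1r -ltrBrDl -mulrA ltr_pdivrMl//.
  by apply: lt_le_trans h; rewrite ltrDl.
Qed.

(** The penalty makes the term of index [i] small off the plane of its curve, where the other curves
    lie. *)
Let b_ C i x : R := b i x + C * zeta i x.

(** The scaling factor is a maximum of one term per curve; on [E i] its own term equals [1 / b i]
    and has to dominate. The constants are chosen in turn: [M] for points in two planes, then [C]
    for points off the other plane, then [D] for the floor [D^-1]. *)
Lemma radial_isotopy : isotopic (\bigcup_i E i) (\bigcup_i B i).
Proof.
have [M1 hM1] : exists C, forall M, C <= M -> forall ij : 'I_3 * 'I_3, ij.1 != ij.2 ->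
    forall x, E ij.1 x -> zeta ij.2 x = 0 ->
    ramp M (a ij.2 x + zeta ij.2 x) * b ij.1 x < b ij.2 x.
  apply: fin_large => -[i j] /=.
  have [->|ij] := eqVneq i j; first by exists 0.
  by have [C hC] := steep ij; exists C => M CM _; apply: hC.
(* With [M >= 2] the ramp vanishes below 1/2, so [gi] is 0 near the origin, where its denominator
   vanishes. *)
pose M : R := `|M1| + 2.
have M0 : 0 < M by rewrite ltr_wpDl.
have M2 : 2 <= M by rewrite lerDr.
have {hM1} hM i j x : i != j -> E i x -> zeta j x = 0 ->
    ramp M (a j x + zeta j x) * b i x < b j x.
  move=> ij; apply: (hM1 M _ (i, j)) => //=.
  by rewrite (le_trans (ler_norm _))// lerDl.
(* Where [zeta j] vanishes on [E i], [hM] is strict; a multiple of [zeta j] pays for the remaining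
   points. *)
have [C1 hC1] : exists C, forall D, C <= D -> forall ij : 'I_3 * 'I_3, ij.1 != ij.2 ->
    forall x, E ij.1 x ->
    ramp M (a ij.2 x + zeta ij.2 x) * b ij.1 x - b ij.2 x <= D * zeta ij.2 x.
  apply: fin_large => -[i j] /=.
  have [->|ij] := eqVneq i j; first by exists 0.
  have [| | | |C _ hC] := @compact_dominated R _ _
    (fun x => ramp M (a j x + zeta j x) * b i x - b j x) (zeta j) (@cE i).
  + cts; [|exact: cb|exact: cb].
    by apply: cts_comp (@cts_ramp M); cts; [exact: ca|exact: cz].
  + exact: cz.
  + by move=> x _; exact: z0.
  + by move=> x Ex zx; rewrite subr_lt0 hM.
  by exists C => D CD _; apply: hC.
pose C : R := `|C1| + 1.
have C1' : 1 <= C by rewrite lerDr.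
have {hC1} hC i j x : i != j -> E i x ->
    ramp M (a j x + zeta j x) * b i x <= b_ C j x.
  move=> ij Ex; rewrite -lerBlDl; apply: (hC1 C _ (i, j)) => //=.
  by rewrite (le_trans (ler_norm _))// lerDl.
have [D1 hD1] : exists D, forall D', D <= D' -> forall i x, E i x -> b i x <= D'.
  apply: fin_large => i.
  have [| | | |D _ hD] := @compact_dominated R _ _ (b i) (fun=> 1) (@cE i).
  + exact: cb.
  + exact: cts_cst.
  + by [].
  + by move=> x _ /eqP; rewrite oner_eq0.
  by exists D => D' DD' x Ex; rewrite -[D']mulr1 hD.
pose D : R := `|D1| + 1.
have {hD1} hD : forall i x, E i x -> b i x <= D.
  by apply: hD1; rewrite (le_trans (ler_norm _))// lerDl.
have D1' : 1 <= D by rewrite lerDr.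
have D0 : 0 < D by rewrite (lt_le_trans ltr01).
have b_0 i x : x != 0 -> 0 < b_ C i x.
  move=> x0; apply: (lt_le_trans (bz0 i x0)); rewrite lerD2l.
  by rewrite ler_peMl.
pose gi i x : R := ramp M (a i x + zeta i x) / b_ C i x.
have cgi i : continuous (gi i).
  move=> x; have [->|x0] := eqVneq x 0.
    have h0 : \forall y \near (0 : V), gi i y = 0.
      have : \forall y \near (0 : V), a i y + zeta i y < 2^-1.
        apply: near_lt; first by cts; [exact: ca|exact: cz].
        by rewrite a00 z00 addr0 invr_gt0.
      apply: filterS => y hy; rewrite /gi ramp0 ?mul0r//.
      by rewrite (@le_trans _ _ (2 * (1 - 2^-1)))//; nra.
    exact: near_cst_continuous h0.
  have cr : continuous (fun x => ramp M (a i x + zeta i x)).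
    by apply: cts_comp (@cts_ramp M); cts; [exact: ca|exact: cz].
  have cbC : continuous (b_ C i).
    by rewrite /b_; cts; [exact: cb|exact: cz].
  suff : {for x, continuous (fun x => ramp M (a i x + zeta i x) * (b_ C i x)^-1)} by [].
  apply: continuousM; first exact: cr.
  by apply: continuousV; [rewrite gt_eqF// b_0|exact: cbC].
have ray i y : ray_incr (fun k => k * gi i (k *: y)).
  have eqF k : 0 <= k -> k * gi i (k *: y) = ramp M (k * (a i y + zeta i y)) / b_ C i y.
    rewrite /gi le_eqVlt => /predU1P[<-|k0].
      by rewrite !mul0r ramp0 ?mul0r// subr0 mulr1; lra.
    rewrite /b_ ha ?ltW// hb ?ltW// hz ?ltW// -mulrDr.
    by rewrite [C * _]mulrCA -mulrDr invfM mulrCA mulVKf ?gt_eqF.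
  move=> k l k0 kl; have l0 : 0 <= l by rewrite (le_trans k0)// ltW.
  rewrite !eqF//.
  have [->|y0] := eqVneq y 0.
    by rewrite a00 z00 addr0 !mulr0 ramp0 ?mul0r ?ltxx// subr0 mulr1; lra.
  have [h1 h2] : ramp M (k * (a i y + zeta i y)) <= ramp M (l * (a i y + zeta i y)) /\
     (0 < ramp M (k * (a i y + zeta i y)) ->
       ramp M (k * (a i y + zeta i y)) < ramp M (l * (a i y + zeta i y))).
    by apply: ramp_incr => //; rewrite ltr_pM2r// az0.
  have bi := b_0 i y y0; rewrite ler_pM2r ?invr_gt0//; split=> //.
  by rewrite pmulr_lgt0 ?invr_gt0// ltr_pM2r ?invr_gt0.
have gi_ge0 i x : 0 <= gi i x.
  by rewrite divr_ge0 ?ramp_ge0// addr_ge0// mulr_ge0// (le_trans ler01).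
(* The floor keeps [g] positive where all terms vanish, and supplies the strict growth and the
   unboundedness on rays. *)
pose g x : R := Num.max D^-1 (Num.max (gi 0 x) (Num.max (gi 1 x) (gi 2 x))).
have cg : continuous g by rewrite /g; cts; exact: cgi.
have gD x : D^-1 <= g x by rewrite le_max lexx.
have gE i x : E i x -> g x = (b i x)^-1.
  move=> Ex; have bi := E_b Ex.
  have gix : gi i x = (b i x)^-1.
    by rewrite /gi Ex.1 Ex.2 addr0 ramp1 mul1r /b_ Ex.1 mulr0 addr0.
  have gj j : gi j x <= (b i x)^-1.
    have [->|ji] := eqVneq j i; first by rewrite gix.
    have bj := b_0 j x (E_neq0 Ex).
    rewrite /gi ler_pdivrMr// mulrC ler_pdivlMr//.
    by apply: hC => //; rewrite eq_sym.
  apply: le_anti; rewrite !ge_max !gj !andbT lef_pV2 ?posrE// hD//=.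
  by rewrite -gix !le_max; elim/ord3P: i {Ex bi gix gj}; rewrite lexx ?orbT.
have g_incr (y : V) k l : 0 <= k -> k < l -> k * g (k *: y) < l * g (l *: y).
  move=> k0 kl; have l0 : 0 < l by rewrite (le_lt_trans k0).
  have r3 := ray_incr_max (ray 0 y) (ray_incr_max (ray 1 y) (ray 2 y)).
  have [h1 h2] := r3 k l k0 kl.
  rewrite /g !maxr_pMr ?(ltW l0)//.
  move: h1 h2; set u := Num.max (k * gi 0 _) _; set v := Num.max (l * gi 0 _) _ => h1 h2.
  rewrite gt_max !lt_max ltr_pM2r ?invr_gt0// kl /=.
  move: k0; rewrite le_eqVlt => /predU1P[k0|k0].
    have -> : u = 0 by rewrite /u -k0 !mul0r !maxxx.
    by rewrite mulr_gt0 ?invr_gt0.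
  have [u0|u0] := leP u 0.
    by rewrite (le_lt_trans u0)// mulr_gt0 ?invr_gt0.
  by have := h2 u0; rewrite /v !lt_max => ->; rewrite orbT.
pose H t x : V := (1 - t + t * g x) *: x.
exists H; split.
- by rewrite /H; cts.

- move=> t /andP[t0 t1]; apply: radial_homeomorphism.
  + by cts.
  + move=> y k l k0 kl; have := g_incr y k l k0 kl.
    rewrite ![_ * (1 - t + _)]mulrDr ![_ * (t * _)]mulrCA => h.
    move: t0; rewrite le_eqVlt => /predU1P[<-|t0].
      by rewrite !mul0r !addr0 subr0 !mulr1.
    apply: ler_ltD; last by rewrite ltr_pM2l.
    by rewrite ler_wpM2r ?subr_ge0// ltW.
  + move=> y; exists D; first exact: ltW.
    have h := gD (D *: y).
    have : 1 <= D * g (D *: y) by rewrite -ler_pdivrMl// mulr1.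
    by move: (g _) => v hv; nra.
- by move=> x; rewrite /H subr0 mul0r addr0 scale1r.
- apply/seteqP; split=> y /=.
    move=> [x [i _ Ex] <-]; exists i => //; have bi := E_b Ex.
    rewrite /H subrr add0r mul1r (gE _ _ Ex); split.
      by rewrite hz ?Ex.1 ?mulr0// invr_ge0 ltW.
    by rewrite hb ?mulVf ?gt_eqF// invr_ge0 ltW.
  move=> [i _ [zy by1]].
  have y0 : y != 0.
    by apply/eqP => y0; move/eqP: by1; rewrite y0 b00 eq_sym oner_eq0.
  have ay : 0 < a i y by have := az0 i y0; rewrite zy addr0.
  have Ex : E i ((a i y)^-1 *: y).
    split; first by rewrite hz ?zy ?mulr0// invr_ge0 ltW.
    by rewrite ha ?mulVf ?gt_eqF// invr_ge0 ltW.
  exists ((a i y)^-1 *: y); first by exists i.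
  rewrite /H subrr add0r mul1r (gE _ _ Ex) hb ?invr_ge0 ?ltW// by1 mulr1.
  by rewrite invrK scalerA mulfV ?gt_eqF// scale1r.
Qed.

End RadialIsotopy.

(** * Paths in the general linear group *)

Section LinearIsotopy.
Variable R : realType.

Definition sign_diagonal n (D : 'M[R]_n) :=
  exists d : 'rV[R]_n, (forall i, d 0 i ^+ 2 = 1) /\ D = diag_mx d.

(* The rings are invariant under sign changes of the coordinates, so a path
   from A to a sign matrix is enough. *)
Definition signable n (A : 'M[R]_n) := exists P : R -> 'M[R]_n,
  [/\ continuous P, forall t, 0 <= t <= 1 -> P t \in unitmx,
      P 0 = A & sign_diagonal (P 1)].

Lemma sign_diagonal_mul n (C D : 'M[R]_n) :
  sign_diagonal C -> sign_diagonal D -> sign_diagonal (C *m D).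
Proof.
move=> [c [c1 ->]] [d [d1 ->]]; exists (\row_j (c 0 j * d 0 j)); split.
  by move=> i; rewrite mxE exprMn c1 d1 mulr1.
by rewrite mulmx_diag.
Qed.

Lemma signable_mul n (A B : 'M[R]_n) :
  signable A -> signable B -> signable (A *m B).
Proof.
move=> [P [cP uP <- P1]] [Q [cQ uQ <- Q1]]; exists (fun t => P t *m Q t); split=> //.
- by cts.
- by move=> t t01; rewrite unitmx_mul uP ?uQ.
- exact: sign_diagonal_mul.
Qed.

Lemma signable_tr n (A : 'M[R]_n) : signable A -> signable A^T.
Proof.
move=> [P [cP uP <- [d [d1 P1]]]]; exists (fun t => (P t)^T); split=> //.
- apply: cts_mx => i j; under eq_fun do rewrite mxE; exact: cts_coord.
- by move=> t t01; rewrite unitmx_tr uP.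
- by exists d; split=> //; rewrite P1 tr_diag_mx.
Qed.

(** The segment to the diagonal matrix of signs stays triangular, and its diagonal entries keep
    their signs. *)
Lemma signable_trig n (A : 'M[R]_n) :
  is_trig_mx A -> (forall i, A i i != 0) -> signable A.
Proof.
move=> /is_trig_mxP tA A0; pose d := \row_i Num.sg (A i i).
exists (fun t => (1 - t) *: A + t *: diag_mx d); split.
- by cts.
- move=> t /andP[t0 t1]; rewrite unitmxE det_trig.
    rewrite unitfE; apply/prodf_neq0 => i _; rewrite !mxE eqxx mulr1n.
    have [Ai|Ai|/eqP] := ltgtP (A i i) 0; last by rewrite (negPf (A0 i)).
      by rewrite ltr0_sg//; apply/negP => /eqP; nra.
    by rewrite gtr0_sg//; apply/negP => /eqP; nra.
  apply/is_trig_mxP => i j ij; rewrite !mxE tA// mulr0 add0r.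
  have /negPf -> : i != j by rewrite -val_eqE /= neq_ltn ij.
  by rewrite mulr0.
- by rewrite subr0 scale1r scale0r addr0.
- exists d; rewrite subrr scale0r add0r scale1r; split=> // i.
  by rewrite mxE sqr_sg A0.
Qed.

Lemma signable_transvection n (i j : 'I_n) (c : R) :
  i != j -> signable (1%:M + c *: delta_mx i j).
Proof.
wlog ij : i j / (j < i)%N.
  move=> h ij; have : (i < j)%N || (j < i)%N by rewrite -neq_ltn.
  case/orP => lt; last exact: h.
  have -> : 1%:M + c *: delta_mx i j = (1%:M + c *: delta_mx j i)^T.
    by rewrite linearD/= linearZ/= trmx1 trmx_delta.
  by apply: signable_tr; apply: h => //; rewrite eq_sym.
move=> nij; apply: signable_trig.
  apply/is_trig_mxP => k l kl; rewrite !mxE.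
  have /negPf -> : k != l by rewrite -val_eqE /= neq_ltn kl.
  have [ki|_] := eqVneq k i; have [lj|_] := eqVneq l j; rewrite ?mulr0 ?add0r//.
  by move: kl; rewrite ki lj ltnNge ltnW.
move=> k; rewrite !mxE eqxx.
have [ki|_] := eqVneq k i; have [kj|_] := eqVneq k j; rewrite ?mulr0 ?addr0 ?oner_eq0//.
by move: nij; rewrite -ki -kj eqxx.
Qed.

Lemma signable_diag n (d : 'rV[R]_n) :
  (forall i, d 0 i != 0) -> signable (diag_mx d).
Proof.
move=> d0; apply: signable_trig; first by apply: diag_mx_is_trig.
by move=> i; rewrite mxE eqxx mulr1n.
Qed.

(** Three transvections compose to a quarter turn in the plane of [i] and [j]; one sign change makes
    it a transposition. *)
Lemma signable_tperm n (i j : 'I_n) : i != j -> signable (tperm_mx i j : 'M[R]_n).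
Proof.
move=> ij.
have -> : tperm_mx i j = (1%:M + 1 *: delta_mx i j) *m (1%:M + (-1) *: delta_mx j i)
    *m (1%:M + 1 *: delta_mx i j) *m diag_mx (\row_k (if k == i then -1 else 1)) :> 'M[R]_n.
  rewrite !scale1r scaleN1r.
  rewrite mulmxDl mul1mx !mulmxDr !mulmxDl !mul1mx !mulmx1 !mulmxN !mulNmx.
  rewrite !mul_delta_mx_cond !eqxx !mulr1n !mul_delta_mx_cond !eqxx.
  rewrite [j == i]eq_sym (negPf ij) !mulr1n mulr0n mul0mx add0r !mul_mx_diag.
  apply/matrixP => k l; rewrite !mxE.
  case: tpermP => [->|->|/eqP ki /eqP kj].
  - rewrite !eqxx (negPf ij) (eq_sym j l) (eq_sym i l) /=.
    have [->|li] := eqVneq l i; first by rewrite (negPf ij) /=; ring.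
    by case: (l == j) => /=; ring.
  - rewrite !eqxx [j == i]eq_sym (negPf ij) (eq_sym i l) (eq_sym j l) /=.
    have [->|li] := eqVneq l i; first by rewrite (negPf ij) /=; ring.
    by case: (l == j) => /=; ring.
  - rewrite (negPf ki) (negPf kj) /=.
    have [<-|lk] := eqVneq k l; last by rewrite /=; ring.
    by rewrite (negPf ki) /=; ring.
apply: signable_mul; last first.
  by apply: signable_diag => k; rewrite mxE; case: ifP => _; rewrite ?oppr_eq0 oner_eq0.
apply: signable_mul; last exact: signable_transvection.
by apply: signable_mul; apply: signable_transvection; rewrite // eq_sym.
Qed.

Lemma signable_perm n (s : 'S_n) : signable (perm_mx s : 'M[R]_n).
Proof.
have [ts -> ts_dpair] := prod_tpermP s.
elim: ts ts_dpair => [_|[i j] ts IH /= /andP[ij /IH {}IH]].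
  rewrite big_nil perm_mx1 -[1%:M]addr0 -(scale0r 1%:M).
  have -> : 1%:M + 0 *: 1%:M = diag_mx (const_mx 1) :> 'M[R]_n.
    by rewrite scale0r addr0 diag_const_mx.
  by apply: signable_diag => i; rewrite mxE oner_eq0.
rewrite big_cons perm_mxM; apply: signable_mul => //.
exact: signable_tperm.
Qed.

(** By the LUP decomposition, whose three factors are signable. *)
Lemma unitmx_signable n (A : 'M[R]_n.+1) : A \in unitmx -> signable A.
Proof.
move=> uA; have := cormen_lup_correct A; have := cormen_lup_perm A.
have := @cormen_lup_upper _ _ A; have := cormen_lup_detL A.
have := @cormen_lup_lower _ _ A.
case: (cormen_lup A) => [[P L] U] /= lowL detL upU /is_perm_mxP[s Ps] PALU.
have {PALU} AE : A = perm_mx s^-1 *m L *m U.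
  rewrite -mulmxA -[L *m U]PALU Ps mulmxA -perm_mxM mulVg perm_mx1.
  by rewrite mul1mx.
have uU : U \in unitmx by move: uA; rewrite AE unitmx_mul => /andP[].
rewrite AE; apply: signable_mul; first apply: signable_mul.
- exact: signable_perm.
- apply: signable_trig => [|i]; last by rewrite lowL// eqxx oner_eq0.
  apply/is_trig_mxP => i j ij; rewrite (lowL i j (ltnW ij)).
  suff /negPf -> : i != j by [].
  by rewrite -val_eqE /= neq_ltn ij.
- rewrite -[U]trmxK; apply: signable_tr.
  have trigU : is_trig_mx U^T by apply/is_trig_mxP => i j ij; rewrite mxE upU.
  apply: signable_trig => // i; move: uU.
  rewrite -unitmx_tr unitmxE det_trig// unitfE => /prodf_neq0; exact.
Qed.

(** Composing the path with [invmx A] makes it start at the identity; the image of [K] under [A]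
    then moves through its images under [P t], and the last one is [K]. *)
Lemma linear_isotopic (A : 'M[R]_3) (K : set 'rV[R]_3) : A \in unitmx ->
  (forall D, sign_diagonal D -> (fun x => x *m D) @` K = K) ->
  isotopic ((fun x => x *m A) @` K) K.
Proof.
move=> uA KD; have [P [cP uP P0 sP]] := unitmx_signable uA.
exists (fun t x => x *m (invmx A *m P t)); split.
- by cts.
- move=> t /uP Pt; split; first by cts.
  exists (fun x => x *m invmx (invmx A *m P t)).
  have u : invmx A *m P t \in unitmx by rewrite unitmx_mul unitmx_inv uA Pt.
  split; last by cts.
  + by move=> x; rewrite mulmxK.
  + by move=> x; rewrite mulmxKV.
- by move=> x; rewrite P0 mulVmx// mulmx1.
- rewrite -{2}(KD _ sP) image_comp; congr image; apply/funext => x /=.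
  by rewrite mulmxA mulmxK.
Qed.

End LinearIsotopy.

(** * Ellipses in affine frames *)

Section Frames.
Variable R : realType.
Local Notation V := 'rV[R]_3.

(* An ellipse is the preimage of the unit circle of the xy-plane under an affine
   isomorphism [frame c N]. *)
Definition frame (c : V) (N : 'M[R]_3) (p : V) : V := (p - c) *m N.

Definition circ c N : set V := [set p | frame c N p 0 2 = 0 /\
  frame c N p 0 0 ^+ 2 + frame c N p 0 1 ^+ 2 = 1].
Definition dsk c N : set V := [set p | frame c N p 0 2 = 0 /\
  frame c N p 0 0 ^+ 2 + frame c N p 0 1 ^+ 2 <= 1].
Definition pln c N : set V := [set p | frame c N p 0 2 = 0].

Lemma entryD m n (A B : 'M[R]_(m, n)) i j : (A + B) i j = A i j + B i j.
Proof. by rewrite mxE. Qed.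

Lemma entryN m n (A : 'M[R]_(m, n)) i j : (- A) i j = - A i j.
Proof. by rewrite mxE. Qed.

Lemma entryZ m n a (A : 'M[R]_(m, n)) i j : (a *: A) i j = a * A i j.
Proof. by rewrite mxE. Qed.

Lemma frameD (c : V) N m v : frame c N (m + v) = frame c N m + v *m N.
Proof. by rewrite /frame -mulmxDl addrAC. Qed.

Lemma row3P (v w : V) : v 0 0 = w 0 0 -> v 0 1 = w 0 1 -> v 0 2 = w 0 2 -> v = w.
Proof. by move=> v0 v1 v2; apply/rowP; elim/ord3P. Qed.

Lemma direction_gt0 (N : 'M[R]_3) (v : V) : N \in unitmx -> v != 0 ->
  (v *m N) 0 2 = 0 -> 0 < (v *m N) 0 0 ^+ 2 + (v *m N) 0 1 ^+ 2.
Proof.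
move=> uN v0 v2; rewrite lt_neqAle addr_ge0 ?sqr_ge0// andbT eq_sym.
rewrite paddr_eq0 ?sqr_ge0// !sqrf_eq0; apply: contra v0 => /andP[/eqP e0 /eqP e1].
have : v *m N = 0 by apply: row3P; rewrite [RHS]mxE.
by move=> /(congr1 (mulmx^~ (invmx N))); rewrite mul0mx mulmxK// => ->.
Qed.

Lemma rigid_affine (f : V -> V) : rigid f ->
  exists A c, A \in unitmx /\ f = fun x => x *m A + c.
Proof.
elim=> [c A AA _|v|c u uu|g h _ [A [c [uA ->]]] _ [B [d [uB ->]]]].
- exists A, (c - c *m A); split; first by case: (mulmx1_unit AA).
  by apply/funext => x; rewrite mulmxBl addrA addrAC.
- exists 1%:M, v; split; first exact: unitmx1.
  by apply/funext => x; rewrite mulmx1.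
- have dotE (v w : V) : v *m w^T = (dot v w)%:M.
    by rewrite [LHS]mx11_scalar mxE; congr (_%:M); apply: eq_bigr => i _; rewrite mxE.
  exists (1%:M - 2 *: (u^T *m u)), ((2 * dot c u) *: u); split.
    (* The linear part of a reflection is its own inverse. *)
    apply: (@mulmx1_unit _ _ _ (1%:M - 2 *: (u^T *m u)) _).1.
    rewrite mulmxBl mul1mx mulmxBr mulmx1 -scalemxAl -scalemxAr scalerA.
    rewrite mulmxA -(mulmxA u^T) dotE uu mulmx1 opprB.
    rewrite -[RHS]addr0 -addrA; congr (_ + _).
    rewrite -scalerBl -scaleNr -scalerDl.
    by apply/eqP; rewrite scaler_eq0; apply/orP; left; apply/eqP; ring.
  apply/funext => x; rewrite mulmxBr mulmx1 -scalemxAr mulmxA dotE mul_scalar_mx.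
  rewrite scalerA -addrA; congr (_ + _).
  have -> : dot (x - c) u = dot x u - dot c u.
    by rewrite /dot -sumrB; apply: eq_bigr => i _; rewrite !mxE mulrBl.
  by rewrite mulrBr scalerBl opprB addrC.
- exists (B *m A), (d *m A + c); split; first by rewrite unitmx_mul uA uB.
  by apply/funext => x /=; rewrite mulmxDl -mulmxA addrA.
Qed.

(** The frame undoes the motion and divides the coordinates by the half-axes. *)
Lemma ellipse_frame (e : ellipse R) : exists c N, [/\ N \in unitmx,
  curve e = circ c N, disk e = dsk c N & plane e = pln c N].
Proof.
have [A [c [uA mE]]] := rigid_affine (motion_rigid e).
have a0 := axis1_neq0 e; have b0 := axis2_neq0 e.
pose d : V := \row_i (if i == 0 then (axis1 e)^-1 else if i == 1 then (axis2 e)^-1 else 1).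
have d0 i : d 0 i != 0 by rewrite mxE; do ?case: ifP; rewrite ?invr_eq0 ?oner_eq0.
exists c, (invmx A *m diag_mx d); split.
- rewrite unitmx_mul unitmx_inv uA /= unitmxE det_diag unitfE.
  exact/prodf_neq0.
- rewrite /curve mE; apply/seteqP; split=> p /=.
    move=> [q [q2 qE] <-]; rewrite /circ /frame /= addrK mulmxA mulmxK//.
    by rewrite mul_mx_diag !mxE /= q2 mul0r !exprMn !exprVn.
  rewrite /circ /frame /= mulmxA.
  have [q qE] : exists q, q = (p - c) *m invmx A by eexists.
  rewrite -qE mul_mx_diag !mxE /= mulr1 !exprMn !exprVn => -[? ?].
  exists q; first by [|split].
  by rewrite qE mulmxKV ?subrK.
- rewrite /disk mE; apply/seteqP; split=> p /=.
    move=> [q [q2 qE] <-]; rewrite /dsk /frame /= addrK mulmxA mulmxK//.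
    by rewrite mul_mx_diag !mxE /= q2 mul0r !exprMn !exprVn.
  rewrite /dsk /frame /= mulmxA.
  have [q qE] : exists q, q = (p - c) *m invmx A by eexists.
  rewrite -qE mul_mx_diag !mxE /= mulr1 !exprMn !exprVn => -[? ?].
  exists q; first by [|split].
  by rewrite qE mulmxKV ?subrK.
- rewrite /plane mE; apply/seteqP; split=> p /=.
    move=> [q q2 <-]; rewrite /pln /frame /= addrK mulmxA mulmxK//.
    by rewrite mul_mx_diag !mxE /= q2 mul0r.
  rewrite /pln /frame /= mulmxA.
  have [q qE] : exists q, q = (p - c) *m invmx A by eexists.
  rewrite -qE mul_mx_diag !mxE /= mulr1 => ?.
  exists q; first by [|split].
  by rewrite qE mulmxKV ?subrK.
Qed.

End Frames.

(** * Links with a triple point and cyclic piercing *)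

Section Gauge.
Variable R : realType.
Implicit Types h v : R.

(* Minkowski functional of the closed unit disk about its interior point
   (h0, h1). *)
Definition gauge h0 h1 v0 v1 : R :=
  (h0 * v0 + h1 * v1 + Num.sqrt ((h0 * v0 + h1 * v1) ^+ 2 +
    (1 - h0 ^+ 2 - h1 ^+ 2) * (v0 ^+ 2 + v1 ^+ 2))) / (1 - h0 ^+ 2 - h1 ^+ 2).

Section Fixed.
Variables h0 h1 : R.
Hypothesis h_lt1 : h0 ^+ 2 + h1 ^+ 2 < 1.

Let D_gt0 : 0 < 1 - h0 ^+ 2 - h1 ^+ 2.
Proof. by move: h_lt1; lra. Qed.

Lemma gauge_ge0 v0 v1 : 0 <= gauge h0 h1 v0 v1.
Proof.
rewrite /gauge divr_ge0 ?(ltW D_gt0)//.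
set u := h0 * v0 + h1 * v1.
have : `|u| <= Num.sqrt (u ^+ 2 + (1 - h0 ^+ 2 - h1 ^+ 2) * (v0 ^+ 2 + v1 ^+ 2)).
  rewrite -sqrtr_sqr; apply: ler_wsqrtr; rewrite lerDl mulr_ge0 ?(ltW D_gt0)//.
  by rewrite addr_ge0// sqr_ge0.
by have := ler_norm (- u); rewrite normrN; lra.
Qed.

Lemma gauge_gt0 v0 v1 : 0 < v0 ^+ 2 + v1 ^+ 2 -> 0 < gauge h0 h1 v0 v1.
Proof.
move=> v_gt0; rewrite /gauge divr_gt0//.
set u := h0 * v0 + h1 * v1.
have : `|u| < Num.sqrt (u ^+ 2 + (1 - h0 ^+ 2 - h1 ^+ 2) * (v0 ^+ 2 + v1 ^+ 2)).
  by rewrite -sqrtr_sqr ltr_sqrt ?ltrDl ?mulr_gt0// ltr_wpDl ?sqr_ge0// mulr_gt0.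
by have := ler_norm (- u); rewrite normrN; lra.
Qed.

Lemma gaugeZ k v0 v1 : 0 <= k ->
  gauge h0 h1 (k * v0) (k * v1) = k * gauge h0 h1 v0 v1.
Proof.
move=> k0; rewrite /gauge [RHS]mulrA; congr (_ / _).
have -> : (h0 * (k * v0) + h1 * (k * v1)) ^+ 2 + (1 - h0 ^+ 2 - h1 ^+ 2) *
   ((k * v0) ^+ 2 + (k * v1) ^+ 2) = k ^+ 2 * ((h0 * v0 + h1 * v1) ^+ 2 +
    (1 - h0 ^+ 2 - h1 ^+ 2) * (v0 ^+ 2 + v1 ^+ 2)) by ring.
by rewrite sqrtrM ?sqr_ge0// sqrtr_sqr ger0_norm//; ring.
Qed.

(** With [s] the square root, [D] times the left side is [(D - u + s) * (D - u - s)]. The first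
    factor is positive and the second is [D] times [1 - gauge], so all comparisons of the gauge with
    1 follow. *)
Lemma gauge_factor v0 v1 : exists2 d, 0 < d &
  1 - (h0 + v0) ^+ 2 - (h1 + v1) ^+ 2 = d * (1 - gauge h0 h1 v0 v1).
Proof.
set u := h0 * v0 + h1 * v1; set D := 1 - h0 ^+ 2 - h1 ^+ 2.
set w := v0 ^+ 2 + v1 ^+ 2.
have w0 : 0 <= w by rewrite addr_ge0 ?sqr_ge0.
have s2 : Num.sqrt (u ^+ 2 + D * w) ^+ 2 = u ^+ 2 + D * w.
  by rewrite sqr_sqrtr// addr_ge0 ?sqr_ge0// mulr_ge0// ltW.
have us : `|u| <= Num.sqrt (u ^+ 2 + D * w).
  by rewrite -sqrtr_sqr; apply: ler_wsqrtr; rewrite lerDl mulr_ge0 ?(ltW D_gt0).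
have us' : u <= Num.sqrt (u ^+ 2 + D * w) by rewrite (le_trans (ler_norm _)).
exists (D - u + Num.sqrt (u ^+ 2 + D * w)).
  by have := D_gt0; rewrite -/D; lra.
rewrite /gauge -/u -/D -/w; set s := Num.sqrt _ in s2 us us' *.
have -> : 1 - (h0 + v0) ^+ 2 - (h1 + v1) ^+ 2 = D - 2 * u - w by rewrite /D /u /w; ring.
apply: (@mulfI _ D); first by rewrite gt_eqF.
have -> : D * ((D - u + s) * (1 - (u + s) / D)) = (D - u + s) * (D - u - s).
  by field; rewrite gt_eqF.
have -> : (D - u + s) * (D - u - s) = (D - u) ^+ 2 - s ^+ 2 by ring.
by rewrite s2; ring.
Qed.

Lemma gauge_lt1 v0 v1 :
  (gauge h0 h1 v0 v1 < 1) = ((h0 + v0) ^+ 2 + (h1 + v1) ^+ 2 < 1).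
Proof.
have [d d0 dE] := gauge_factor v0 v1.
by rewrite -subr_gt0 -(pmulr_rgt0 _ d0) -dE -[RHS]subr_gt0 opprD addrA.
Qed.

Lemma gauge_le1 v0 v1 :
  (gauge h0 h1 v0 v1 <= 1) = ((h0 + v0) ^+ 2 + (h1 + v1) ^+ 2 <= 1).
Proof.
have [d d0 dE] := gauge_factor v0 v1.
by rewrite -subr_ge0 -(pmulr_rge0 _ d0) -dE -[RHS]subr_ge0 opprD addrA.
Qed.

Lemma gauge_eq1 v0 v1 :
  gauge h0 h1 v0 v1 = 1 <-> (h0 + v0) ^+ 2 + (h1 + v1) ^+ 2 = 1.
Proof.
split=> /eqP h; apply/eqP.
  by rewrite eq_le [1 <= _]leNgt -gauge_le1 -gauge_lt1 (eqP h) lexx ltxx.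
by rewrite eq_le [1 <= _]leNgt gauge_le1 gauge_lt1 (eqP h) lexx ltxx.
Qed.

Lemma cts_gauge (T : topologicalType) (f g : T -> R) :
  continuous f -> continuous g -> continuous (fun x => gauge h0 h1 (f x) (g x)).
Proof. by move=> cf cg; rewrite /gauge; cts. Qed.

End Fixed.
End Gauge.

Section Circles.
Variable R : realType.
Local Notation V := 'rV[R]_3.

Lemma coord_bound_compact (S : set V) (M : R) : closed S ->
  (forall x, S x -> forall i, `|x 0 i| <= M) -> compact S.
Proof.
move=> cS bS; apply: bounded_closed_compact => //.
exists (`|M|); split; first exact: num_real.
move=> N MN x Sx; rewrite /= [X in X <= _]mx_normrE; apply: bigmax_le.
  by rewrite (le_trans (normr_ge0 M))// ltW.
by move=> [j i] _; rewrite ord1 /= (le_trans (bS x Sx i))// (le_trans (ler_norm M))// ltW.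
Qed.

Lemma compact_circ (c : V) N : N \in unitmx -> compact (circ c N).
Proof.
move=> uN.
pose S : set V := [set q | q 0 2 = 0] `&` [set q | q 0 0 ^+ 2 + q 0 1 ^+ 2 = 1].
have cS : compact S.
  apply: (@coord_bound_compact _ 1).
    by apply: closedI; apply: closed_fun_eq; cts.
  move=> x [/= x2 x01] i.
  rewrite -(@ler_pXn2r _ 2)// ?nnegrE// expr1n real_normK ?num_real//.
  have h (j : 'I_3) : j = 0 \/ j = 1 \/ j = 2.
    by case: j => -[|[|[|//]]] hj; [left|right; left|right; right]; exact: val_inj.
  have := sqr_ge0 (x 0 0); have := sqr_ge0 (x 0 1).
  by have [->|[->|->]] := h i; rewrite ?x2; lra.
have -> : circ c N = (fun q => q *m invmx N + c) @` S.
  apply/seteqP; split=> x /=.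
    by move=> Cx; exists (frame c N x) => //; rewrite /frame mulmxK// subrK.
  by move=> [q Sq <-]; rewrite /circ /frame /= addrK mulmxKV.
apply: continuous_compact => //; apply: continuous_subspaceT; cts.
Qed.

End Circles.

Section Rings.
Variable R : realType.
Local Notation V := 'rV[R]_3.

Definition ring_gauge (i : 'I_3) (x : V) : R :=
  Num.sqrt (x 0 i ^+ 2 / 4 + x 0 (i + 1) ^+ 2).

(* Indices are taken modulo 3: the ring i lies in the plane where coordinate
   i - 1 vanishes, and its disk pierces the disk of the ring i + 1. *)
Definition ring3 (i : 'I_3) : set V :=
  [set x | x 0 (i - 1) = 0 /\ x 0 i ^+ 2 / 4 + x 0 (i + 1) ^+ 2 = 1].

Lemma borromean_ringsE : @borromean_rings R = \bigcup_i ring3 i.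
Proof.
apply/seteqP; split=> x /=.
  by move=> [[|]|] h; [exists 0|exists 1|exists 2]; rewrite // /ring3 /= !ord3_num.
move=> [i _]; elim/ord3P: i; rewrite /ring3 /= !ord3_num => h.
- by left; left.
- by left; right.
- by right.
Qed.

End Rings.

Section Sufficiency.
Variable R : realType.
Local Notation V := 'rV[R]_3.

Lemma ring_gauge0 (i : 'I_3) (k : R) (x : V) :
  0 <= k -> ring_gauge i (k *: x) = k * ring_gauge i x.
Proof.
move=> k0; rewrite /ring_gauge !mxE !exprMn -[k ^+ 2 * _ / _]mulrA -mulrDr.
by rewrite sqrtrM ?sqr_ge0// sqrtr_sqr ger0_norm.
Qed.

Lemma isotopic_translation (v : V) (K : set V) :
  isotopic ((fun x => x + v) @` K) K.
Proof.
exists (fun t x => x - t *: v); split.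
- by cts.
- move=> t _; split; first by cts.
  exists (fun x => x + t *: v); split; last by cts.
  + by move=> x; rewrite subrK.
  + by move=> x; rewrite addrK.
- by move=> x; rewrite scale0r subr0.
- rewrite image_comp -[RHS]image_id; congr image; apply/funext => x /=.
  by rewrite scale1r addrK.
Qed.

Lemma sign_diagonal_ring3 (D : 'M[R]_3) : sign_diagonal D ->
  (fun x => x *m D) @` (\bigcup_i @ring3 R i) = \bigcup_i @ring3 R i.
Proof.
move=> [d [d1 ->]].
have dd (x : V) : x *m diag_mx d *m diag_mx d = x.
  by apply/rowP => i; rewrite !mul_mx_diag !mxE -mulrA -expr2 d1 mulr1.
have inv i (x : V) : ring3 i x -> ring3 i (x *m diag_mx d).
  rewrite /ring3 /= => -[x0 x1]; rewrite mul_mx_diag !mxE x0 mul0r.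
  by rewrite !exprMn !d1 !mulr1.
apply/seteqP; split=> x /=; first by move=> [y [i _ yi] <-]; exists i => //; exact: inv.
move=> [i _ xi]; exists (x *m diag_mx d); last by [].
by exists i => //; exact: inv.
Qed.

Section Frames.
Variables (c : 'I_3 -> V) (N : 'I_3 -> 'M[R]_3) (p : V).
Hypothesis uN : forall i, N i \in unitmx.
Let w i := frame (c i) (N i).
Hypothesis p2 : forall i, w i p 0 2 = 0.
Hypothesis p01 : forall i, w i p 0 0 ^+ 2 + w i p 0 1 ^+ 2 < 1.
Hypothesis p_unique : forall x, (forall i, dsk (c i) (N i) x) -> x = p.
Hypothesis disj : forall i x, dsk (c i) (N i) x ->
  ~ circ (c (i + 1)) (N (i + 1)) x.

(** The columns are normals of the three planes, shifted so that plane [i] becomes the vanishing of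
    coordinate [i - 1], as for [ring3]. *)
Let A : 'M[R]_3 := \matrix_(r, k) N (k + 1) r 2.

Let AE (v : V) k : (v *m A) 0 k = (v *m N (k + 1)) 0 2.
Proof. by rewrite !mxE; apply: eq_bigr => r _; rewrite !mxE. Qed.

Let AE' (v : V) i : (v *m N i) 0 2 = (v *m A) 0 (i - 1).
Proof. by rewrite AE subrK. Qed.

Let wD i (v : V) : w i (p + v) = w i p + v *m N i.
Proof. by rewrite /w /frame -mulmxDl addrAC. Qed.

(** A vector killed by [A] is parallel to all three planes; a short step along it from [p] stays in
    all three disks, against uniqueness. *)
Let uA : A \in unitmx.
Proof.
rewrite -row_free_unit -kermx_eq0; apply/negPn/negP => /rowV0Pn[v /sub_kermxP vA v0].
pose f i (k : R) := w i (p + k *: v) 0 0 ^+ 2 + w i (p + k *: v) 0 1 ^+ 2.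
have nf i : \forall k \near (0 : R), f i k < 1.
  apply: near_lt; first by rewrite /f /w /frame; cts.
  by rewrite /f scale0r addr0.
have [r /= r0 hr] := (nbhs_ballP (0 : R) _).1 (filterI (nf 0) (filterI (nf 1) (nf 2))).
have h i : f i (r / 2) < 1.
  have : ball 0 r (r / 2).
    by rewrite /ball /= sub0r normrN gtr0_norm ?divr_gt0// ltr_pdivrMr// ltr_pMr// ltr1n.
  by move=> /hr [f0 [f1 f2]]; elim/ord3P: i.
have {h}/p_unique/eqP : forall i, dsk (c i) (N i) (p + (r / 2) *: v).
  move=> i; split; last exact/ltW/h.
  rewrite -/(w i _) wD mxE p2 add0r -scalemxAl mxE AE' vA mxE mulr0.
  by [].
rewrite -subr_eq0 addrAC subrr add0r scaler_eq0 (negPf v0) orbF.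
by rewrite gt_eqF// divr_gt0.
Qed.

(** The gauge of disk [i] about [p], extended off its plane by ignoring the third frame
    coordinate. *)
Let a i (y : V) : R := gauge (w i p 0 0) (w i p 0 1)
  ((y *m invmx A *m N i) 0 0) ((y *m invmx A *m N i) 0 1).
Let zeta i (y : V) : R := `|y 0 (i - 1)|.
Let to (x : V) := (x - p) *m A.
Let from (y : V) := y *m invmx A + p.

Let fromK : cancel from to. Proof. by move=> y; rewrite /to /from addrK mulmxKV. Qed.
Let toK : cancel to from. Proof. by move=> y; rewrite /to /from mulmxK// subrK. Qed.

Let wfrom i y : w i (from y) = w i p + y *m invmx A *m N i.
Proof. by rewrite /from addrC wD. Qed.

Let wfrom2 i y : w i (from y) 0 2 = y 0 (i - 1).
Proof. by rewrite wfrom mxE p2 add0r AE' mulmxKV. Qed.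

Let wfrom01 i y : w i (from y) 0 0 ^+ 2 + w i (from y) 0 1 ^+ 2 =
  (w i p 0 0 + (y *m invmx A *m N i) 0 0) ^+ 2 +
  (w i p 0 1 + (y *m invmx A *m N i) 0 1) ^+ 2.
Proof. by rewrite wfrom [X in X ^+ 2 + _]mxE [X in _ + X ^+ 2]mxE. Qed.

Let zeta0 i y : zeta i y = 0 <-> w i (from y) 0 2 = 0.
Proof. by rewrite wfrom2 /zeta; split=> [/normr0_eq0//|->]; rewrite normr0. Qed.

Let circ_from i y : circ (c i) (N i) (from y) <-> zeta i y = 0 /\ a i y = 1.
Proof.
rewrite /circ /= -/(w i _) wfrom01; split=> -[/zeta0 h1 h2]; split=> //.
  exact/(gauge_eq1 (p01 i)).
exact/(gauge_eq1 (p01 i)).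
Qed.

Let az0 i y : y != 0 -> 0 < a i y + zeta i y.
Proof.
move=> y0; rewrite lt0r addr_ge0 ?normr_ge0 ?(gauge_ge0 (p01 i))// andbT.
apply/negP; rewrite paddr_eq0 ?normr_ge0 ?(gauge_ge0 (p01 i))// => /andP[a0 /eqP z0].
have y2 : (y *m invmx A *m N i) 0 2 = 0.
  by rewrite AE' mulmxKV//; apply/normr0_eq0.
have yA0 : y *m invmx A != 0.
  by apply: contra_neq y0 => /(congr1 (mulmx^~ A)); rewrite mul0mx mulmxKV.
have := gauge_gt0 (p01 i) (direction_gt0 (uN i) yA0 y2).
by rewrite -/(a i y) (eqP a0) ltxx.
Qed.

Let bz0 i (y : V) : y != 0 -> 0 < ring_gauge i y + zeta i y.
Proof.
move=> y0; rewrite lt0r addr_ge0 ?normr_ge0 ?sqrtr_ge0// andbT.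
apply/negP; rewrite paddr_eq0 ?normr_ge0 ?sqrtr_ge0// => /andP[].
rewrite /ring_gauge sqrtr_eq0 /zeta normr_eq0 => h /eqP z0.
move/negP: y0; apply; apply/eqP/rowP => j; rewrite [RHS]mxE.
have s0 := sqr_ge0 (y 0 i); have s1 := sqr_ge0 (y 0 (i + 1)).
have [ji|/ord3_cover[->|->]//] := eqVneq i j; last first.
  by apply/eqP; rewrite -sqrf_eq0; apply/eqP; lra.
by rewrite -ji; apply/eqP; rewrite -sqrf_eq0; apply/eqP; lra.
Qed.

Let caE i y : dsk (c i) (N i) (from y) <-> zeta i y = 0 /\ a i y <= 1.
Proof.
rewrite /dsk /= -/(w i _) wfrom01 -(gauge_le1 (p01 i)).
by split=> -[/zeta0 h1 h2].
Qed.

Let homZ i k y : 0 <= k -> zeta i (k *: y) = k * zeta i y.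
Proof. by move=> k0; rewrite /zeta mxE normrM ger0_norm. Qed.

Let homa i k y : 0 <= k -> a i (k *: y) = k * a i y.
Proof. by move=> k0; rewrite /a -!scalemxAl !entryZ gaugeZ. Qed.

(** Disk [i] misses curve [i + 1], so on a common ray curve [i + 1] lies farther out than curve [i].
    For [j = i - 1] the same is applied to disk [j]. *)
Let a_order i j y : i != j -> zeta i y = 0 -> a i y = 1 -> zeta j y = 0 ->
  if j == i + 1 then a j y < 1 else 1 < a j y.
Proof.
move=> ij zi ai zj.
have y0 : y != 0.
  apply/eqP => y0; move/eqP: ai; rewrite y0 -(scale0r 0) homa// mul0r.
  by rewrite eq_sym oner_eq0.
have aj : 0 < a j y by have := az0 j y0; rewrite zj addr0.
have ia : 0 <= (a j y)^-1 by rewrite invr_ge0 ltW.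
case: eqVneq => [jE|ji].
  rewrite ltNge; apply/negP => aj1.
  apply: (@disj i (from ((a j y)^-1 *: y))).
    apply/caE; rewrite homZ// zi mulr0; split=> //.
    by rewrite homa// ai mulr1 invf_le1.
  rewrite -jE; apply/circ_from; rewrite homZ// zj mulr0; split=> //.
  by rewrite homa// mulVf ?gt_eqF.
have ij' : i = j + 1.
  by have [jE|->] := ord3_cover ij; [rewrite jE eqxx in ji|rewrite subrK].
rewrite ltNge; apply/negP => aj1.
apply: (@disj j (from y)); first by apply/caE.
by rewrite -ij'; apply/circ_from.
Qed.

Lemma borromean_position_isotopic :
  isotopic (\bigcup_i circ (c i) (N i)) (\bigcup_i @ring3 R i).
Proof.
have -> : \bigcup_i circ (c i) (N i) =
    from @` (\bigcup_i [set y | zeta i y = 0 /\ a i y = 1]).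
  apply/seteqP; split=> x /=.
    by move=> [i _ ix]; exists (to x) => //; exists i => //; apply/circ_from; rewrite toK.
  by move=> [y [i _ iy] <-]; exists i => //; apply/circ_from.
have rE : (\bigcup_i @ring3 R i) =
    \bigcup_i [set y | zeta i y = 0 /\ ring_gauge i y = 1].
  apply: eq_bigcupr => i _; apply/seteqP; split=> y /=.
    by move=> [y0 y1]; rewrite /zeta y0 normr0 /ring_gauge y1 sqrtr1.
  move=> [/normr0_eq0 y0 y1]; split=> //.
  move: y1 => /(congr1 (fun z => z ^+ 2)); rewrite expr1n sqr_sqrtr//.
  by rewrite addr_ge0 ?sqr_ge0// divr_ge0// sqr_ge0.
apply: (@isotopic_trans _ _ (from @` (\bigcup_i @ring3 R i))).
  apply: (@isotopic_conj _ from to) => //.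
  - by rewrite /from; cts.
  - by rewrite /to; cts.
  rewrite rE; apply: radial_isotopy.
  - by move=> i; apply: cts_gauge; cts.
  - by move=> i; rewrite /ring_gauge; cts.
  - by move=> i; rewrite /zeta; cts.
  - exact: homa.
  - by move=> i k x; exact: ring_gauge0.
  - exact: homZ.

  - by move=> i x; exact: sqrtr_ge0.
  - by move=> i x; exact: normr_ge0.
  - exact: az0.
  - exact: bz0.
  - move=> i.
    rewrite (_ : mkset _ = to @` circ (c i) (N i)).
      apply: continuous_compact; last exact: compact_circ.
      by apply: continuous_subspaceT; rewrite /to; cts.
    apply/seteqP; split=> y /=; first by move=> /circ_from h; exists (from y).
    by move=> [x Cx <-]; apply/circ_from; rewrite toK.
  - move=> i j ij; have [jE|jE] := eqVneq j (i + 1); [left|right].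
      by move=> x [zi ai] zj; have := a_order ij zi ai zj; rewrite jE eqxx.
    move=> x [zi ai] zj; have := a_order ij zi ai zj; rewrite (negPf jE) => aj; split=> //.
    have [jE'|jE'] := ord3_cover ij; first by rewrite jE' eqxx in jE.
    have x0 : x != 0.
      apply/eqP => x0; move/eqP: ai; rewrite x0 -(scale0r 0) homa// mul0r.
      by rewrite eq_sym oner_eq0.
    have xi1 : x 0 (i - 1) = 0 by apply/normr0_eq0.
    have xj1 : x 0 (i + 1) = 0.
      have -> : i + 1 = j - 1 by rewrite jE'; elim/ord3P: (i); exact: val_inj.
      exact/normr0_eq0.
    have xi : x 0 i != 0.
      apply: contra_neq x0 => xi; apply/rowP => k; rewrite [RHS]mxE.
      by have [<-|/ord3_cover[->|->]] := eqVneq i k.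
    (* The planes of [i] and [j = i - 1] share the axis of coordinate [i], where ring [i] has
       half-axis 2 and ring [j] has half-axis 1. *)
    rewrite /ring_gauge jE' subrK xi1 xj1 expr0n /= mul0r addr0 add0r.
    have x20 : 0 < x 0 i ^+ 2 by rewrite exprn_even_gt0.
    by rewrite ltr_sqrt//; lra.
apply: (@isotopic_trans _ _ ((fun x => x *m invmx A) @` (\bigcup_i @ring3 R i))).
  rewrite (_ : from = (fun x => x + p) \o (fun x => x *m invmx A))//.
  by rewrite -image_comp; exact: isotopic_translation.
apply: linear_isotopic; first by rewrite unitmx_inv.
exact: sign_diagonal_ring3.
Qed.

End Frames.
End Sufficiency.

(** * Loops and holonomy *)

Section Holonomy.
Variable R : realType.
Local Notation V := 'rV[R]_3.
Implicit Types (Ob A : set V) (gam : R -> V).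

Definition unit01 (t : R) := 0 <= t <= 1.

Definition null_loop Ob gam := exists G : R * R -> V,
  [/\ continuous G,
      forall s, unit01 s -> G (0, s) = gam s,
      forall s, unit01 s -> G (1, s) = G (1, 0),
      forall t, unit01 t -> G (t, 0) = G (t, 1) &
      forall t s, unit01 t -> unit01 s -> ~ Ob (G (t, s))].

(* Stated for the closed paths in A, so that no parametrization of A has to be
   followed through homeomorphisms. *)
Definition null_in A Ob := forall gam, continuous gam ->
  (forall s, A (gam s)) -> gam 0 = gam 1 -> null_loop Ob gam.

Variables (gT : finGroupType) (T : V -> V -> gT).

(** A group-valued cocycle near the diagonal: a discrete flat connection on the complement of
    [Ob]. *)
Definition flat Ob := forall x, ~ Ob x -> exists2 U, nbhs x U &
  forall a b c, U a -> U b -> U c -> (T a b * T b c)%g = T a c.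

Definition node (n i : nat) : R := i%:R / n%:R.

Definition holonomy gam (n : nat) : gT :=
  (\prod_(0 <= i < n) T (gam (node n i)) (gam (node n i.+1)))%g.

(** On a grid fine enough for flatness in every cell, consecutive rows have conjugate holonomies,
    because the two vertical edges coincide. The last row is constant. *)
Lemma null_holonomy Ob gam : flat Ob -> null_loop Ob gam ->
  exists n0, forall n, (n0 <= n)%N -> (0 < n)%N -> holonomy gam n = 1%g.
Proof.
move=> fT [G [cG G0 G1 G01 GO]].
pose K : set (R * R) := `[0, 1]%classic `*` `[0, 1]%classic.
have KE t s : K (t, s) <-> unit01 t /\ unit01 s by rewrite /K /= !in_itv.
have cK : compact K by apply: compact_setX; exact: segment_compact.
(* The corners of a cell differ by at most [1 / n] in each coordinate; the factor 2 makes the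
   inequality strict. *)
pose P (n : nat) (q : R * R) := forall a b c, ball q (2 / n%:R) a ->
  ball q (2 / n%:R) b -> ball q (2 / n%:R) c ->
  (T (G a) (G b) * T (G b) (G c))%g = T (G a) (G c).
have [|n0 _ hn0] := (compact_near_coveringP K).1 cK nat \oo P.
  move=> [t s] /KE[t01 s01].
  have [U nU hU] := fT _ (GO _ _ t01 s01).
  have [r /= r0 hr] := (nbhs_ballP (t, s) _).1 (cG (t, s) _ nU).
  exists (ball (t, s) (r / 2), [set n | (Num.truncn (4 / r) < n)%N]) => /=.
    split; first by apply: nbhsx_ballx; rewrite divr_gt0.
    by exists (Num.truncn (4 / r)).+1.
  move=> [q n] /= [qr nr] a b c.
  have n0 : (0 < n%:R :> R) by rewrite ltr0n (leq_ltn_trans _ nr).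
  have nr' : 2 / n%:R <= r / 2.
    rewrite ler_pdivrMr//; have : 4 / r <= n%:R.
      by apply: (le_trans (ltW (truncnS_gt _))); rewrite ler_nat.
    by rewrite ler_pdivrMr// => h; nra.
  have sub x : ball q (2 / n%:R) x -> U (G x).
    move=> qx; apply: hr; rewrite [r]splitr.
    exact: ball_triangle qr (le_ball nr' qx).
  by move=> /sub Ua /sub Ub /sub Uc; exact: hU.
exists n0 => n nn0 n_gt0.
have {hn0} hn : forall q, K q -> P n q by apply: hn0.
have nR : 0 < n%:R :> R by rewrite ltr0n.
pose g (i j : nat) := G (node n i, node n j).
have u01 (i : nat) : (i <= n)%N -> unit01 (node n i).
  by move=> ni; rewrite /unit01 /node divr_ge0 ?ler0n//= ler_pdivrMr// mul1r ler_nat.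
have dist (i k : nat) : (i <= k <= i.+1)%N -> `|node n i - node n k| < 2 / n%:R :> R.
  move=> ik; rewrite /node -mulrBl normrM [`|n%:R^-1|]ger0_norm ?invr_ge0 ?ltW//.
  rewrite ltr_pM2r ?invr_gt0// distrC ger0_norm.
    rewrite -natrB; last by case/andP: ik.
    by rewrite ltr_nat ltnS leq_subLR addn1; case/andP: ik.
  by rewrite subr_ge0 ler_nat; case/andP: ik.
have cell (i j i1 j1 i2 j2 i3 j3 : nat) : (i < n)%N -> (j < n)%N ->
    (i <= i1 <= i.+1)%N -> (i <= i2 <= i.+1)%N -> (i <= i3 <= i.+1)%N ->
    (j <= j1 <= j.+1)%N -> (j <= j2 <= j.+1)%N -> (j <= j3 <= j.+1)%N ->
    (T (g i1 j1) (g i2 j2) * T (g i2 j2) (g i3 j3))%g = T (g i1 j1) (g i3 j3).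
  move=> i_n j_n *; apply: (hn (node n i, node n j)).
  - by apply/KE; split; apply: u01; rewrite ltnW.
  - by split; apply: dist.
  - by split; apply: dist.
  - by split; apply: dist.
pose row i k := (\prod_(0 <= j < k) T (g i j) (g i j.+1))%g.
have rowS i k : (i < n)%N -> (k <= n)%N ->
    (T (g i 0%N) (g i.+1 0%N) * row i.+1 k = row i k * T (g i k) (g i.+1 k))%g.
  move=> i_n; elim: k => [_|k IH kn]; first by rewrite /row !big_nil mulg1 mul1g.
  rewrite /row !big_nat_recr//= mulgA -/(row i.+1 k) IH ?(ltnW kn)//.
  rewrite -/(row i k) -!mulgA; congr (_ * _)%g.
  by rewrite !(cell i k)// ?leqnn ?leqnSn.
have per i : (i <= n)%N -> g i n = g i 0%N.
  by move=> ni; rewrite /g /node divff ?gt_eqF// mul0r G01//; exact: u01.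
have row1 i : (i <= n)%N -> row i n = 1%g -> row 0%N n = 1%g.
  elim: i => [//|i IH i_n ri]; apply: IH; first exact: ltnW.
  have := rowS i n i_n (leqnn n); rewrite ri mulg1 !per//; last exact: ltnW.
  by move=> /esym /(canRL (mulgK _)); rewrite mulgV.
have -> : holonomy gam n = row 0%N n.
  apply: eq_big_nat => i /andP[_ i_n]; rewrite /g /node mul0r !G0//; apply: u01 => //.
  exact: ltnW.
apply: (row1 n) => //; apply: big1_seq => j /=; rewrite mem_index_iota => /andP[_ jn].
have nn1 : node n n = 1 by rewrite /node divff ?gt_eqF.
rewrite /g nn1 (G1 _ (u01 _ (ltnW jn))) (G1 _ (u01 _ jn)).
have u0 : unit01 0 by rewrite /unit01 lexx ler01.
have u1 : unit01 1 by rewrite /unit01 lexx ler01.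
have [U nU hU] := fT _ (GO 1 0 u1 u0).
have U10 : U (G (1, 0)) by apply: nbhs_singleton.
(* Flatness at three equal points makes the transport idempotent, hence trivial. *)
apply: (mulgI (T (G (1, 0)) (G (1, 0)))); rewrite mulg1; apply: hU => //.
Qed.

End Holonomy.

(** * Transport by crossings of two walls *)

Section Crossing.
Variable R : realType.
Local Notation V := 'rV[R]_3.

(* The step from [a] to [b] crosses the part [c] of the boundary of the
   half-space [s]; on short steps it does not matter where [c] is tested. *)
Definition cross (s c : pred V) (a b : V) : bool :=
  (s a != s b) && c (if s a then a else b).

(** The wall is the part of the boundary of [s] where [c] holds. Away from its rim crossings add up
    modulo 2; at an inert point there are none. *)
Definition tame (s c : pred V) (x : V) :=
  (\forall y \near x, s y = s x) \/ (\forall y \near x, c y = c x).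

Definition inert (s c : pred V) (x : V) :=
  (\forall y \near x, s y = s x) \/ (\forall y \near x, c y = false).

Lemma tame_cross s c x : tame s c x -> exists2 U, nbhs x U &
  forall a b d, U a -> U b -> U d ->
  cross s c a b (+) cross s c b d = cross s c a d.
Proof.
move=> [sx|cx].
  by exists [set y | s y = s x] => // a b d /= sa sb sd; rewrite /cross sa sb sd !eqxx.
exists [set y | c y = c x] => // a b d /= ca cb cd; rewrite /cross.
case: (s a); case: (s b); case: (s d); rewrite /= ?ca ?cb ?cd //;
  by case: (c x).
Qed.

Lemma inert_cross s c x : inert s c x -> exists2 U, nbhs x U &
  forall a b, U a -> U b -> cross s c a b = false.
Proof.
move=> [sx|cx].
  by exists [set y | s y = s x] => // a b /= sa sb; rewrite /cross sa sb eqxx.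
exists [set y | c y = false] => // a b /= ca cb; rewrite /cross.
by case: (s a); rewrite ?ca ?cb andbF.
Qed.

Variables (gT : finGroupType) (tau1 tau2 : gT) (s1 c1 s2 c2 : pred V).
Hypotheses (tau1K : (tau1 * tau1 = 1)%g) (tau2K : (tau2 * tau2 = 1)%g).

Definition transport (a b : V) : gT :=
  ((if cross s1 c1 a b then tau1 else 1) * (if cross s2 c2 a b then tau2 else 1))%g.

(** Near each point one wall is inert, so the two involutions never mix and parity of crossings of
    the other wall is enough. *)
Lemma transport_flat (Ob : set V) :
  (forall x, ~ Ob x ->
     tame s1 c1 x /\ inert s2 c2 x \/ inert s1 c1 x /\ tame s2 c2 x) ->
  flat transport Ob.
Proof.
move=> h x /h [[/tame_cross[U nU hU] /inert_cross[W nW hW]]|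
               [/inert_cross[U nU hU] /tame_cross[W nW hW]]];
  exists (U `&` W); try exact: filterI; move=> a b d [Ua Wa] [Ub Wb] [Ud Wd];
  rewrite /transport.
- rewrite !hW// !mulg1 -(hU a b d)//.
  by case: (cross _ _ a b); case: (cross _ _ b d); rewrite /= ?mulg1 ?mul1g.
- rewrite !hU// !mul1g -(hW a b d)//.
  by case: (cross _ _ a b); case: (cross _ _ b d); rewrite /= ?mulg1 ?mul1g.
Qed.

End Crossing.

Section NearSign.
Variable R : realType.
Local Notation V := 'rV[R]_3.

Lemma near_sign (f : V -> R) x : continuous f -> f x != 0 ->
  \forall y \near x, (0 <= f y) = (0 <= f x).
Proof.
move=> cf; rewrite neq_lt => /orP[] fx.
  have := near_lt cf fx; apply: filterS => y fy.
  by rewrite !leNgt fx fy.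
have := near_gt cf fx; apply: filterS => y fy.
by rewrite !ltW.
Qed.

Lemma near_neg (f : V -> R) x : continuous f -> f x != 0 ->
  \forall y \near x, (f y < 0) = (f x < 0).
Proof.
move=> cf fx; have := near_sign cf fx; apply: filterS => y.
by rewrite !ltNge => ->.
Qed.

Lemma tame_sign (f h : V -> R) x : continuous f -> continuous h ->
  ~ (f x = 0 /\ h x = 0) -> tame (fun y => 0 <= f y) (fun y => h y < 0) x.
Proof.
move=> cf ch fh; have [fx|fx] := eqVneq (f x) 0; last by left; exact: near_sign.
by right; apply: near_neg => //; apply/eqP => hx; apply: fh.
Qed.

Lemma inert_sign (f h : V -> R) x : continuous f -> continuous h ->
  f x != 0 \/ 0 < h x -> inert (fun y => 0 <= f y) (fun y => h y < 0) x.
Proof.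
move=> cf ch [fx|hx]; [left; exact: near_sign|right].
have := near_gt ch hx; apply: filterS => y hy.
by apply/negbTE; rewrite -leNgt ltW.
Qed.

End NearSign.

(** * A piecewise linear loop in the plane *)

Section Diamond.
Variable R : realType.
Implicit Types t : R.

(** A substitute for cosine and sine: on [0, 1] the pair runs once around the square
    [|u| + |v| = 1], with corners at the multiples of 1/4. *)
Definition diamond_u t : R := `|4 * t - 2| - 1.
Definition diamond_v t : R := Num.min (4 * t) (Num.max (2 - 4 * t) (4 * t - 4)).

Lemma cts_diamond_u : continuous diamond_u.
Proof. by rewrite /diamond_u; cts. Qed.

Lemma cts_diamond_v : continuous diamond_v.
Proof. by rewrite /diamond_v; cts. Qed.

Ltac diamond_cases := rewrite /diamond_u /diamond_v;
  rewrite ?maxEle; try (case: ifPn; rewrite -?ltNge => ?);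
  rewrite ?minEle; try (case: ifPn; rewrite -?ltNge => ?);
  try match goal with |- context [Num.norm ?a] => case: (ger0P a) => ? end.

Lemma diamond0 : diamond_u 0 = 1 /\ diamond_v 0 = 0.
Proof. by diamond_cases; split; lra. Qed.

Lemma diamond1 : diamond_u 1 = 1 /\ diamond_v 1 = 0.
Proof. by diamond_cases; split; lra. Qed.

Lemma diamond_half : diamond_u 2^-1 = -1 /\ diamond_v 2^-1 = 0.
Proof. by diamond_cases; split; lra. Qed.

(** Valid at all real times, since [null_in] asks for paths that stay in the curve at all real
    times. *)
Lemma diamond_neq0 t : diamond_u t = 0 -> diamond_v t = 0 -> False.
Proof. by diamond_cases; lra. Qed.

Lemma diamond_v_ge0 t : 0 <= t <= 2^-1 -> 0 <= diamond_v t.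
Proof. by move=> /andP[? ?]; diamond_cases; lra. Qed.

Lemma diamond_v_lt0 t : 2^-1 < t -> t < 1 -> diamond_v t < 0.
Proof. by move=> ? ?; diamond_cases; lra. Qed.

Lemma diamond_u_ge0 t : t <= 4^-1 \/ 3 / 4 <= t -> 0 <= diamond_u t.
Proof. by case=> ?; diamond_cases; lra. Qed.

Lemma diamond_u_lt0 t : 4^-1 < t -> t < 3 / 4 -> diamond_u t < 0.
Proof. by move=> ? ?; diamond_cases; lra. Qed.

End Diamond.

Section Linked.
Variable R : realType.
Local Notation V := 'rV[R]_3.

Lemma node_le (n i k : nat) : (0 < n)%N -> (node R n i <= node R n k) = (i <= k)%N.
Proof. by move=> n0; rewrite /node ler_pM2r ?invr_gt0 ?ltr0n// ler_nat. Qed.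

Lemma node_lt (n i k : nat) : (0 < n)%N -> (node R n i < node R n k) = (i < k)%N.
Proof. by move=> n0; rewrite !ltNge node_le// ltnNge. Qed.

Lemma node0 n : node R n 0 = 0.
Proof. by rewrite /node mul0r. Qed.

Lemma node1 n : (0 < n)%N -> node R n n = 1.
Proof. by move=> n0; rewrite /node divff// pnatr_eq0 -lt0n. Qed.

Lemma node_half m : (0 < m)%N -> node R (m.*2) m = 2^-1.
Proof.
move=> m0; rewrite /node -mul2n natrM invfM mulrCA divff ?mulr1//.
by rewrite pnatr_eq0 -lt0n.
Qed.

Lemma prod_last (gT : finGroupType) (F : nat -> gT) (a b : nat) : (a <= b)%N ->
  (forall i, (a <= i < b)%N -> F i = 1%g) -> (\prod_(a <= i < b.+1) F i = F b)%g.
Proof.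
move=> ab F1; rewrite big_nat_recr//= big1_seq ?mul1g// => i.
by rewrite mem_index_iota => /F1.
Qed.

(* The loop passes once through the part [h < 0] of the wall [f = 0]. *)
Lemma linked_loop_not_null (Ob : set V) (f h : V -> R) (gam : R -> V) :
  continuous f -> continuous h ->
  (forall x, f x = 0 -> h x = 0 -> Ob x) ->
  (forall t, 0 <= t <= 2^-1 -> 0 <= f (gam t)) ->
  (forall t, 2^-1 < t -> t < 1 -> f (gam t) < 0) ->
  0 <= f (gam 1) -> h (gam 1) < 0 -> 0 <= h (gam 2^-1) -> ~ null_loop Ob gam.
Proof.
move=> cf ch fhO f1 f2 f3 h1 h2.
pose tau : 'S_2 := tperm 0 1.
have tauK : (tau * tau = 1)%g by exact: tperm2.
pose s (x : V) := 0 <= f x; pose c (x : V) := h x < 0.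
(* The second wall is empty. *)
have fl : flat (transport tau 1%g s c xpredT xpred0) Ob.
  apply: transport_flat => //; first by rewrite mulg1.
  move=> x Ox; left; split; last by right; apply: filterE.
  by apply: tame_sign => // -[fx hx]; apply: Ox; exact: fhO.
move=> /(null_holonomy fl) [n0 hn0].
(* An even number of steps puts a node at 1/2 exactly. The crossing there is tested at that node,
   where [h] is nonnegative, so only the last step counts. *)
pose m := (n0 + 2)%N.
have m0 : (0 < m.*2)%N by rewrite double_gt0 /m addn2.
have := hn0 m.*2 _ m0.
have -> : (n0 <= m.*2)%N by rewrite -addnn /m -!addnA leq_addr.
move=> /(_ isT).
have mm : m.*2 = (m.*2).-1.+1 by rewrite (prednK m0).
rewrite /holonomy [X in (\prod_(_ <= _ < X) _)%g]mm prod_last//; last first.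
  move=> i /andP[_ im]; rewrite /transport [cross xpredT _ _ _]andbF mulg1.
  suff -> : cross s c (gam (node R m.*2 i)) (gam (node R m.*2 i.+1)) = false by [].
  have half : node R m.*2 m = 2^-1 by apply: node_half; rewrite /m addn2.
  have lt1 k : (k < m.*2)%N -> node R m.*2 k < 1 by move=> km; rewrite -(node1 m0) node_lt.
  have i2 : (i.+1 < m.*2)%N by rewrite -ltn_predRL.
  have st k : (k <= m)%N -> s (gam (node R m.*2 k)).
    by move=> km; apply: f1; rewrite -half node_le// km -(node0 m.*2) node_le.
  have sf k : (m < k < m.*2)%N -> s (gam (node R m.*2 k)) = false.
    move=> /andP[mk k2]; apply/negbTE; rewrite -ltNge; apply: f2; last exact: lt1.
    by rewrite -half node_lt.
  rewrite /cross; have [im'|im'|im'] := ltngtP i m.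
  - by rewrite !st// ltnW.
  - have -> : s (gam (node R m.*2 i)) = false by apply: sf; rewrite im' ltnW.
    by have -> : s (gam (node R m.*2 i.+1)) = false by apply: sf; rewrite i2 (leqW im').
  - have -> : s (gam (node R m.*2 i)) = true by apply: st; rewrite im'.
    have -> : s (gam (node R m.*2 i.+1)) = false by apply: sf; rewrite i2 im' ltnSn.
    by rewrite /c im' half ltNge h2.
rewrite -mm /transport [cross xpredT _ _ _]andbF mulg1 /cross (node1 m0).
have -> : s (gam 1) = true by exact: f3.
have s0 : s (gam (node R m.*2 m.*2.-1)) = false.
  apply/negbTE; rewrite -ltNge; apply: f2.
    have m2 : (1 < m)%N by rewrite /m addn2.
    rewrite -(@node_half m) ?(ltnW m2)// node_lt// ltn_predRL -addnn -[m.+1]add1n.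
    by rewrite ltn_add2r.
  by rewrite -(node1 m0) node_lt// ltn_predL.
rewrite s0 /= /c h1 => /(congr1 (fun u : 'S_2 => u 0)).
by rewrite tpermL perm1.
Qed.

End Linked.

Section NotNull.
Variable R : realType.
Local Notation V := 'rV[R]_3.

(** The ellipse is traced in diamond directions from the midpoint of [p] and [q], so that the height
    over the other plane has the sign of [diamond_v]. It changes sign at [p], inside the other disk,
    and at [q], not inside it. *)
Lemma linked_not_null (c d : V) (N M : 'M[R]_3) (p q nu : V) :
  N \in unitmx -> circ c N p -> circ c N q ->
  frame d M p 0 2 = 0 -> frame d M q 0 2 = 0 ->
  frame d M p 0 0 ^+ 2 + frame d M p 0 1 ^+ 2 < 1 ->
  1 <= frame d M q 0 0 ^+ 2 + frame d M q 0 1 ^+ 2 ->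
  (nu *m N) 0 2 = 0 -> 0 < (nu *m M) 0 2 ->
  ~ null_in (circ c N) (circ d M).
Proof.
move=> uN [p2 p01] [q2 q01] dp2 dq2 dp dq nuN nuM.
pose m := 2^-1 *: (p + q); pose k := 2^-1 *: (p - q).
have pE : p = m + k by apply/rowP => j; rewrite !mxE; lra.
have qE : q = m - k by apply/rowP => j; rewrite !mxE; lra.
clearbody m k.
have [km m2] : (k *m N) 0 2 = 0 /\ frame c N m 0 2 = 0.
  move: p2 q2; rewrite pE qE !frameD mulNmx !entryD entryN.
  by move=> ? ?; split; lra.
have [kM dm2] : (k *m M) 0 2 = 0 /\ frame d M m 0 2 = 0.
  move: dp2 dq2; rewrite pE qE !frameD mulNmx !entryD entryN.
  by move=> ? ?; split; lra.
have k0 : k != 0.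
  by apply: contraTneq dp => k0; rewrite -leNgt; move: dq; rewrite pE qE k0 subr0 addr0.
have kN := direction_gt0 uN k0 km.
have hm : frame c N m 0 0 ^+ 2 + frame c N m 0 1 ^+ 2 < 1.
  move: p01 q01 kN; rewrite pE qE !frameD mulNmx !entryD !entryN.
  move: (frame _ _ _ _ _) (frame _ _ _ _ _) => a b.
  by move: ((k *m N) 0 0) ((k *m N) 0 1) => x y ? ? ?; nra.
pose del t := diamond_u t *: k + diamond_v t *: nu.
have del2 t : (del t *m N) 0 2 = 0.
  by rewrite mulmxDl -!scalemxAl entryD !entryZ km nuN !mulr0 addr0.
have delM t : (del t *m M) 0 2 = diamond_v t * (nu *m M) 0 2.
  by rewrite mulmxDl -!scalemxAl entryD !entryZ kM mulr0 add0r.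
have del0 t : 0 < (del t *m N) 0 0 ^+ 2 + (del t *m N) 0 1 ^+ 2.
  apply: direction_gt0 => //; apply/eqP => d0.
  have v0 : diamond_v t = 0.
    have := delM t; rewrite d0 mul0mx mxE => /esym/eqP.
    by rewrite mulf_eq0 (gt_eqF nuM) orbF => /eqP.
  move/eqP: d0; rewrite /del v0 scale0r addr0 scaler_eq0 (negPf k0) orbF => /eqP u0.
  exact: diamond_neq0 u0 v0.
pose g t := gauge (frame c N m 0 0) (frame c N m 0 1) ((del t *m N) 0 0) ((del t *m N) 0 1).
have g0 t : 0 < g t by apply: gauge_gt0.
have cdel : continuous del.
  by rewrite /del; cts; [exact: cts_diamond_u|exact: cts_diamond_v].
have cg : continuous g by apply: cts_gauge; cts.
pose gam t := m + (g t)^-1 *: del t.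
have cgam : continuous gam.
  by rewrite /gam; cts => t; rewrite gt_eqF.
have Agam t : circ c N (gam t).
  rewrite /circ /= /gam frameD -scalemxAl; split.
    by rewrite entryD m2 entryZ del2 mulr0 addr0.
  rewrite !entryD !entryZ; apply/gauge_eq1 => //.
  by rewrite gaugeZ ?invr_ge0 ?ltW// mulVf// gt_eqF.
have fgam t : frame d M (gam t) 0 2 = (g t)^-1 * (diamond_v t * (nu *m M) 0 2).
  by rewrite /gam frameD entryD dm2 add0r -scalemxAl entryZ delM.
have gp : gauge (frame c N m 0 0) (frame c N m 0 1) ((k *m N) 0 0) ((k *m N) 0 1) = 1.
  by apply/gauge_eq1 => //; move: p01; rewrite pE frameD !entryD.
have gq : gauge (frame c N m 0 0) (frame c N m 0 1) ((- k *m N) 0 0) ((- k *m N) 0 1) = 1.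
  by apply/gauge_eq1 => //; move: q01; rewrite qE frameD !entryD.
have gam_p t : diamond_u t = 1 /\ diamond_v t = 0 -> gam t = p.
  by move=> [u1 v0]; rewrite /gam /g /del u1 v0 scale1r scale0r addr0 gp invr1 scale1r pE.
have gam1 := gam_p _ (diamond1 R).
have gam12 : gam 2^-1 = q.
  have [u1 v0] := diamond_half R.
  by rewrite /gam /g /del u1 v0 scaleN1r scale0r addr0 gq invr1 scale1r qE.
move=> /(_ gam cgam Agam); rewrite gam1 (gam_p _ (diamond0 R)) => /(_ erefl).
apply: (@linked_loop_not_null _ _ (fun x => frame d M x 0 2)
  (fun x => frame d M x 0 0 ^+ 2 + frame d M x 0 1 ^+ 2 - 1)).
- by rewrite /frame; cts.
- by rewrite /frame; cts.
- by move=> x x2 /eqP; rewrite subr_eq0 => /eqP x01.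
- move=> t t01; rewrite fgam; apply: mulr_ge0; first by rewrite invr_ge0 ltW.
  by apply: mulr_ge0; [exact: diamond_v_ge0|exact: ltW].
- move=> t t1 t2; rewrite fgam pmulr_rlt0 ?invr_gt0// pmulr_llt0//.
  exact: diamond_v_lt0.
- by rewrite gam1 dp2.
- by rewrite gam1 subr_lt0.
- by rewrite gam12 subr_ge0.
Qed.

Lemma null_in_star A Ob (o : V) :
  (forall x, A x -> forall t, 0 <= t <= 1 -> ~ Ob ((1 - t) *: x + t *: o)) ->
  null_in A Ob.
Proof.
move=> h gam cgam Agam gam01.
exists (fun ts => (1 - ts.1) *: gam ts.2 + ts.1 *: o); split=> /=.
- by cts.
- by move=> s _; rewrite subr0 scale1r scale0r addr0.
- by move=> s _; rewrite subrr !scale0r.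
- by move=> t _; rewrite gam01.
- by move=> t s t01 _; apply: h.
Qed.

Lemma null_in_circ c N (Ob : set V) : (forall x, dsk c N x -> ~ Ob x) ->
  null_in (circ c N) Ob.
Proof.
move=> h; apply: (@null_in_star _ _ c) => x [x2 x01] t /andP[t0 t1]; apply: h.
have -> : (1 - t) *: x + t *: c = c + (1 - t) *: (x - c).
  by apply/rowP => j; rewrite !(entryD, entryZ, entryN); ring.
have fE : frame c N (c + (1 - t) *: (x - c)) = (1 - t) *: frame c N x.
  by rewrite frameD -scalemxAl /frame subrr mul0mx add0r.
rewrite /dsk /= fE !entryZ x2 mulr0 !exprMn -mulrDr x01 mulr1; split=> //.
by rewrite expr_le1//; lra.
Qed.

Lemma null_in_image (f g : V -> V) A Ob : continuous f -> continuous g ->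
  cancel f g -> cancel g f -> null_in A Ob -> null_in (f @` A) (f @` Ob).
Proof.
move=> cf cg fg gf h gam cgam Agam gam01.
have [|s||G [cG G0 G1 G01 GO]] := h (fun s => g (gam s)).
- exact: cts_comp cgam cg.
- by have [x Ax <-] := Agam s; rewrite fg.
- by rewrite gam01.
exists (fun ts => f (G ts)); split.
- exact: cts_comp cG cf.
- by move=> s s01; rewrite G0// gf.
- by move=> s s01; rewrite G1.
- by move=> t t01; rewrite G01.
- move=> t s t01 s01 [x Ox] /(congr1 g); rewrite !fg => xE.
  by apply: (GO t s) => //; rewrite -xE.
Qed.

End NotNull.

Section RingsNotNull.
Variable R : realType.
Local Notation V := 'rV[R]_3.
Implicit Types i : 'I_3.

(** Shrinking to the centre works: along coordinate [i + 1] ring [i] has half-axis 1, while ring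
    [i + 1] has half-axis 2. *)
Lemma ring3_null i : null_in (@ring3 R i) (ring3 (i + 1)).
Proof.
apply: (@null_in_star _ _ _ 0) => x [x2 x01] t /andP[t0 t1].
rewrite scaler0 addr0 /ring3 /= !ord3_idx !entryZ x2 mulr0 expr0n /= addr0.
move=> [_]; rewrite exprMn => h.
have : (1 - t) ^+ 2 <= 1 by rewrite expr_le1//; lra.
have := sqr_ge0 (x 0 i); have := sqr_ge0 (x 0 (i + 1)); have := sqr_ge0 (1 - t).
move: h x01; move: (x 0 i ^+ 2) (x 0 (i + 1) ^+ 2) ((1 - t) ^+ 2) => a b d *.
have : d * b <= 1 by nra.
lra.
Qed.

Lemma ring3_not_null i : ~ null_in (@ring3 R i) (ring3 (i + 1) `|` ring3 (i - 1)).
Proof.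
(* The walls are the disk bounded by the ring i + 1 and the planar complement of
   the disk bounded by the ring i - 1. *)
pose tau1 : 'S_3 := tperm 0 1; pose tau2 : 'S_3 := tperm 1 2.
have tau1K : (tau1 * tau1 = 1)%g by exact: tperm2.
have tau2K : (tau2 * tau2 = 1)%g by exact: tperm2.
pose f1 (x : V) := x 0 i; pose f2 (x : V) := x 0 (i + 1).
pose h1 (x : V) := x 0 (i + 1) ^+ 2 / 4 + x 0 (i - 1) ^+ 2 - 1.
pose h2 (x : V) := 1 - (x 0 (i - 1) ^+ 2 / 4 + x 0 i ^+ 2).
pose s1 (x : V) := 0 <= f1 x; pose c1 (x : V) := h1 x < 0.
pose s2 (x : V) := 0 <= f2 x; pose c2 (x : V) := h2 x < 0.
have cf1 : continuous f1 by rewrite /f1; cts.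
have cf2 : continuous f2 by rewrite /f2; cts.
have ch1 : continuous h1 by rewrite /h1; cts.
have ch2 : continuous h2 by rewrite /h2; cts.
have fl : flat (transport tau1 tau2 s1 c1 s2 c2) (ring3 (i + 1) `|` ring3 (i - 1)).
  apply: transport_flat => // x Ox.
  have t1 : tame s1 c1 x.
    apply: tame_sign => // -[fx /eqP hx]; apply: Ox; left.
    by rewrite /ring3 /= !ord3_idx; split=> //; apply/eqP; rewrite -subr_eq0.
  have t2 : tame s2 c2 x.
    apply: tame_sign => // -[fx /eqP hx]; apply: Ox; right.
    by rewrite /ring3 /= !ord3_idx; split=> //; apply/esym/eqP; rewrite -subr_eq0.
  have [h1x|h1x] := ltP 0 (h1 x).
    by right; split=> //; apply: inert_sign => //; right.
  have [h2x|h2x] := ltP 0 (h2 x).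
    by left; split=> //; apply: inert_sign => //; right.
  have [f1x|f1x] := eqVneq (f1 x) 0.
    have [f2x|f2x] := eqVneq (f2 x) 0.
      (* Only coordinate [i - 1] can be nonzero here; the two conditions would make its absolute
         value at most 1 and at least 2. *)
      move: h1x h2x; rewrite /h1 /h2; move: f1x f2x; rewrite /f1 /f2 => -> ->.
      by move: (x 0 (i - 1) ^+ 2) => z; rewrite !expr0n /=; lra.
    by left; split=> //; apply: inert_sign => //; left.
  by right; split=> //; apply: inert_sign => //; left.
pose g t : R := Num.sqrt (diamond_u t ^+ 2 / 4 + diamond_v t ^+ 2).
have g0 t : 0 < g t.
  rewrite sqrtr_gt0 lt_neqAle addr_ge0 ?divr_ge0 ?sqr_ge0// andbT eq_sym.
  apply/eqP => h.
  have su := sqr_ge0 (diamond_u t); have sv := sqr_ge0 (diamond_v t).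
  apply: (@diamond_neq0 _ t); apply/eqP; rewrite -sqrf_eq0; apply/eqP; lra.
have cg : continuous g.
  by rewrite /g; cts; [exact: cts_diamond_u|exact: cts_diamond_v].
pose gam t : V := \row_k (if k == i then diamond_u t / g t else
  if k == i + 1 then diamond_v t / g t else 0).
have gam_i t : gam t 0 i = diamond_u t / g t by rewrite mxE eqxx.
have gam_i1 t : gam t 0 (i + 1) = diamond_v t / g t by rewrite mxE ord3_neq eqxx.
have gam_i2 t : gam t 0 (i - 1) = 0 by rewrite mxE !ord3_neq.
have cgam : continuous gam.
  apply: cts_mx => a k; under eq_fun do rewrite mxE.
  have ig : continuous (fun t => (g t)^-1) by apply: cts_inv => // t; rewrite gt_eqF.
  case: eqP => _; first by apply: cts_mul ig; exact: cts_diamond_u.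
  by case: eqP => _; [apply: cts_mul ig; exact: cts_diamond_v|exact: cts_cst].
have g2 t : g t ^+ 2 = diamond_u t ^+ 2 / 4 + diamond_v t ^+ 2.
  by rewrite sqr_sqrtr// addr_ge0 ?divr_ge0 ?sqr_ge0.
have Agam t : ring3 i (gam t).
  rewrite /ring3 /= gam_i2 gam_i gam_i1 !exprMn !exprVn; split=> //.
  rewrite mulrAC -mulrDl -g2 divff// expf_neq0// gt_eqF//.
move=> /(_ gam cgam Agam).
have gam_eq t t' : diamond_u t = diamond_u t' -> diamond_v t = diamond_v t' ->
    gam t = gam t'.
  by move=> ue ve; rewrite /gam /g ue ve.
have [u0 v0] := diamond0 R; have [u1 v1] := diamond1 R.
rewrite (gam_eq 0 1) ?u0 ?u1 ?v0 ?v1// => /(_ erefl).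
move=> /(null_holonomy fl) [n0 hn0].
(* A multiple of 4 puts nodes at the corners of the diamond. *)
pose m := n0.+2; pose n := (4 * m)%N.
have n_gt0 : (0 < n)%N by [].
have {hn0} : holonomy (transport tau1 tau2 s1 c1 s2 c2) gam n = 1%g.
  apply: hn0 => //; apply: (@leq_trans m); first by rewrite /m -addn2 leq_addr.
  by rewrite leq_pmull.
have q k : node R n (k * m) = k%:R / 4.
  by rewrite /node /n !natrM -mulf_div divff ?mulr1// pnatr_eq0.
have q1 : node R n m = 4^-1 by have := q 1%N; rewrite mul1n div1r.
have q2 : node R n (2 * m) = 2^-1 by rewrite q; lra.
have q3 : node R n (3 * m) = 3 / 4 by rewrite q.
pose P k := gam (node R n k).
have lt1 k : (k < n)%N -> node R n k < 1 by move=> kn; rewrite -(node1 R n_gt0) node_lt.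
have S1t k : (k <= m)%N || (3 * m <= k)%N -> s1 (P k).
  move=> km; rewrite /s1 /f1 gam_i divr_ge0 ?(ltW (g0 _))//; apply: diamond_u_ge0.
  by case/orP: km => km; [left; rewrite -q1|right; rewrite -q3]; rewrite node_le.
have S1f k : (m < k < 3 * m)%N -> s1 (P k) = false.
  move=> /andP[k1 k2]; apply/negbTE; rewrite -ltNge /f1 gam_i pmulr_llt0 ?invr_gt0//.
  by apply: diamond_u_lt0; [rewrite -q1|rewrite -q3]; rewrite node_lt.
have S2t k : (k <= 2 * m)%N || (k == n) -> s2 (P k).
  move=> km; rewrite /s2 /f2 gam_i1 divr_ge0 ?(ltW (g0 _))//.
  case/orP: km => [km|/eqP ->]; last by rewrite node1// v1.
  apply: diamond_v_ge0; rewrite -(node0 R n) -q2 !node_le//.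
have S2f k : (2 * m < k < n)%N -> s2 (P k) = false.
  move=> /andP[k1 k2]; apply/negbTE; rewrite -ltNge /f2 gam_i1 pmulr_llt0 ?invr_gt0//.
  by apply: diamond_v_lt0; [rewrite -q2 node_lt|exact: lt1].
(* On ring [i] the square of coordinate [i + 1] is at most 1, below the bound 4 of the first wall.
   Where [diamond_v] vanishes, the square of coordinate [i] is 4, beyond the bound 1 of the second
   wall. *)
have C1 t : c1 (gam t).
  rewrite /c1 /h1 gam_i1 gam_i2 expr0n /= addr0.
  have := (Agam t).2; rewrite gam_i gam_i1.
  have := sqr_ge0 (diamond_u t / g t); have := sqr_ge0 (diamond_v t / g t).
  by move: (_ ^+ 2) (_ ^+ 2) => a b; lra.
have C2 t : diamond_v t = 0 -> c2 (gam t).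
  move=> vt; rewrite /c2 /h2 gam_i2 expr0n /= mul0r add0r.
  have := (Agam t).2; rewrite gam_i gam_i1 vt mul0r expr0n /= addr0.
  by move: (_ ^+ 2) => a; lra.
have cr1 k : cross s1 c1 (P k) (P k.+1) = (s1 (P k) != s1 (P k.+1)).
  by rewrite /cross; case: ifP => _; rewrite C1 andbT.
have cr20 k : s2 (P k) = s2 (P k.+1) -> cross s2 c2 (P k) (P k.+1) = false.
  by move=> sk; rewrite /cross sk eqxx.
pose F k := transport tau1 tau2 s1 c1 s2 c2 (P k) (P k.+1).
have F1 k : s1 (P k) = s1 (P k.+1) -> s2 (P k) = s2 (P k.+1) -> F k = 1%g.
  by move=> h h'; rewrite /F /transport cr1 h eqxx cr20// mulg1.
have FE1 k : s1 (P k) != s1 (P k.+1) -> s2 (P k) = s2 (P k.+1) -> F k = tau1.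
  by move=> h h'; rewrite /F /transport cr1 h cr20// mulg1.
have FE2 k : s1 (P k) = s1 (P k.+1) -> cross s2 c2 (P k) (P k.+1) -> F k = tau2.
  by move=> h h'; rewrite /F /transport cr1 h eqxx h' mul1g.
have m2 : (1 < m)%N by [].
have mm : (m < 2 * m)%N by rewrite -[X in (X < _)%N]mul1n ltn_pmul2r.
have mm2 : (2 * m < 3 * m)%N by rewrite ltn_pmul2r.
have mm3 : (3 * m < n)%N by rewrite ltn_pmul2r.
have m3 : (2 * m < (3 * m).-1)%N.
  by rewrite ltn_predRL (mulSn 2 m) -[(2 * m).+1]add1n ltn_add2r.
have n1 : (3 * m < n.-1)%N.
  by rewrite ltn_predRL /n (mulSn 3 m) -[(3 * m).+1]add1n ltn_add2r.
have pm3 : (3 * m).-1.+1 = (3 * m)%N by [].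
have pn : n.-1.+1 = n by [].
have : holonomy (transport tau1 tau2 s1 c1 s2 c2) gam n = (tau1 * tau2 * tau1 * tau2)%g.
  (* Corner nodes count as nonnegative: a sign is lost in the step after [m] or [2 * m], and
     regained in the step before [3 * m] or [n]. Each block ends with its crossing. *)
  have e1 : (\prod_(0 <= k < m.+1) F k = tau1)%g.
    rewrite prod_last//; last first.
      move=> k /andP[_ km]; apply: F1; first by rewrite !S1t// ?km// ltnW.
      rewrite !S2t//; apply/orP; left; first exact: ltn_trans mm.
      by apply: ltnW; exact: ltn_trans mm.
    apply: FE1; first by rewrite (S1f m.+1) ?ltnSn ?(leq_ltn_trans mm mm2)// S1t ?leqnn.
    by rewrite !S2t// ?mm// (ltnW mm).
  have e2 : (\prod_(m.+1 <= k < (2 * m).+1) F k = tau2)%g.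
    rewrite prod_last//; last first.
      move=> k /andP[mk km]; apply: F1; last by rewrite !S2t ?km// ltnW.
      rewrite !S1f ?mk ?(ltn_trans km mm2) ?(leqW mk)//.
      by rewrite (leq_ltn_trans km mm2).
    apply: FE2.
      by rewrite !S1f ?mm ?mm2 ?(leqW mm)//= (ltn_trans _ m3)// -ltn_predRL.
    have st : s2 (P (2 * m)%N) by rewrite S2t// leqnn.
    have sf : s2 (P (2 * m).+1) = false.
      by rewrite S2f// ltnSn (leq_ltn_trans _ mm3).
    rewrite /cross sf st /=; apply: C2; rewrite q2.
    by have [] := diamond_half R.
  have e3 : (\prod_((2 * m).+1 <= k < (3 * m).-1.+1) F k = tau1)%g.
    rewrite prod_last//; last first.
      move=> k /andP[mk km]; have km' : (k.+1 < 3 * m)%N by rewrite -ltn_predRL.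
      apply: F1.
        rewrite !S1f ?km' ?(ltn_trans mm mk) ?(ltnW km')//.
        by rewrite (leqW (ltn_trans mm mk)).
      rewrite !S2f ?mk ?(leqW mk) ?(ltn_trans km' mm3)//=.
      by rewrite (ltn_trans _ mm3)// ltnW.
    have lt : ((3 * m).-1 < 3 * m)%N by rewrite ltn_predL.
    apply: FE1.
      rewrite (S1f (3 * m).-1) ?(ltn_trans mm m3)// pm3 S1t// leqnn.
      by rewrite orbT.
    by rewrite pm3 !S2f// ?mm2 ?m3//= (ltn_trans lt).
  have e4 : (\prod_(3 * m <= k < n.-1.+1) F k = tau2)%g.
    rewrite prod_last ?(ltnW n1)//; last first.
      move=> k /andP[mk km]; have km' : (k.+1 < n)%N by rewrite -ltn_predRL.
      apply: F1; first by rewrite !S1t ?mk ?(leqW mk) ?orbT.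
      rewrite !S2f ?km' ?(ltnW km') ?(leq_trans mm2 mk) ?(leqW (leq_trans mm2 mk))//.
    have lt : (n.-1 < n)%N by rewrite ltn_predL.
    apply: FE2.
      by rewrite pn !S1t ?(ltnW n1) ?(ltnW mm3) ?orbT.
    have st : s2 (P n) by rewrite S2t// eqxx orbT.
    have sf : s2 (P n.-1) = false by rewrite S2f// lt (ltn_trans mm2 n1).
    by rewrite /cross pn sf st /=; apply: C2; rewrite node1.
  rewrite /holonomy (big_cat_nat _ (n := m.+1))//=; last first.
    by rewrite (leq_trans mm)// ltnW// (ltn_trans mm2).
  rewrite [X in (_ * X)%g](big_cat_nat _ (n := (2 * m).+1))//=;
    [|exact: ltnW|by rewrite (ltn_trans mm2)].
  rewrite [X in (_ * (_ * X))%g](big_cat_nat _ (n := (3 * m)%N))//=; [|exact: ltnW].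
  rewrite -{2}pm3 -{2}pn.
  by rewrite -/F e1 e2 e3 e4 !mulgA.
(* Products act from left to right: 0 goes to 1, 2, 2, 1, so it is not fixed. *)
move=> -> /(congr1 (fun u : 'S_3 => u 0)); rewrite !permM perm1 /tau1 /tau2.
have -> : tperm 0 1 (0 : 'I_3) = 1 by rewrite tpermL.
have -> : tperm 1 2 (1 : 'I_3) = 2 by rewrite tpermL.
have -> : tperm 0 1 (2 : 'I_3) = 2 by rewrite tpermD.
by rewrite tpermR.
Qed.

End RingsNotNull.

(** * Elliptic links isotopic to the rings *)

Section Matching.
Variable R : realType.
Local Notation V := 'rV[R]_3.

Lemma circle_angle (x y : R) : x ^+ 2 + y ^+ 2 = 1 ->
  exists t, x = cos t /\ y = sin t.
Proof.
move=> xy; have x1 : -1 <= x <= 1.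
  by have := sqr_ge0 y; move=> ?; apply/andP; split; nra.
have [y0|y0] := leP 0 y.
  exists (acos x); rewrite acosK// sin_acos//; split=> //.
  by rewrite -xy addrC addKr sqrtr_sqr ger0_norm.
exists (- acos x); rewrite cosN acosK// sinN sin_acos//; split=> //.
by rewrite -xy addrC addKr sqrtr_sqr ltr0_norm// opprK.
Qed.

Lemma connected_circ (c : V) N : N \in unitmx -> connected (circ c N).
Proof.
move=> uN.
pose P (t : R) : V := (cos t *: delta_mx 0 0 + sin t *: delta_mx 0 1) *m invmx N + c.
have PE t : frame c N (P t) = cos t *: delta_mx 0 0 + sin t *: delta_mx 0 1.
  by rewrite /frame addrK mulmxKV.
have -> : circ c N = P @` [set: R].
  apply/seteqP; split=> x /=.
    move=> [x2 /circle_angle[t [xt yt]]]; exists t => //.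
    have fE : frame c N x = frame c N (P t).
      rewrite PE; apply/rowP; apply: ord3P; rewrite ?xt ?yt ?x2 !mxE /=; ring.
    move: fE; rewrite /frame => /(congr1 (fun y => y *m invmx N)).
    by rewrite !mulmxK// => /addIr.
  move=> [t _ <-]; rewrite /circ /= PE !mxE /= !mulr0 !mulr1 !addr0 add0r.
  by split=> //; exact: cos2Dsin2.
apply: connected_continuous_connected; first exact/connected_intervalP.
apply: continuous_subspaceT.
have ccos : continuous (fun t : R => cos t) by move=> t; exact: continuous_cos.
have csin : continuous (fun t : R => sin t) by move=> t; exact: continuous_sin.
by rewrite /P; cts.
Qed.

Lemma closed_ring3 i : closed (@ring3 R i).
Proof. by apply: closedI; apply: closed_fun_eq; cts. Qed.

Lemma ring3_inj i j x : @ring3 R i x -> ring3 j x -> i = j.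
Proof.
suff h k y : @ring3 R k y -> ring3 (k + 1) y -> False.
  move=> ix jx; have [//|/ord3_cover[ji|ji]] := eqVneq i j.
    by case: (h i x ix); rewrite -ji.
  by case: (h j x jx); rewrite ji subrK.
rewrite /ring3 /= !ord3_idx => -[y2 y01] [y0].
by move: y01; rewrite y0 y2 expr0n /= mul0r add0r addr0 => ->; lra.
Qed.

Lemma connected_in_ring (C : set V) : connected C -> C !=set0 ->
  C `<=` \bigcup_i @ring3 R i -> exists i, C `<=` ring3 i.
Proof.
move=> conn [x Cx] sub; have [i _ ix] := sub x Cx; exists i.
suff <- : C `&` ring3 i = C by move=> y [].
apply: conn.
- by exists x.
- exists (~` (ring3 (i + 1) `|` ring3 (i - 1))).
    by apply: closed_openC; apply: closedU; exact: closed_ring3.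
  apply/seteqP; split=> y [Cy yi]; split=> //=.
    move=> [/(ring3_inj yi)/eqP|/(ring3_inj yi)/eqP]; by rewrite eq_sym ord3_neq.
  have [j _ yj] := sub y Cy; have [->//|/ord3_cover[jE|jE]] := eqVneq i j.
    by exfalso; apply: yi; left; rewrite -jE.
  by exfalso; apply: yi; right; rewrite -jE.
- by exists (ring3 i) => //; exact: closed_ring3.
Qed.

Lemma ring3_neq0 i : @ring3 R i !=set0.
Proof.
exists (\row_k (k == i + 1)%:R); rewrite /ring3 /= !mxE !eqxx ord3_neq.
by rewrite [i == _]eq_sym ord3_neq expr0n /= mul0r add0r expr1n.
Qed.

(** The image of a component is connected, hence inside one ring. The resulting map of indices is
    onto because the rings are covered, so it is a permutation. *)
Lemma ring_matching (c : 'I_3 -> V) (N : 'I_3 -> 'M[R]_3) (f : V -> V) :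
  (forall i, N i \in unitmx) -> continuous f -> injective f ->
  f @` (\bigcup_i circ (c i) (N i)) = \bigcup_i @ring3 R i ->
  exists s : 'S_3, forall i, f @` circ (c i) (N i) = ring3 (s i).
Proof.
move=> uN cf f_inj fK.
have fi i : exists j, f @` circ (c i) (N i) `<=` ring3 j.
  apply: connected_in_ring.
  - apply: connected_continuous_connected; first exact: connected_circ.
    exact: continuous_subspaceT.
  - exists (f (delta_mx 0 0 *m invmx (N i) + c i)).
    exists (delta_mx 0 0 *m invmx (N i) + c i) => //.
    by rewrite /circ /= /frame addrK mulmxKV// !mxE /= expr1n expr0n /= addr0.
  - by rewrite -fK; apply: image_subset => x ix; exists i.
have /choice[r hr] := fi.
have r_surj j : exists i, r i = j.
  have [y jy] := ring3_neq0 j.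
  have : (\bigcup_i @ring3 R i) y by exists j.
  rewrite -fK => -[x [i _ ix] xy]; exists i; apply: ring3_inj jy.
  by apply: hr; exists x.
have /choice[r' hr'] := r_surj.
have r'_inj : injective r' by apply: can_inj hr'.
have r_inj : injective r by exact: (bij_inj (bij_can_bij (injF_bij r'_inj) hr')).
exists (perm r_inj) => i; rewrite permE; apply/seteqP; split; first exact: hr.
move=> y iy; have : (\bigcup_i @ring3 R i) y by exists (r i).
rewrite -fK => -[x [k _ kx] xy].
suff <- : k = i by exists x.
apply: r_inj; apply: (ring3_inj _ iy).
by apply: hr; exists x.
Qed.

Lemma null_in_sub (A Ob Ob' : set V) : Ob' `<=` Ob -> null_in A Ob -> null_in A Ob'.
Proof.
move=> sub h gam cg Ag g01; have [G [? ? ? ? GO]] := h gam cg Ag g01.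
by exists G; split=> // t s t01 s01 /sub; exact: GO.
Qed.

(** The permutation of components may reverse the cyclic order of the rings, whence the
    disjunction. *)
Lemma borromean_circs (c : 'I_3 -> V) (N : 'I_3 -> 'M[R]_3) :
  (forall i, N i \in unitmx) -> borromean (\bigcup_i circ (c i) (N i)) ->
  (forall i j, i != j -> null_in (circ (c i) (N i)) (circ (c j) (N j)) \/
                         null_in (circ (c j) (N j)) (circ (c i) (N i))) /\
  (forall i Ob, (forall j, i != j -> circ (c j) (N j) `<=` Ob) ->
     ~ null_in (circ (c i) (N i)) Ob).
Proof.
move=> uN [H [[_ hH _]]]; set f := H 1 => fK.
have [cf [g [fg gf cg]]] : homeomorphism f.
  by apply: hH; rewrite in_itv /= lexx ler01.
have [s hs] := ring_matching uN cf (can_inj fg) (etrans fK (@borromean_ringsE R)).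
have gs i : g @` ring3 (s i) = circ (c i) (N i).
  rewrite -hs; apply/seteqP; split=> x /=.
    by move=> [_ [y iy <-] <-]; rewrite fg.
  by move=> ix; exists (f x); [exists x|rewrite fg].
split=> [i j ij|i Ob hOb].
  have sij : s i != s j by rewrite (inj_eq perm_inj).
  rewrite -!gs; have [sE|sE] := ord3_cover sij; [left|right].
    by apply: null_in_image cg cf gf fg _; rewrite sE; exact: ring3_null.
  apply: null_in_image cg cf gf fg _.
  have -> : s i = s j + 1 by rewrite sE subrK.
  exact: ring3_null.
move=> /(null_in_image cf cg fg gf); rewrite hs => h.
apply: (@ring3_not_null _ (s i)); apply: null_in_sub h.
move=> x xO.
have [j ij xj] : exists2 j, i != j & ring3 (s j) x.
  have [k [ks xk]] : exists k, k != s i /\ ring3 k x.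
    by case: xO => xO; [exists (s i + 1)|exists (s i - 1)]; rewrite ord3_neq.
  exists ((s^-1)%g k); last by rewrite permKV.
  by apply: contra_neq ks => ->; rewrite permKV.
by move: xj; rewrite -hs => -[y jy <-]; exists y => //; exact: (hOb j).
Qed.

End Matching.

(** * Chords cut by one plane on the disk of another *)

Section Chords.
Variable R : realType.
Local Notation V := 'rV[R]_3.

Definition sqn (c : V) N (x : V) : R := frame c N x 0 0 ^+ 2 + frame c N x 0 1 ^+ 2.

Definition mix (p q : V) (t : R) : V := (1 - t) *: p + t *: q.

Lemma frame_mix c N p q t :
  frame c N (mix p q t) = (1 - t) *: frame c N p + t *: frame c N q.
Proof.
rewrite /frame /mix !scalemxAl -mulmxDl; congr (_ *m _).
by apply/rowP => j; rewrite !mxE; ring.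
Qed.

Lemma pln_mix c N p q t :
  pln c N p -> pln c N q -> pln c N (mix p q t).
Proof. by rewrite /pln /= frame_mix entryD !entryZ => -> ->; rewrite !mulr0 addr0. Qed.

Lemma sqn_mix_lt c N p q t : sqn c N p < 1 -> sqn c N q <= 1 ->
  0 <= t < 1 -> sqn c N (mix p q t) < 1.
Proof.
rewrite /sqn frame_mix !entryD !entryZ.
move: (frame c N p 0 0) (frame c N p 0 1) (frame c N q 0 0) (frame c N q 0 1).
move=> a b x y h1 h2 /andP[t0 t1].
have : 0 <= (a - x) ^+ 2 + (b - y) ^+ 2 by rewrite addr_ge0 ?sqr_ge0.
have h : 0 <= t * (1 - t) by rewrite mulr_ge0 ?subr_ge0// ltW.
move=> /(mulr_ge0 h).
have : (1 - t) * (a ^+ 2 + b ^+ 2) < (1 - t) * 1 by rewrite ltr_pM2l ?subr_gt0.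
have : t * (x ^+ 2 + y ^+ 2) <= t * 1 by rewrite ler_wpM2l.
nra.
Qed.

Lemma sqn_mix_le c N p q t : sqn c N p <= 1 -> sqn c N q <= 1 ->
  0 <= t <= 1 -> sqn c N (mix p q t) <= 1.
Proof.
rewrite /sqn frame_mix !entryD !entryZ.
move: (frame c N p 0 0) (frame c N p 0 1) (frame c N q 0 0) (frame c N q 0 1).
move=> a b x y h1 h2 /andP[t0 t1].
have : 0 <= (a - x) ^+ 2 + (b - y) ^+ 2 by rewrite addr_ge0 ?sqr_ge0.
have h : 0 <= t * (1 - t) by rewrite mulr_ge0 ?subr_ge0.
move=> /(mulr_ge0 h).
have : (1 - t) * (a ^+ 2 + b ^+ 2) <= (1 - t) * 1 by rewrite ler_wpM2l ?subr_ge0.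
have : t * (x ^+ 2 + y ^+ 2) <= t * 1 by rewrite ler_wpM2l.
nra.
Qed.

Lemma frame_inj (c : V) (N : 'M[R]_3) : N \in unitmx -> injective (frame c N).
Proof.
move=> uN x y; rewrite /frame => /(congr1 (fun z : V => z *m invmx N)).
by rewrite !mulmxK// => /addIr.
Qed.

Lemma sqn_mix_chord (c : V) (N : 'M[R]_3) p q t :
  N \in unitmx -> circ c N p -> circ c N q ->
  p != q -> 0 < t < 1 -> sqn c N (mix p q t) < 1.
Proof.
move=> uN [p2 p01] [q2 q01] pq /andP[t0 t1].
have : 0 < (frame c N p 0 0 - frame c N q 0 0) ^+ 2 +
           (frame c N p 0 1 - frame c N q 0 1) ^+ 2.
  rewrite lt_neqAle addr_ge0 ?sqr_ge0// andbT eq_sym.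
  rewrite paddr_eq0 ?sqr_ge0// !sqrf_eq0 !subr_eq0.
  apply: contra pq => /andP[/eqP h0 /eqP h1]; apply/eqP/(@frame_inj c N uN).
  by apply: row3P => //; rewrite p2 q2.
have h : 0 < t * (1 - t) by rewrite mulr_gt0 ?subr_gt0.
move=> /(mulr_gt0 h).
move: p01 q01; rewrite /sqn frame_mix !entryD !entryZ.
move: (frame c N p 0 0) (frame c N p 0 1) (frame c N q 0 0) (frame c N q 0 1).
by move=> a b x y h1 h2; nra.
Qed.

(* The curve circ c N meets the plane of (d, M) transversely at p: a direction
   tangent to the curve is not parallel to the plane. *)
Definition cuts (c : V) N (d : V) M := forall p, circ c N p -> pln d M p ->
  exists u : V, [/\ (u *m N) 0 2 = 0,
    frame c N p 0 0 * (u *m N) 0 0 + frame c N p 0 1 * (u *m N) 0 1 = 0 &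
    (u *m M) 0 2 != 0].

(** Along the orthogonal vectors [(al, be)] and [(be, - al)] the point [w] has components [s] and
    [ka], up to the factor [D]. The line fixes the first, so its other end has [- ka]; in the disk
    the second is [lam * ka] with [|lam| <= 1]. *)
Lemma chord2 (al be w0 w1 : R) : w0 ^+ 2 + w1 ^+ 2 = 1 -> be * w0 - al * w1 != 0 ->
  exists v0 v1, [/\ v0 ^+ 2 + v1 ^+ 2 = 1, al * (v0 - w0) + be * (v1 - w1) = 0,
    ~ (v0 = w0 /\ v1 = w1) &
    forall z0 z1, z0 ^+ 2 + z1 ^+ 2 <= 1 -> al * (z0 - w0) + be * (z1 - w1) = 0 ->
      exists t, [/\ 0 <= t <= 1, z0 = (1 - t) * w0 + t * v0 &
                    z1 = (1 - t) * w1 + t * v1]].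
Proof.
move=> ww ka0; set ka := be * w0 - al * w1 in ka0.
pose D := al ^+ 2 + be ^+ 2; pose s := al * w0 + be * w1.
have DE : D = s ^+ 2 + ka ^+ 2.
  by rewrite /D /s /ka -[LHS]mulr1 -ww; ring.
have ka2 : 0 < ka ^+ 2 by rewrite exprn_even_gt0.
have D0 : 0 < D by rewrite DE ltr_wpDl ?sqr_ge0.
have D0' : D != 0 by rewrite gt_eqF.
have w0E : w0 = (s * al + ka * be) / D.
  by apply: (mulIf D0'); rewrite divfK// /s /ka /D; ring.
have w1E : w1 = (s * be - ka * al) / D.
  by apply: (mulIf D0'); rewrite divfK// /s /ka /D; ring.
exists ((s * al - ka * be) / D), ((s * be + ka * al) / D); split.
- rewrite !expr_div_n -mulrDl; apply: (mulIf (expf_neq0 2 D0')).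
  rewrite divfK ?expf_neq0// mul1r.
  have -> : (s * al - ka * be) ^+ 2 + (s * be + ka * al) ^+ 2 = (s ^+ 2 + ka ^+ 2) * D.
    by rewrite /D; ring.
  by rewrite -DE.
- by rewrite {1}w0E {1}w1E; field.
- move=> [h0 h1]; have := ka2; rewrite exprn_even_gt0//= => /eqP; apply.
  have : be * ((s * al - ka * be) / D - w0) - al * ((s * be + ka * al) / D - w1) = 0.
    by rewrite h0 h1 !subrr !mulr0 subrr.
  rewrite {1}w0E {1}w1E.
  have -> : be * ((s * al - ka * be) / D - (s * al + ka * be) / D) -
     al * ((s * be + ka * al) / D - (s * be - ka * al) / D) = - 2 * ka * (D / D).
    by rewrite {5}/D; field.
  by rewrite divff// mulr1 => /eqP; rewrite mulf_eq0 oppr_eq0 pnatr_eq0 /= => /eqP.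
- move=> z0 z1 zz zs.
  have sE : al * z0 + be * z1 = s by move: zs; rewrite /s; lra.
  pose kz := be * z0 - al * z1; pose lam := kz / ka.
  have z0E : z0 = (s * al + kz * be) / D.
    by apply: (mulIf D0'); rewrite divfK// -sE /kz /D; ring.
  have z1E : z1 = (s * be - kz * al) / D.
    by apply: (mulIf D0'); rewrite divfK// -sE /kz /D; ring.
  have kzE : kz = lam * ka by rewrite /lam divfK.
  have lam2 : lam ^+ 2 <= 1.
    have : (z0 ^+ 2 + z1 ^+ 2) * D <= 1 * D by rewrite ler_pM2r.
    have -> : (z0 ^+ 2 + z1 ^+ 2) * D = s ^+ 2 + kz ^+ 2 by rewrite -sE /kz /D; ring.
    by rewrite mul1r DE lerD2l kzE exprMn ger_pMl.
  have lam1 : -1 <= lam <= 1.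
    by rewrite -ler_norml -(@expr_le1 _ 2)// real_normK ?num_real.
  exists ((1 - lam) / 2); split.
  + by move: lam1 => /andP[? ?]; apply/andP; split; lra.
  + by rewrite {1}z0E {1}w0E kzE; field.
  + by rewrite {1}z1E {1}w1E kzE; field.
Qed.

Lemma mulmx_slopes (N M : 'M[R]_3) (v : V) : N \in unitmx ->
  (v *m M) 0 2 = (invmx N *m M) 0 2 * (v *m N) 0 0 +
    (invmx N *m M) 1 2 * (v *m N) 0 1 + (invmx N *m M) 2 2 * (v *m N) 0 2.
Proof.
move=> uN; rewrite -[v in LHS](mulmxK uN) -(mulmxA (v *m N)) mxE sum_ord3.
by rewrite ![_ * (invmx N *m M) _ _]mulrC.
Qed.

(** Transversality rules out tangency, so the two planes meet in a line that cuts a true chord from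
    the disk. The vector [nu] serves as second axis of the loop in [linked_not_null]. *)
Lemma chord (c : V) (N : 'M[R]_3) (d : V) (M : 'M[R]_3) p :
  N \in unitmx -> cuts c N d M -> circ c N p -> pln d M p ->
  exists q, [/\ circ c N q, pln d M q, p != q,
    forall x, dsk c N x -> pln d M x -> exists2 t, 0 <= t <= 1 & x = mix p q t &
    exists nu : V, (nu *m N) 0 2 = 0 /\ 0 < (nu *m M) 0 2].
Proof.
move=> uN cut Cp Pp; have [u [u2 u01 uM]] := cut p Cp Pp.
have [p2 p01] := Cp.
pose al := (invmx N *m M) 0 2; pose be := (invmx N *m M) 1 2.
have LE (v : V) : (v *m N) 0 2 = 0 ->
    (v *m M) 0 2 = al * (v *m N) 0 0 + be * (v *m N) 0 1.
  by move=> v2; rewrite (mulmx_slopes M v uN) v2 mulr0 addr0.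
set w0 := frame c N p 0 0 in u01 p01; set w1 := frame c N p 0 1 in u01 p01.
(* The tangent vector [u] is a multiple of [(- w1, w0)], on which the form [(al, be)] equals that
   multiple of [ka]. *)
have ka0 : be * w0 - al * w1 != 0.
  apply: contra_neq uM => ka; rewrite LE//.
  have e0 : (u *m N) 0 0 = - w1 * (w0 * (u *m N) 0 1 - w1 * (u *m N) 0 0).
    have h : (u *m N) 0 0 = (w0 ^+ 2 + w1 ^+ 2) * (u *m N) 0 0 by rewrite p01 mul1r.
    rewrite {1}h; have -> : (w0 ^+ 2 + w1 ^+ 2) * (u *m N) 0 0 =
      w0 * (w0 * (u *m N) 0 0 + w1 * (u *m N) 0 1) -
      w1 * (w0 * (u *m N) 0 1 - w1 * (u *m N) 0 0) by ring.
    by rewrite u01; ring.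
  have e1 : (u *m N) 0 1 = w0 * (w0 * (u *m N) 0 1 - w1 * (u *m N) 0 0).
    have h : (u *m N) 0 1 = (w0 ^+ 2 + w1 ^+ 2) * (u *m N) 0 1 by rewrite p01 mul1r.
    rewrite {1}h; have -> : (w0 ^+ 2 + w1 ^+ 2) * (u *m N) 0 1 =
      w1 * (w0 * (u *m N) 0 0 + w1 * (u *m N) 0 1) +
      w0 * (w0 * (u *m N) 0 1 - w1 * (u *m N) 0 0) by ring.
    by rewrite u01; ring.
  set r := w0 * (u *m N) 0 1 - w1 * (u *m N) 0 0 in e0 e1.
  rewrite e0 e1.
  have -> : al * (- w1 * r) + be * (w0 * r) = (be * w0 - al * w1) * r by ring.
  by rewrite ka mul0r.
have [v0 [v1 [vv vL vw vseg]]] := chord2 p01 ka0.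
pose v : V := \row_j (if j == 0 then v0 else if j == 1 then v1 else 0).
pose q := v *m invmx N + c.
have qE : frame c N q = v by rewrite /frame /q addrK mulmxKV.
have q0 : frame c N q 0 0 = v0 by rewrite qE mxE.
have q1 : frame c N q 0 1 = v1 by rewrite qE mxE.
have q2 : frame c N q 0 2 = 0 by rewrite qE mxE.
have diff x : (x - p) *m N = frame c N x - frame c N p.
  by rewrite /frame -mulmxBl opprB addrA subrK.
have diffM x : frame d M x = frame d M p + (x - p) *m M.
  by rewrite -frameD addrC subrK.
have pM x : frame c N x 0 2 = 0 ->
    frame d M x 0 2 = al * (frame c N x 0 0 - w0) + be * (frame c N x 0 1 - w1).
  move=> x2; rewrite diffM entryD Pp add0r LE.
    by rewrite diff !entryD !entryN.
  by rewrite diff entryD entryN x2 p2 subr0.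
exists q; split.
- by split=> //; rewrite q0 q1.
- by rewrite /pln /= pM// q0 q1.
- by apply/eqP => pq; apply: vw; rewrite -q0 -q1 -pq.
- move=> x [x2 x01] Px; move: (Px); rewrite /pln /= pM// => xL.
  have [t [t01 e0 e1]] := vseg _ _ x01 xL; exists t => //.
  apply: (@frame_inj c N uN); rewrite frame_mix; apply: row3P.
  + by rewrite entryD !entryZ q0.
  + by rewrite entryD !entryZ q1.
  + by rewrite entryD !entryZ q2 p2 x2 !mulr0 addr0.
- case: (ltgtP ((u *m M) 0 2) 0) uM => // uM _; last by exists u.
  by exists (- u); rewrite !mulNmx !entryN u2 oppr0 oppr_gt0.
Qed.

End Chords.

Section Pairs.
Variable R : realType.
Local Notation V := 'rV[R]_3.
Variables (c : V) (N : 'M[R]_3) (d : V) (M : 'M[R]_3).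
Hypotheses (uN : N \in unitmx) (cut : cuts c N d M).
Hypothesis disj : forall x, circ c N x -> circ d M x -> False.

Lemma circ_dsk (c' : V) N' x : circ c' N' x -> dsk c' N' x.
Proof. by move=> [? h]; split=> //; rewrite h. Qed.

Lemma dsk_mix (c' : V) N' p q t : dsk c' N' p -> dsk c' N' q -> 0 <= t <= 1 ->
  dsk c' N' (mix p q t).
Proof.
move=> [p2 p1] [q2 q1] t01; split; last exact: sqn_mix_le.
exact: pln_mix.
Qed.

(** A chord that starts in the other disk and reaches its boundary or leaves it would meet the
    boundary curve, by the intermediate value theorem. *)
Lemma pair_pierces p : circ c N p -> dsk d M p ->
  (forall x, dsk c N x -> circ d M x -> False) ->
  exists q, [/\ circ c N q, p != q,
    forall x, dsk c N x -> pln d M x -> exists2 t, 0 <= t <= 1 & x = mix p q t,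
    forall t, 0 <= t <= 1 -> [/\ dsk c N (mix p q t), pln d M (mix p q t) &
                                 sqn d M (mix p q t) < 1] &
    forall t, 0 < t < 1 -> sqn c N (mix p q t) < 1].
Proof.
move=> Cp Dp noD; have [q [Cq Pq pq seg _]] := chord uN cut Cp Dp.1.
exists q; split=> //; last by move=> t t01; exact: sqn_mix_chord.
have dm t : 0 <= t <= 1 -> dsk c N (mix p q t).
  by move=> t01; apply: dsk_mix => //; exact: circ_dsk.
have pm t : pln d M (mix p q t) by apply: pln_mix => //; exact: Dp.1.
move=> t t01; split=> //; first exact: dm.
rewrite ltNge; apply/negP => t1.
pose phi s := sqn d M (mix p q s).
have cphi : continuous phi by rewrite /phi /sqn /frame /mix; cts.
have phi0 : phi 0 <= 1 by rewrite /phi /mix subr0 scale1r scale0r addr0; exact: Dp.2.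
have [t0 tle1] := andP t01.
have [|s] := @IVT R phi 0 t 1 t0 (continuous_subspaceT cphi).
  by rewrite ge_min phi0 le_max t1 orbT.
rewrite in_itv /= => /andP[s0 st] phis.
have s01 : 0 <= s <= 1 by rewrite s0 (le_trans st).
apply: (noD (mix p q s)); first exact: dm.
by split; [exact: pm|exact: phis].
Qed.

(** If the far end [q] were inside the other disk as well, the whole chord would be, including [r],
    which lies on the boundary. Hence the curve crosses that disk exactly once. *)
Lemma pair_linked p r : circ c N p -> dsk d M p -> circ d M r -> dsk c N r ->
  ~ null_in (circ c N) (circ d M).
Proof.
move=> Cp Dp Cr Dr; have [q [Cq Pq pq seg [nu [nuN nuM]]]] := chord uN cut Cp Dp.1.
have p1 : sqn d M p < 1.
  rewrite lt_neqAle Dp.2 andbT; apply/eqP => p1.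
  by apply: (disj Cp); split=> //; exact: Dp.1.
apply: (linked_not_null uN Cp Cq Dp.1 Pq p1 _ nuN nuM).
rewrite leNgt; apply/negP => q1.
have [t /andP[t0 t1] rE] := seg r Dr Cr.1.
have : sqn d M r < 1.
  rewrite rE; move: t1; rewrite le_eqVlt => /predU1P[->|t1].
    by rewrite /mix subrr scale0r add0r scale1r.
  by apply: sqn_mix_lt => //; [exact: ltW|rewrite t0].
by rewrite /sqn Cr.2 ltxx.
Qed.

End Pairs.

(** * Gluing homotopies *)

Section Homotopies.
Variable R : realType.
Local Notation V := 'rV[R]_3.

Lemma compact_separation (K S : set V) : compact K -> closed S ->
  (forall z, K z -> ~ S z) ->
  exists2 e, 0 < e & forall z y, K z -> `|y - z| < e -> ~ S y.
Proof.
move=> cK cS dis.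
have [|n _ nP] := (compact_near_coveringP K).1 cK nat \oo
    (fun n z => forall y, `|y - z| < n.+1%:R^-1 -> ~ S y).
  move=> z Kz.
  have oS : open (~` S) by exact: closed_openC.
  have /nbhs_ballP[r /= r0 hr] : nbhs z (~` S).
    by apply: open_nbhs_nbhs; split=> //; exact: dis.
  have [k kr] : exists k : nat, k.+1%:R^-1 < r / 2.
    exists (Num.truncn (2 / r)); rewrite invf_plt ?posrE ?divr_gt0//.
    by rewrite invf_div truncnS_gt.
  exists (ball z (r / 2), [set n | (k <= n)%N]) => /=.
    by split; [apply: nbhsx_ballx; rewrite divr_gt0|exists k].
  move=> [x n] /= [zx kn] y yx; apply: hr; rewrite [r]splitr.
  apply: ball_triangle zx _; rewrite -ball_normE /ball_ /= distrC.
  apply: (lt_trans yx); apply: le_lt_trans kr.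
  by rewrite lef_pV2 ?posrE ?ltr0Sn// ler_nat.
exists n.+1%:R^-1; first by rewrite invr_gt0 ltr0Sn.
by move=> z y Kz; apply: (nP n _ z Kz) => /=.
Qed.

Definition clamp (x : R) := Num.max 0 (Num.min 1 x).

Lemma clamp_unit01 x : unit01 (clamp x).
Proof. by rewrite /unit01 /clamp le_max lexx ge_max ler01 ge_min lexx. Qed.

Lemma clamp_le0 x : x <= 0 -> clamp x = 0.
Proof. by move=> x0; apply: max_l; rewrite ge_min x0 orbT. Qed.

Lemma clamp_ge1 x : 1 <= x -> clamp x = 1.
Proof. by move=> x1; rewrite /clamp min_l// max_r. Qed.

(** The sum [G + F - G (1, _)] with clamped times is continuous at once; on each half of the time
    interval two of its terms cancel. *)
Lemma null_loop_homotopy (Ob : set V) (gam : R -> V) (G : R * R -> V) :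
  continuous G -> (forall s, unit01 s -> G (0, s) = gam s) ->
  (forall t, unit01 t -> G (t, 0) = G (t, 1)) ->
  (forall t s, unit01 t -> unit01 s -> ~ Ob (G (t, s))) ->
  null_loop Ob (fun s => G (1, s)) -> null_loop Ob gam.
Proof.
move=> cG G0 Gper GO [F [cF F0 F1 Fper FO]].
pose a (t : R) := clamp (2 * t); pose b (t : R) := clamp (2 * t - 1).
have ca : continuous a by rewrite /a /clamp; cts.
have cb : continuous b by rewrite /b /clamp; cts.
pose H ts := G (a ts.1, ts.2) + F (b ts.1, ts.2) - G (1, ts.2).
have HG t s : unit01 s -> t <= 2^-1 -> H (t, s) = G (a t, s).
  move=> s01 t2; rewrite /H /= (_ : b t = 0) ?F0 ?addrK//.
  by apply: clamp_le0; lra.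
have HF t s : 2^-1 <= t -> H (t, s) = F (b t, s).
  move=> t2; rewrite /H /= (_ : a t = 1); first by rewrite addrAC subrr add0r.
  by apply: clamp_ge1; lra.
have h01 : (0 : R) <= 2^-1 by rewrite invr_ge0.
have h11 : 2^-1 <= (1 : R) by rewrite invf_le1 ?ler1n.
have u0 : unit01 (0 : R) by rewrite /unit01 lexx ler01.
have u1 : unit01 (1 : R) by rewrite /unit01 lexx ler01.
have b1 : b 1 = 1 by apply: clamp_ge1; lra.
have a0 : a 0 = 0 by apply: clamp_le0; lra.
exists H; split.
- by rewrite /H; cts.
- by move=> s s01; rewrite HG// a0 G0.
- by move=> s s01; rewrite !HF// b1 F1.
- move=> t t01; have [t2|/ltW t2] := leP t 2^-1.
    by rewrite !HG// Gper//; exact: clamp_unit01.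
  by rewrite !HF// Fper//; exact: clamp_unit01.
- move=> t s t01 s01; have [t2|/ltW t2] := leP t 2^-1.
    by rewrite HG//; apply: GO => //; exact: clamp_unit01.
  by rewrite HF//; apply: FO => //; exact: clamp_unit01.
Qed.

End Homotopies.

(** * Sliding a loop off a disk *)

Section Slide.
Variable R : realType.
Local Notation V := 'rV[R]_3.
Variables (o g v om : V) (D K xi0 : R).

(** Here [E3] is centred at [o] in the plane of [xi] and [eta], and [E1] lies in the plane
    [xi = xi0]. The normalization [xi0E] makes the chord of [E3] in that plane [|eta| <= 1]. *)
Definition place (xi eta zeta : R) : V := o + xi *: g + eta *: v + zeta *: om.

Hypotheses (D0 : 0 < D) (K0 : 0 < K) (xi0E : xi0 ^+ 2 * D + K = 1).
Variables (E1 E2 E3 : set V) (eta zeta : V -> R).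
Hypotheses (ceta : continuous eta) (czeta : continuous zeta).
Hypotheses (closedE1 : closed E1) (closedE2 : closed E2).
Hypothesis E1E : forall x, E1 x -> x = place xi0 (eta x) (zeta x).
Hypothesis E3E : forall a b z, E3 (place a b z) ->
  z = 0 /\ a ^+ 2 * D + b ^+ 2 * K = 1.
Hypothesis star : forall x, E1 x -> forall mu, 0 <= mu <= 1 ->
  ~ E2 (place xi0 (mu * eta x) (mu * zeta x)).
(* The part xi <= xi0 of the disk bounded by E3 misses E1 and E2. *)
Hypothesis half : forall a b, a <= xi0 -> a ^+ 2 * D + b ^+ 2 * K <= 1 ->
  ~ (E1 `|` E2) (place a b 0).

Let r : R := (Num.sqrt D)^-1.

Let r2 : r ^+ 2 * D = 1.
Proof. by rewrite exprVn sqr_sqrtr ?ltW// mulVf// gt_eqF. Qed.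

Let r0 : 0 < r.
Proof. by rewrite invr_gt0 sqrtr_gt0. Qed.

Let xi0_lt : - r < xi0 < r.
Proof.
rewrite -ltr_norml -(@ltr_pXn2r _ 2)// ?nnegrE// ?(ltW r0)// real_normK ?num_real//.
by rewrite -(ltr_pM2r D0) r2 -xi0E ltrDl.
Qed.

Let r_xi0 : - r <= xi0.
Proof. by case/andP: xi0_lt => /ltW. Qed.

(** The half disk is compact and misses two closed curves, so boxes of some half-width [k] around
    its points miss them too. *)
Let nearby : exists2 k, 0 < k & forall a b x y z, a <= xi0 ->
  a ^+ 2 * D + b ^+ 2 * K <= 1 -> `|x - a| <= k -> `|y - b| <= k -> `|z| <= k ->
  ~ (E1 `|` E2) (place x y z).
Proof.
pose B : set V := [set q | q 0 2 = 0] `&` ([set q | q 0 0 <= xi0] `&`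
  [set q | q 0 0 ^+ 2 * D + q 0 1 ^+ 2 * K <= 1]).
have cB : compact B.
  apply: (@coord_bound_compact _ _ (1 + D^-1 + K^-1)).
    by do ![apply: closedI]; [apply: closed_fun_eq|apply: closed_fun_le..]; cts.
  have iD : 0 < D^-1 by rewrite invr_gt0.
  have iK : 0 < K^-1 by rewrite invr_gt0.
  have sq_bound (q L : R) : 0 < L -> q ^+ 2 * L <= 1 -> `|q| <= 1 + L^-1.
    move=> L0 qL; rewrite leNgt; apply/negP => qq.
    have : q ^+ 2 <= L^-1 by rewrite -[L^-1]mul1r ler_pdivlMr.
    have iL : 0 < L^-1 by rewrite invr_gt0.
    by rewrite -(@real_normK _ q) ?num_real//; nra.
  move=> q [/= q2 [_ q01]] i.
  have h0 : 0 <= q 0 0 ^+ 2 * D by rewrite mulr_ge0 ?sqr_ge0// ltW.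
  have h1 : 0 <= q 0 1 ^+ 2 * K by rewrite mulr_ge0 ?sqr_ge0// ltW.
  elim/ord3P: i.
  - by have := @sq_bound (q 0 0) D D0; lra.
  - by have := @sq_bound (q 0 1) K K0; lra.
  - by rewrite q2 normr0; lra.
pose f (q : V) := place (q 0 0) (q 0 1) 0.
have cfB : compact (f @` B).
  apply: continuous_compact => //; apply: continuous_subspaceT.
  by rewrite /f /place; cts.
have [|e e0 he] := compact_separation cfB (closedU closedE1 closedE2).
  by move=> _ [q [_ [q0 q01]] <-]; exact: half.
pose L : R := `|g| + `|v| + `|om| + 1.
have L0 : 0 < L by rewrite ltr_wpDl// !addr_ge0.
exists (e / (2 * L)); first by rewrite divr_gt0 ?mulr_gt0.
move=> a b x y z a0 ab xa yb zk.
set k := e / (2 * L) in xa yb zk.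
have k0 : 0 < k by rewrite divr_gt0 ?mulr_gt0.
pose q : V := \row_j (if j == 0 then a else if j == 1 then b else 0).
apply: (he (place a b 0)).
  exists q; last by rewrite /f !mxE.
  by split; [rewrite /= !mxE|split; rewrite /= !mxE].
have -> : place x y z - place a b 0 = (x - a) *: g + (y - b) *: v + z *: om.
  by apply/rowP => j; rewrite !mxE; ring.
apply: (@le_lt_trans _ _ (k * L)).
  rewrite (le_trans (ler_normD _ _))// (le_trans (lerD (ler_normD _ _) (lexx _)))//.
  rewrite !normrZ /L !mulrDr mulr1 -[leLHS]addr0.
  by apply: lerD; [apply: lerD; [apply: lerD|]|exact: ltW]; exact: ler_wpM2r.
by rewrite /k invfM mulrA divfK ?gt_eqF// ltr_pdivrMr// ltr_pMr// ltr1n.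
Qed.

(* The loop shrinks in the plane xi = xi0 to a thin curve around the chord of
   E3, slides past the tip of E3, then shrinks to a point. *)
Lemma slide_null : null_in E1 (E2 `|` E3).
Proof.
have [k k0 hk] := nearby.
have k1 : 0 < 1 + k by rewrite addr_gt0.
(* The rhombus [rho <= 1] lies within [k] of the chord, so [E1] stays outside its interior; dividing
   by [rho] projects [E1] to its boundary. *)
pose rho x := `|eta x| / (1 + k) + `|zeta x| / k.
have crho : continuous rho by rewrite /rho; cts.
have rho1 x : E1 x -> 1 <= rho x.
  move=> Ex; rewrite leNgt; apply/negP => rx.
  have zk : `|zeta x| <= k.
    have : 0 <= `|eta x| / (1 + k) by rewrite divr_ge0// ltW.
    move=> h; rewrite -[k]mul1r -ler_pdivrMr//; move: rx; rewrite /rho; lra.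
  have ek : `|eta x| <= 1 + k.
    have : 0 <= `|zeta x| / k by rewrite divr_ge0// ltW.
    move=> h; rewrite -[1 + k]mul1r -ler_pdivrMr//; move: rx; rewrite /rho; lra.
  (* The point of the chord nearest to [eta x]. *)
  pose b := Num.max (-1) (Num.min 1 (eta x)).
  have b1 : -1 <= b <= 1.
    by rewrite /b le_max lexx ge_max ge_min lexx; lra.
  apply: (hk xi0 b xi0 (eta x) (zeta x)) => //.
  - have : b ^+ 2 <= 1 by case/andP: b1; nra.
    by have := xi0E; have := K0; nra.
  - by rewrite subrr normr0 ltW.
  - move: ek; rewrite /b !ler_norml => /andP[e1 e2].
    rewrite maxEle; case: ifPn; rewrite minEle; case: ifPn => //; rewrite -?ltNge => h1 h2;
      apply/andP; split; lra.
  - by left; rewrite -E1E.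
move=> gam cgam Egam gam01.
have rg0 s : rho (gam s) != 0 by rewrite gt_eqF// (lt_le_trans ltr01) ?rho1.
have crg : continuous (fun s => (rho (gam s))^-1).
  by apply: cts_inv => //; exact: cts_comp cgam crho.
pose y s := eta (gam s) / rho (gam s) / (1 + k).
pose z s := zeta (gam s) / rho (gam s) / k.
have ceg : continuous (fun s => eta (gam s)) by exact: cts_comp cgam ceta.
have czg : continuous (fun s => zeta (gam s)) by exact: cts_comp cgam czeta.
have cy : continuous y.
  by apply: cts_mul; [exact: cts_mul ceg crg|exact: cts_cst].
have cz : continuous z.
  by apply: cts_mul; [exact: cts_mul czg crg|exact: cts_cst].
have y01 : y 0 = y 1 by rewrite /y gam01.
have z01 : z 0 = z 1 by rewrite /z gam01.
have rg s : 0 < rho (gam s) by rewrite (lt_le_trans ltr01) ?rho1.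
have yz s : `|y s| + `|z s| = 1.
  rewrite /y /z !normrM !normfV (gtr0_norm k0) (gtr0_norm k1) (gtr0_norm (rg s)).
  transitivity (rho (gam s) / rho (gam s)); last exact: divff.
  by rewrite {3}/rho mulrDl; congr (_ + _); exact: mulrAC.
have yE s : eta (gam s) = rho (gam s) * ((1 + k) * y s).
  by rewrite /y mulrC [_ * _ / (1 + k)]mulrC mulVKf ?gt_eqF// divfK.
have zE s : zeta (gam s) = rho (gam s) * (k * z s).
  by rewrite /z mulrC [_ * _ / k]mulrC mulVKf ?gt_eqF// divfK.
have y1 s : `|y s| <= 1 by rewrite -(yz s) lerDl.
have z1 s : `|z s| <= 1 by rewrite -(yz s) lerDr.
clearbody y z.
have y_sq s : z s = 0 -> y s ^+ 2 = 1.
  move=> zs; have := yz s; rewrite zs normr0 addr0.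
  by rewrite -(@real_normK _ (y s)) ?num_real// => ->; rewrite expr1n.
(* Half the chord of [E3] at level [xi], read as 0 beyond the tip, plus the margin [k]. When [z] is
   0, [|y|] is 1, and the loop passes outside [E3]. *)
pose lam xi := Num.sqrt (Num.max 0 (1 - xi ^+ 2 * D) / K) + k.
have clam : continuous lam by rewrite /lam; cts.
have lam_sq xi : lam xi ^+ 2 * K > Num.max 0 (1 - xi ^+ 2 * D).
  have h : 0 <= Num.max 0 (1 - xi ^+ 2 * D) by rewrite le_max lexx.
  have := sqr_sqrtr (divr_ge0 h (ltW K0)).
  have := sqrtr_ge0 (Num.max 0 (1 - xi ^+ 2 * D) / K); rewrite /lam.
  set q := Num.sqrt _ => q0 qE.
  have -> : Num.max 0 (1 - xi ^+ 2 * D) = q ^+ 2 * K by rewrite qE divfK// gt_eqF.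
  rewrite ltr_pM2r//; nra.
have lam0 : lam xi0 = 1 + k.
  rewrite /lam max_r; last by have := xi0E; have := K0; lra.
  have -> : 1 - xi0 ^+ 2 * D = K by have := xi0E; lra.
  by rewrite divff ?gt_eqF// sqrtr1.
have lam1 : lam (- r - k) = k.
  rewrite /lam max_l ?mul0r ?sqrtr0 ?add0r//.
  have := r2; have := D0; have := r0; move=> h1 h2 h3.
  have : r ^+ 2 * D <= (- r - k) ^+ 2 * D by rewrite ler_pM2r//; nra.
  lra.
(* Both coordinates shrink by a common factor, so [star] excludes [E2]. At [zeta = 0] one has
   [|eta| >= 1 + k], which excludes [E3]. *)
apply: (@null_loop_homotopy _ _ _ (fun ts => place xi0
  ((1 - ts.1) * eta (gam ts.2) + ts.1 * ((1 + k) * y ts.2))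
  ((1 - ts.1) * zeta (gam ts.2) + ts.1 * (k * z ts.2)))).
- by rewrite /place; cts.
- by move=> s _ /=; rewrite subr0 !mul1r !mul0r !addr0 -E1E.
- by move=> t _ /=; rewrite gam01 y01 z01.
- move=> t s /andP[t0 t1] _ /= [|].
    have -> : (1 - t) * eta (gam s) + t * ((1 + k) * y s) =
        (1 - t + t / rho (gam s)) * eta (gam s).
      by rewrite [RHS]mulrDl {3}yE; congr (_ + _); rewrite -mulrA mulKf.
    have -> : (1 - t) * zeta (gam s) + t * (k * z s) =
        (1 - t + t / rho (gam s)) * zeta (gam s).
      by rewrite [RHS]mulrDl {3}zE; congr (_ + _); rewrite -mulrA mulKf.
    apply: star => //.
    have i1 : (rho (gam s))^-1 <= 1 by rewrite invf_le1 ?rho1.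
    have i0 : 0 <= (rho (gam s))^-1 by rewrite invr_ge0 ltW.
    by apply/andP; split; nra.
  move=> /E3E[/eqP]; rewrite yE zE.
  have -> : (1 - t) * (rho (gam s) * (k * z s)) + t * (k * z s) =
    ((1 - t) * rho (gam s) + t) * (k * z s) by ring.
  have -> : (1 - t) * (rho (gam s) * ((1 + k) * y s)) + t * ((1 + k) * y s) =
    ((1 - t) * rho (gam s) + t) * ((1 + k) * y s) by ring.
  have mu1 : 1 <= (1 - t) * rho (gam s) + t by have := rho1 _ (Egam s); nra.
  rewrite !mulf_eq0 (gt_eqF k0) (gt_eqF (lt_le_trans ltr01 mu1)) /= => /eqP zs.
  rewrite !exprMn (y_sq s zs) mulr1; move: mu1; set mu := _ + t => mu1.
  have h : 1 < mu ^+ 2 * (1 + k) ^+ 2.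
    have m2 : 1 <= mu ^+ 2 by nra.
    have k2 : 1 < (1 + k) ^+ 2 by have := k0; nra.
    by move: m2 k2; move: (mu ^+ 2) ((1 + k) ^+ 2) => A B; nra.
  have : 1 * K < mu ^+ 2 * (1 + k) ^+ 2 * K by rewrite ltr_pM2r.
  by have := xi0E; lra.
apply: (@null_loop_homotopy _ _ _ (fun ts =>
  place ((1 - ts.1) * xi0 + ts.1 * (- r - k))
    (lam ((1 - ts.1) * xi0 + ts.1 * (- r - k)) * y ts.2) (k * z ts.2))).
- by rewrite /place; cts.
- by move=> s _ /=; rewrite !subr0 subrr !mul1r !mul0r !addr0 !add0r lam0.
- by move=> t _ /=; rewrite y01 z01.
- move=> t s /andP[t0 t1] _ /=; set xi := _ + _ * (_ - k).
  have zk : `|k * z s| <= k by rewrite normrM gtr0_norm// ger_pMr.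
  have xik : xi <= xi0.
    by have := r_xi0; rewrite /xi; nra.
  have xirk : - r - k <= xi by have := r_xi0; rewrite /xi; nra.
  move=> [E2p|].
    (* The comparison point in the half disk is obtained by removing the margin [k] and stopping at
       the tip [- r]. *)
    apply: (hk (Num.max (- r) xi) ((lam xi - k) * y s) xi (lam xi * y s) (k * z s)) => //.
    + by rewrite ge_max r_xi0.
    + have q0 : 0 <= Num.sqrt (Num.max 0 (1 - xi ^+ 2 * D) / K) by exact: sqrtr_ge0.
      have h : 0 <= Num.max 0 (1 - xi ^+ 2 * D) by rewrite le_max lexx.
      have qE := sqr_sqrtr (divr_ge0 h (ltW K0)).
      rewrite /lam addrK; move: q0 qE; set q := Num.sqrt _ => q0 qE.
      have -> : (q * y s) ^+ 2 * K = q ^+ 2 * K * y s ^+ 2 by ring.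
      rewrite qE divfK ?gt_eqF//.
      have ys : 0 <= y s ^+ 2 <= 1.
        by rewrite sqr_ge0 -(@real_normK _ (y s)) ?num_real// expr_le1 ?y1.
      have [rx|xr] := leP (- r) xi.
        have xiD : xi ^+ 2 * D <= 1.
          rewrite -r2 ler_pM2r// -(@real_normK _ xi) ?num_real//.
          rewrite ler_pXn2r ?nnegrE ?(ltW r0)//.
          by rewrite ler_norml rx (le_trans xik)//; case/andP: xi0_lt => _ /ltW.
        rewrite max_r ?subr_ge0//; case/andP: ys => ? ?; nra.
      rewrite sqrrN r2 max_l ?mul0r ?addr0//.
      have : r ^+ 2 * D <= xi ^+ 2 * D by rewrite ler_pM2r//; have := r0; nra.
      by rewrite r2; lra.
    + case: (leP (- r) xi) => [_|h]; first by rewrite subrr normr0 ltW.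
      by rewrite ler_norml; apply/andP; split; lra.
    + have -> : lam xi * y s - (lam xi - k) * y s = k * y s by ring.
      by rewrite normrM gtr0_norm// ger_pMr.
    + by right.
  move=> /E3E[/eqP]; rewrite mulf_eq0 (gt_eqF k0) /= => /eqP zs.
  rewrite exprMn (y_sq s zs) mulr1; have := lam_sq xi; rewrite gt_max => /andP[h1 h2].
  by lra.
(* Beyond the tip the loop contracts within distance [k] of it, where neither curve passes. *)
exists (fun ts => place (- r - k) ((1 - ts.1) * (k * y ts.2)) ((1 - ts.1) * (k * z ts.2))).
split.
- by rewrite /place; cts.
- by move=> s _ /=; rewrite subr0 subrr mul0r !mul1r add0r lam1.
- by move=> s _ /=; rewrite subrr !mul0r.
- by move=> t _ /=; rewrite y01 z01.
- move=> t s /andP[t0 t1] _ /= [E2p|].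
    apply: (hk (- r) 0 (- r - k) ((1 - t) * (k * y s)) ((1 - t) * (k * z s))) => //.
    + by rewrite sqrrN r2 expr0n /= mul0r addr0.
    + by rewrite addrAC subrr add0r normrN gtr0_norm.
    + rewrite subr0 !normrM (gtr0_norm k0) ger0_norm ?subr_ge0//.
      by rewrite mulrCA ger_pMr// mulr_ile1 ?subr_ge0// gerBl.
    + rewrite !normrM (gtr0_norm k0) ger0_norm ?subr_ge0//.
      by rewrite mulrCA ger_pMr// mulr_ile1 ?subr_ge0// gerBl.
    + by right.
  move=> /E3E[_].
  have : 0 <= ((1 - t) * (k * y s)) ^+ 2 * K by rewrite mulr_ge0 ?sqr_ge0// ltW.
  have : r ^+ 2 * D < (- r - k) ^+ 2 * D by rewrite ltr_pM2r//; have := mulr_gt0 r0 k0; nra.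
  by rewrite r2; lra.
Qed.

End Slide.

Section Cycle.
Variable R : realType.
Local Notation V := 'rV[R]_3.

Lemma closed_circ (c : V) N : closed (circ c N).
Proof. by apply: closedI; apply: closed_fun_eq; rewrite /frame; cts. Qed.

(** Without a triple point, the height over the first plane has constant sign on the chord of disks
    2 and 3. So the second curve meets disk 3 on one side of the first plane, and the other half of
    disk 3 is free for sliding. *)
Lemma cycle_null (c1 c2 c3 : V) (N1 N2 N3 : 'M[R]_3) (a b : V) :
  N1 \in unitmx -> N2 \in unitmx -> N3 \in unitmx ->
  cuts c3 N3 c1 N1 -> cuts c2 N2 c3 N3 ->
  (forall x, circ c3 N3 x -> circ c1 N1 x -> False) ->
  (forall x, circ c2 N2 x -> circ c3 N3 x -> False) ->
  (forall x, dsk c1 N1 x -> circ c2 N2 x -> False) ->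
  (forall x, dsk c2 N2 x -> circ c3 N3 x -> False) ->
  (forall x, dsk c3 N3 x -> circ c1 N1 x -> False) ->
  circ c3 N3 a -> dsk c1 N1 a -> circ c2 N2 b -> dsk c3 N3 b ->
  (forall x, dsk c1 N1 x -> dsk c2 N2 x -> dsk c3 N3 x -> False) ->
  null_in (circ c1 N1) (circ c2 N2 `|` circ c3 N3).
Proof.
move=> u1 u2 u3 cut31 cut23 dis31 dis23 h12 h23 h31 Ca Da Cb Db notriple.
have [q [Cq aq seg31 D31 _]] := pair_pierces u3 cut31 Ca Da h31.
have [q' [Cq' bq' seg23 D23 _]] := pair_pierces u2 cut23 Cb Db h23.
pose n x := frame c1 N1 x 0 2.
have nmix x y t : n (mix x y t) = (1 - t) * n x + t * n y.
  by rewrite /n frame_mix entryD !entryZ.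
have n_neq0 t : 0 <= t <= 1 -> n (mix b q' t) != 0.
  move=> /D23[d2 p3 s3]; apply/eqP => nx.
  have d3 : dsk c3 N3 (mix b q' t) by split; [exact: p3|exact: ltW].
  have [s /D31[_ p1 s1] xE] := seg31 _ d3 nx.
  by apply: (notriple _ _ d2 d3); rewrite xE; split; [exact: p1|exact: ltW].
have mix0 (x y : V) : mix x y 0 = x by rewrite /mix subr0 scale1r scale0r addr0.
have mix1 (x y : V) : mix x y 1 = y by rewrite /mix subrr scale1r scale0r add0r.
have [nb nq] : n b != 0 /\ n q' != 0.
  split; first by rewrite -(mix0 b q') n_neq0// lexx ler01.
  by rewrite -(mix1 b q') n_neq0// lexx ler01.
(* Normalizes the side: the chord from [b] to [q'] gets positive height. *)
pose ep := Num.sg (n b).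
have ep2 : ep ^+ 2 = 1 by rewrite sqr_sg nb.
have epb : 0 < ep * n b by rewrite /ep -normrEsg normr_gt0.
have epq : 0 < ep * n q'.
  rewrite ltNge; apply/negP => h.
  have h' : ep * n q' < 0.
    by rewrite lt_neqAle h andbT mulf_eq0 sgr_eq0 (negPf nb) (negPf nq).
  have den : 0 < ep * n b - ep * n q' by lra.
  have t01 : 0 <= ep * n b / (ep * n b - ep * n q') <= 1.
    apply/andP; split; first by rewrite divr_ge0 ?ltW.
    by rewrite ler_pdivrMr// mul1r lerBrDl gerDr ltW.
  have ep0 : ep != 0 by rewrite sgr_eq0.
  move/eqP: (n_neq0 _ t01); apply; apply: (mulfI ep0); rewrite nmix mulr0.
  by field; rewrite gt_eqF.
have nE2 x : circ c2 N2 x -> dsk c3 N3 x -> 0 < ep * n x.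
  move=> Cx Dx; have [t /andP[t0 t1] ->] := seg23 x (circ_dsk Cx) Dx.1.
  rewrite nmix mulrDr !(mulrCA ep).
  by move: epb epq; move: (ep * n b) (ep * n q') => A B *; nra.
pose al := ep * (invmx N3 *m N1) 0 2; pose be := ep * (invmx N3 *m N1) 1 2.
pose ka := ep * (invmx N3 *m N1) 2 2.
have nE (v : V) : ep * (v *m N1) 0 2 =
    al * (v *m N3) 0 0 + be * (v *m N3) 0 1 + ka * (v *m N3) 0 2.
  by rewrite (mulmx_slopes N1 v u3) /al /be /ka; ring.
pose D := al ^+ 2 + be ^+ 2.
have D0 : 0 < D.
  rewrite lt_neqAle addr_ge0 ?sqr_ge0// andbT eq_sym paddr_eq0 ?sqr_ge0// !sqrf_eq0.
  apply/negP => /andP[/eqP al0 /eqP be0].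
  have [u [uN3 _ /negP]] := cut31 a Ca Da.1; apply.
  have ep0 : ep != 0 by rewrite sgr_eq0.
  by rewrite -(mulrI_eq0 _ (mulfI ep0)) nE al0 be0 uN3 !mul0r mulr0 !addr0.
have Dn : D != 0 by rewrite gt_eqF.
pose w := frame c3 N3.
pose v : V := 2^-1 *: (q - a).
pose k0 := (v *m N3) 0 0; pose k1 := (v *m N3) 0 1.
have vN3 : v *m N3 = 2^-1 *: (w q - w a).
  by rewrite /v -scalemxAl /w /frame -mulmxBl opprB addrA subrK.
have v2 : (v *m N3) 0 2 = 0.
  by rewrite vN3 entryZ entryD entryN Cq.1 Ca.1 subrr mulr0.
have na : n a = 0 by exact: Da.1.
have nq0 : n q = 0.
  have : 0 <= (1 : R) <= 1 by rewrite lexx ler01.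
  by move=> /D31[_ h _]; move: h; rewrite mix1.
have vN1 : (v *m N1) 0 2 = 0.
  have -> : v *m N1 = 2^-1 *: (frame c1 N1 q - frame c1 N1 a).
    by rewrite /v -scalemxAl /frame -mulmxBl opprB addrA subrK.
  by rewrite entryZ entryD entryN -/(n q) -/(n a) nq0 na subrr mulr0.
have kperp : al * k0 + be * k1 = 0.
  by have := nE v; rewrite vN1 v2 !mulr0 addr0 => <-.
(* The half-chord [(k0, k1)] is orthogonal to the slope [(al, be)], so it is [tau] times the slope
   rotated by a right angle. *)
pose tau := (al * k1 - be * k0) / D.
have k0E : k0 = - tau * be.
  apply: (mulIf Dn); rewrite /tau mulNr mulrAC mulrAC -mulrA mulNr.
  have -> : k0 * D = - be * (al * k1 - be * k0) + al * (al * k0 + be * k1) by rewrite /D; ring.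
  by rewrite kperp mulr0 addr0; field.
have k1E : k1 = tau * al.
  apply: (mulIf Dn).
  have -> : k1 * D = al * (al * k1 - be * k0) + be * (al * k0 + be * k1) by rewrite /D; ring.
  by rewrite kperp mulr0 addr0 /tau; field.
pose K := k0 ^+ 2 + k1 ^+ 2.
have KE : K = tau ^+ 2 * D by rewrite /K k0E k1E /D; ring.
have tau0 : tau != 0.
  apply/eqP => t0; move/eqP: aq; apply; apply: (@frame_inj _ c3 N3 u3).
  have h : v *m N3 = 0.
    by apply: row3P; rewrite [RHS]mxE ?v2// -/k0 -/k1 ?k0E ?k1E t0 ?oppr0 mul0r.
  move: h; rewrite vN3 => /eqP; rewrite scaler_eq0 invr_eq0 pnatr_eq0 /= subr_eq0.
  by move=> /eqP /esym.
have K0 : 0 < K by rewrite KE mulr_gt0// exprn_even_gt0.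
(* The midpoint of a chord lies on the perpendicular through the centre; hence its frame coordinates
   are [xi0] times the slope. *)
pose m := mix a q 2^-1.
have half01 : 0 <= (2^-1 : R) <= 1 by apply/andP; split; lra.
have [_ m1 sm] := D31 _ half01; rewrite -/m in m1 sm.
have Dm1 : dsk c1 N1 m by split; [exact: m1|exact: ltW].
have wm j : w m 0 j = 2^-1 * (w a 0 j + w q 0 j).
  by rewrite /w /m frame_mix entryD !entryZ; lra.
have wv j : (v *m N3) 0 j = 2^-1 * (w q 0 j - w a 0 j).
  by rewrite vN3 entryZ entryD entryN.
have m2 : w m 0 2 = 0 by rewrite wm /w Ca.1 Cq.1 addr0 mulr0.
have mk : w m 0 0 * k0 + w m 0 1 * k1 = 0.
  rewrite !wm /k0 /k1 !wv; have := Ca.2; have := Cq.2; rewrite -/w.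
  by move: (w a 0 0) (w a 0 1) (w q 0 0) (w q 0 1) => ? ? ? ?; nra.
have mm : w m 0 0 ^+ 2 + w m 0 1 ^+ 2 + K = 1.
  rewrite /K !wm /k0 /k1 !wv; have := Ca.2; have := Cq.2; rewrite -/w.
  by move: (w a 0 0) (w a 0 1) (w q 0 0) (w q 0 1) => ? ? ? ?; nra.
pose xi0 := (al * w m 0 0 + be * w m 0 1) / D.
have mperp : be * w m 0 0 - al * w m 0 1 = 0.
  by apply: (mulfI tau0); move: mk; rewrite k0E k1E mulr0 => h; nra.
have m0E : w m 0 0 = xi0 * al.
  apply: (mulIf Dn).
  have -> : xi0 * al * D = (al * w m 0 0 + be * w m 0 1) * al by rewrite /xi0; field.
  have -> : w m 0 0 * D = (al * w m 0 0 + be * w m 0 1) * al +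
      be * (be * w m 0 0 - al * w m 0 1).
    by rewrite /D; ring.
  by rewrite mperp mulr0 addr0.
have m1E : w m 0 1 = xi0 * be.
  apply: (mulIf Dn).
  have -> : xi0 * be * D = (al * w m 0 0 + be * w m 0 1) * be by rewrite /xi0; field.
  have -> : w m 0 1 * D = (al * w m 0 0 + be * w m 0 1) * be -
      al * (be * w m 0 0 - al * w m 0 1).
    by rewrite /D; ring.
  by rewrite mperp mulr0 subr0.
have xi0E : xi0 ^+ 2 * D + K = 1.
  by rewrite -mm m0E m1E /D; ring.
pose g : V := (\row_j (if j == 0 then al else if j == 1 then be else 0)) *m invmx N3.
(* The first two entries cancel the contribution of the third to the height, so that [xi] alone
   determines the height. *)
pose om : V := (\row_j (if j == 0 then - (ka * al / D) else
  if j == 1 then - (ka * be / D) else 1)) *m invmx N3.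
pose P := place c3 g v om.
have wP x y z : [/\ w (P x y z) 0 0 = x * al + y * k0 - z * (ka * al / D),
    w (P x y z) 0 1 = x * be + y * k1 - z * (ka * be / D) & w (P x y z) 0 2 = z].
  have -> : w (P x y z) = x *: (g *m N3) + y *: (v *m N3) + z *: (om *m N3).
    by rewrite /w /frame /P /place -2!(addrA c3) [c3 + _]addrC addrK !mulmxDl -!scalemxAl.
  rewrite !entryD !entryZ /g /om !mulmxKV// v2 -/k0 -/k1.
  by split; rewrite !mxE /=; ring.
have PE x : w x 0 0 * al + w x 0 1 * be + w x 0 2 * ka = xi0 * D ->
    x = P xi0 ((w x 0 0 * k0 + w x 0 1 * k1) / K) (w x 0 2).
  move=> h; apply: (@frame_inj _ c3 N3 u3).
  have [h0 h1 h2] := wP xi0 ((w x 0 0 * k0 + w x 0 1 * k1) / K) (w x 0 2).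
  apply: row3P; rewrite -/w ?h0 ?h1 ?h2//.
  - have -> : xi0 = (w x 0 0 * al + w x 0 1 * be + w x 0 2 * ka) / D.
      by rewrite h mulfK.
    by rewrite KE k0E k1E /D; field; rewrite tau0 Dn.
  - have -> : xi0 = (w x 0 0 * al + w x 0 1 * be + w x 0 2 * ka) / D.
      by rewrite h mulfK.
    by rewrite KE k0E k1E /D; field; rewrite tau0 Dn.
have nx x : ep * n x = w x 0 0 * al + w x 0 1 * be + w x 0 2 * ka - xi0 * D.
  have -> : ep * n x = ep * ((x - m) *m N1) 0 2.
    rewrite -[x in LHS](subrK m) /n addrC frameD entryD.
    have -> : frame c1 N1 m 0 2 = 0 by exact: m1.
    by rewrite add0r.
  rewrite nE; have -> : (x - m) *m N3 = w x - w m.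
    by rewrite /w /frame -mulmxBl opprB addrA subrK.
  by rewrite !entryD !entryN m0E m1E m2 /D; ring.
pose eta x := (w x 0 0 * k0 + w x 0 1 * k1) / K.
pose zeta x := w x 0 2.
have cw : continuous w by rewrite /w /frame; cts.
apply: (@slide_null _ c3 g v om D K xi0 D0 K0 xi0E _ _ _ eta zeta).
- by rewrite /eta; cts.
- by rewrite /zeta; cts.
- exact: closed_circ.
- exact: closed_circ.
- move=> x Cx; apply: PE; apply/eqP; rewrite -subr_eq0 -nx.
  by rewrite /n Cx.1 mulr0.
- move=> x y z; rewrite -/(P x y z) => -[]; have [h0 h1 h2] := wP x y z.
  rewrite -/w h2 => z0; rewrite h0 h1 z0 !mul0r !subr0 => h; split=> //.
  by rewrite -h /K /D k0E k1E; ring.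
- move=> x Cx mu mu01.
  have xE : x = P xi0 (eta x) (zeta x).
    by apply: PE; apply/eqP; rewrite -subr_eq0 -nx /n Cx.1 mulr0.
  have mE : m = P xi0 0 0.
    have {1}-> : m = P xi0 ((w m 0 0 * k0 + w m 0 1 * k1) / K) (w m 0 2).
      by apply: PE; rewrite m0E m1E m2 /D; ring.
    by rewrite mk m2 mul0r.
  have -> : place c3 g v om xi0 (mu * eta x) (mu * zeta x) = mix m x mu.
    rewrite [in RHS]xE mE; move: (eta x) (zeta x) => y z.
    by rewrite /P /place /mix; apply/rowP => j; rewrite !(entryD, entryZ); ring.
  by move=> h; apply: (h12 (mix m x mu)) => //; apply: dsk_mix => //; exact: circ_dsk.
- move=> x y xx xy; have [h0 h1 h2] := wP x y 0.
  have Dz : dsk c3 N3 (P x y 0).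
    split; first exact: h2.
    move: h0 h1; rewrite -/w => -> ->; rewrite !mul0r !subr0.
    apply: le_trans xy; rewrite le_eqVlt; apply/orP; left; apply/eqP.
    by rewrite /K /D k0E k1E; ring.
  move=> [C1|C2]; first exact: (h31 _ Dz).
  have := nE2 _ C2 Dz; rewrite nx h0 h1 h2 !mul0r !subr0 addr0 k0E k1E.
  have -> : (x * al + y * (- tau * be)) * al + (x * be + y * (tau * al)) * be - xi0 * D =
    (x - xi0) * D by rewrite /D; ring.
  by rewrite pmulr_lgt0// subr_gt0 ltNge xx.
Qed.

End Cycle.

(** * From tangent vectors to frame coordinates *)

Section Transversality.
Variable R : realType.
Local Notation V := 'rV[R]_3.

Lemma scale_regularE (a b : R) : a *: (b : R^o) = a * b.
Proof. by []. Qed.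

Lemma is_derive_frame (c v d : V) (M : 'M[R]_3) (gam : R -> V) k :
  is_derive (0 : R) (1 : R) gam v ->
  is_derive (0 : R) (1 : R) (fun t => frame d M (gam t) 0 k) ((v *m M) 0 k).
Proof.
move=> [dg vE].
have dj j : is_derive (0 : R) (1 : R) (fun t => gam t 0 j) (v 0 j).
  split; first by have /derivable_mxP := dg; exact.
  by rewrite -vE derive_mx// mxE.
have -> : (fun t => frame d M (gam t) 0 k) =
    (fun t => gam t 0 0) * cst (M 0 k) + (fun t => gam t 0 1) * cst (M 1 k) +
    (fun t => gam t 0 2) * cst (M 2 k) - cst ((d *m M) 0 k).
  apply/funext => t; rewrite /frame mulmxBl entryD entryN !fctE; congr (_ - _).
  by rewrite mxE sum_ord3.
have -> : (v *m M) 0 k = gam 0 0 0 *: 0 + cst (M 0 k) (0 : R) *: v 0 0 +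
    (gam 0 0 1 *: 0 + cst (M 1 k) (0 : R) *: v 0 1) +
    (gam 0 0 2 *: 0 + cst (M 2 k) (0 : R) *: v 0 2) - 0.
  rewrite !scaler0 !add0r subr0 mxE sum_ord3 /= !scale_regularE.
  by rewrite ![M _ _ * _]mulrC.
have cst0 j : is_derive (0 : R) (1 : R) (cst (M j k)) 0 by exact: is_derive_cst.
exact: (is_deriveB (is_deriveD (is_deriveD (is_deriveM (dj 0) (cst0 0))
  (is_deriveM (dj 1) (cst0 1))) (is_deriveM (dj 2) (cst0 2))) (is_derive_cst _ _ _)).
Qed.

(** A vector of height 1 over the plane is split as [u + v]. Differentiating the equations along the
    two paths gives height 0 for [v], hence 1 for [u], and tangency of [u] to the circle. *)
Lemma transverse_cuts (c d : V) (N M : 'M[R]_3) : M \in unitmx ->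
  transverse (circ c N) (pln d M) -> cuts c N d M.
Proof.
move=> uM tr p Cp Pp.
have [u [v [[gam [g0 gC dg]] [del [d0 dP dd]] uv]]] :=
  tr p Cp Pp (delta_mx 0 2 *m invmx M).
have cst_deriv (f : R -> R) (a b : R) : (forall t, f t = a) ->
    is_derive (0 : R) (1 : R) f b -> b = 0.
  move=> fa fb; have fE : f = cst a by apply/funext.
  by rewrite -(@derive_val _ _ _ _ _ _ _ fb) fE derive_cst.
have vM : (v *m M) 0 2 = 0 by exact: cst_deriv dP (is_derive_frame p d M 2 dd).
have uN : (u *m N) 0 2 = 0.
  by apply: cst_deriv (is_derive_frame p c N 2 dg) => t; exact: (gC t).1.
exists u; split=> //.
- have d0' := is_derive_frame p c N 0 dg; have d1' := is_derive_frame p c N 1 dg.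
  have := is_deriveD (is_deriveM d0' d0') (is_deriveM d1' d1').
  move=> /(cst_deriv _ 1) h.
  have : forall t, ((fun t => frame c N (gam t) 0 0) * (fun t => frame c N (gam t) 0 0) +
     (fun t => frame c N (gam t) 0 1) * (fun t => frame c N (gam t) 0 1)) t = 1.
    by move=> t; rewrite -(gC t).2 !fctE /= !expr2.
  move=> /h; rewrite g0 !scale_regularE; lra.
- have -> : (u *m M) 0 2 = 1; last exact: oner_neq0.
  have := congr1 (fun x : V => (x *m M) 0 2) uv.
  by rewrite mulmxKV// mulmxDl entryD vM addr0 mxE !eqxx.
Qed.

End Transversality.

Section Piercing.
Variable R : realType.
Local Notation V := 'rV[R]_3.

Lemma pierces_disjoint (e f : ellipse R) x :
  curve f `<=` disk f -> pierces e f -> disk e x -> ~ curve f x.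
Proof.
move=> sub [p [q [_ efE efD _ _]]] ex fx.
have : segment p q x by rewrite -efE; split=> //; exact: sub.
by move=> /efD[].
Qed.

Lemma frame_pierces (e f : ellipse R) (c d : V) (N M : 'M[R]_3) x :
  N \in unitmx -> cuts c N d M ->
  curve e = circ c N -> disk e = dsk c N -> curve f = circ d M -> disk f = dsk d M ->
  circ c N x -> dsk d M x -> (forall y, dsk c N y -> circ d M y -> False) ->
  pierces e f.
Proof.
move=> uN cut eC eD fC fD Cx Dx dis.
have [q [Cq xq seg mid int]] := pair_pierces uN cut Cx Dx dis.
exists x, q; rewrite eC eD fC fD; split=> //.
- apply/seteqP; split=> y.
    by move=> [Ny My]; have [t t01 ->] := seg y Ny My.1; exists t; rewrite // /= in_itv.
  move=> [t]; rewrite /= in_itv /= => /mid[h1 h2 h3] <-; split=> //.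
  by split; [exact: h2|exact: ltW].
- move=> y [t]; rewrite /= in_itv /= => /mid[h1 h2 h3] <-; split.
    by split; [exact: h2|exact: ltW].
  by move=> [_ h]; move: h3; rewrite /sqn /mix h ltxx.
- move=> y [[t]]; rewrite /= in_itv /= => t01 <- ends; have [h1 _ _] := mid t t01.
  split=> //; move=> [_ h].
  have t0 : t != 0.
    by apply/eqP => t0; apply: ends; left; rewrite t0 subr0 scale1r scale0r addr0.
  have t1 : t != 1.
    by apply/eqP => t1; apply: ends; right; rewrite t1 subrr scale1r scale0r add0r.
  have /int : 0 < t < 1.
    by move: t01 => /andP[ta tb]; rewrite !lt_neqAle ta tb eq_sym t0 t1.
  by rewrite /sqn /mix h ltxx.
Qed.

(* Chords of three disks cut out by a common line would be strictly nested in
   a cycle. *)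
Lemma triple_unique (c d b : V) (N M L : 'M[R]_3) x0 x1 x y :
  N \in unitmx -> M \in unitmx -> cuts c N d M -> cuts d M b L ->
  circ c N x0 -> dsk d M x0 -> (forall y, dsk c N y -> circ d M y -> False) ->
  circ d M x1 -> dsk b L x1 -> (forall y, dsk d M y -> circ b L y -> False) ->
  (forall y, dsk b L y -> circ c N y -> False) ->
  dsk c N x -> dsk d M x -> dsk b L x -> dsk c N y -> dsk d M y -> dsk b L y -> x = y.
Proof.
move=> uN uM cut1 cut2 C0 D0 dis1 C1 D1 dis2 dis3 xc xd xb yc yd yb.
have [q [Cq pq seg mid _]] := pair_pierces uN cut1 C0 D0 dis1.
have [q' [_ _ seg' mid' _]] := pair_pierces uM cut2 C1 D1 dis2.
have [t t01 xE] := seg x xc xd.1; have [s s01 yE] := seg y yc yd.1.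
have [->//|xy] := eqVneq x y; exfalso.
have ts : t != s by apply: contra_neq xy => ts; rewrite xE yE ts.
(* Two common points put the whole line of the chord into the third plane, so the end [x0] of the
   first chord falls on the second chord, inside the third disk. *)
have bx0 : pln b L x0.
  have := xb.1; have := yb.1; rewrite xE yE !frame_mix !entryD !entryZ /pln /=.
  move: (frame b L x0 0 2) (frame b L q 0 2) => f0 f1 hs ht.
  have ts0 : t - s != 0 by rewrite subr_eq0.
  have f10 : f1 = f0.
    apply/eqP; rewrite -subr_eq0; apply/eqP.
    by apply: (mulfI ts0); rewrite mulr0; lra.
  by move: hs; rewrite f10; lra.
have [r r01 x0E] := seg' x0 D0 bx0.
have [_ _ lt1] := mid' r r01.
by apply: (dis3 x0) => //; split=> //; rewrite x0E; exact: ltW.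
Qed.

End Piercing.

Section Main.
Variable R : realType.
Local Notation V := 'rV[R]_3.
Variables (e : 'I_3 -> ellipse R) (c : 'I_3 -> V) (N : 'I_3 -> 'M[R]_3).
Hypothesis uN : forall i, N i \in unitmx.
Hypotheses (eC : forall i, curve (e i) = circ (c i) (N i))
  (eD : forall i, disk (e i) = dsk (c i) (N i)).
Hypothesis cut : forall i j, i != j -> cuts (c i) (N i) (c j) (N j).
Hypothesis dis : forall i j x, i != j ->
  circ (c i) (N i) x -> circ (c j) (N j) x -> False.

Let eK : \bigcup_i curve (e i) = \bigcup_i circ (c i) (N i).
Proof. by apply: eq_bigcupr => i _. Qed.

Lemma piercing_borromean : has_triple_point e ->
  (exists s : 'S_3, forall i, pierces (e (s i)) (e (s (i + 1)))) ->
  borromean (\bigcup_i curve (e i)).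
Proof.
move=> [p pE] [s hs].
have disj i x : dsk (c (s i)) (N (s i)) x ->
    ~ circ (c (s (i + 1))) (N (s (i + 1))) x.
  rewrite -eD -eC; apply: pierces_disjoint => // y; rewrite eC eD; exact: circ_dsk.
have pD i : dsk (c i) (N i) p.
  have : (\bigcap_i disk (e i)) p by rewrite pE.
  by move=> /(_ i I); rewrite eD.
(* The point [p] lies in the preceding disk, which misses the curve of index [s i]. *)
have p1 i : sqn (c (s i)) (N (s i)) p < 1.
  rewrite lt_neqAle (pD (s i)).2 andbT; apply/eqP => h.
  apply: (@disj (i - 1) p (pD _)); rewrite subrK; split=> //.
  exact: (pD _).1.
apply: isotopic_ambient; rewrite eK borromean_ringsE.
have -> : \bigcup_i circ (c i) (N i) = \bigcup_i circ (c (s i)) (N (s i)).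
  apply/seteqP; split=> x [i _ ix]; last by exists (s i).
  by exists ((s^-1)%g i); rewrite ?permKV.
apply: (@borromean_position_isotopic _ (fun i => c (s i)) (fun i => N (s i)) p) => //.
- by move=> i; exact: (pD _).1.
- move=> x hx.
  have : (\bigcap_i disk (e i)) x.
    by move=> i _; rewrite eD -(permKV s i); exact: hx.
  by rewrite pE.
Qed.

Lemma borromean_piercing : borromean (\bigcup_i curve (e i)) ->
  has_triple_point e /\ exists s : 'S_3, forall i, pierces (e (s i)) (e (s (i + 1))).
Proof.
rewrite eK => /(borromean_circs uN)[nulls not_null].
(* Once [a_asym] is known, this incidence amounts to disk [j] piercing disk [i]. *)
pose a i j := exists2 x, circ (c j) (N j) x & dsk (c i) (N i) x.
have a_asym i j : i != j -> a i j -> a j i -> False.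
  move=> ij [x xj xi] [y yi yj]; have [] := nulls i j ij.
    by apply: (pair_linked (uN i) (cut ij) (fun z => @dis i j z ij) yi yj xj xi).
  have ji : j != i by rewrite eq_sym.
  by apply: (pair_linked (uN j) (cut ji) (fun z => @dis j i z ji) xj xi yi yj).
have a_some i : exists2 j, i != j & a i j.
  apply: contrapT => h.
  pose Ob : set V := \bigcup_(j in [set j | i != j]) circ (c j) (N j).
  apply: (not_null i Ob); first by move=> j ij x xj; exists j.
  apply: null_in_circ => x xi [j ij xj]; apply: h; exists j => //.
  by exists x.
have a_next i : a i (i + 1) \/ a i (i - 1).
  have [j ij aij] := a_some i.
  by have [jE|jE] := ord3_cover ij; [left|right]; rewrite -jE.
(* Asymmetry propagates the choice made at index 0 around the triangle; one of the two orientations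
   is relabelled by a transposition. *)
have [s hs] : exists s : 'S_3, forall i, a (s (i + 1)) (s i).
  have := a_next 0; have := a_next 1; have := a_next 2; rewrite !ord3_num.
  have n01 := @a_asym 0 1 isT; have n12 := @a_asym 1 2 isT; have n20 := @a_asym 2 0 isT.
  move=> a2 a1 a0; case: a0 => a0.
    have {}a1 : a 1 2 by case: a1 => // /(n01 a0).
    have {}a2 : a 2 0 by case: a2 => // /(n12 a1).
    exists (tperm 1 2); apply: ord3P; rewrite !ord3_num ?tpermL ?tpermR ?tpermD//.
  have {}a2 : a 2 1 by case: a2 => // /n20 /(_ a0).
  have {}a1 : a 1 0 by case: a1 => // /n12 /(_ a2).
  by exists 1%g; apply: ord3P; rewrite !ord3_num !perm1.
have s_neq i : s i != s (i + 1) by rewrite (inj_eq perm_inj) eq_sym ord3_neq.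
have s_neq' i : s (i + 1) != s i by rewrite eq_sym.
have hdis i x : dsk (c (s i)) (N (s i)) x ->
    circ (c (s (i + 1))) (N (s (i + 1))) x -> False.
  move=> xi xj; apply: (a_asym _ _ (s_neq' i) (hs i)).
  by exists x.
have hd0 := @hdis 0; have hd1 := @hdis 1; have hd2 := @hdis 2.
have hs0 := hs 0; have hs1 := hs 1; have hs2 := hs 2.
have sn0 := s_neq 0; have sn1 := s_neq 1; have sn2 := s_neq 2.
rewrite !ord3_num in hd0 hd1 hd2 hs0 hs1 hs2 sn0 sn1 sn2.
split; last first.
  exists s => i; have [x xi xj] := hs i.
  exact: (frame_pierces (uN _) (cut (s_neq i)) (eC _) (eD _) (eC _) (eD _)
    xi xj (@hdis i)).
have [x0 Cx0 Dx0] := hs0; have [x1 Cx1 Dx1] := hs1; have [x2 Cx2 Dx2] := hs2.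
have [p pD] : exists p, forall i, dsk (c (s i)) (N (s i)) p.
  apply: contrapT => no.
  apply: (not_null (s 0) (circ (c (s 1)) (N (s 1)) `|` circ (c (s 2)) (N (s 2)))).
    move=> j; have [k ->] : exists k, j = s k.
      by exists ((s^-1)%g j); rewrite permKV.
    elim/ord3P: k; first by rewrite eqxx.
    - by move=> _ x xj; left.
    - by move=> _ x xj; right.
  apply: (cycle_null (uN _) (uN _) (uN _) (cut sn2) (cut sn1) _ _
    hd0 hd1 hd2 Cx2 Dx2 Cx1 Dx1).
  - by move=> x; exact: dis.
  - by move=> x; exact: dis.
  - by move=> x h0 h1 h2; apply: no; exists x; exact: ord3P.
exists p; apply/seteqP; split=> x /=.
  move=> hx; have xD i : dsk (c (s i)) (N (s i)) x by rewrite -eD; exact: hx.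
  exact: (triple_unique (uN _) (uN _) (cut sn0) (cut sn1) Cx0 Dx0 hd0 Cx1 Dx1 hd1 hd2).
move=> -> i _; rewrite eD -(permKV s i); exact: pD.
Qed.

End Main.

Theorem theorem2 (R : realType) (e : 'I_3 -> ellipse R)
    (link_e : elliptic_link e) (std_e : standard_position e) :
  borromean (\bigcup_i curve (e i)) <->
  has_triple_point e /\
  exists s : 'S_3,
    [/\ pierces (e (s 0)) (e (s 1)),
        pierces (e (s 1)) (e (s 2)) &
        pierces (e (s 2)) (e (s 0))].
Proof.
have /choice[c hc] := fun i => ellipse_frame (e i).
have /choice[N hN] := hc.
have uN i : N i \in unitmx by case: (hN i).
have eC i : curve (e i) = circ (c i) (N i) by case: (hN i).
have eD i : disk (e i) = dsk (c i) (N i) by case: (hN i).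
have eP i : plane (e i) = pln (c i) (N i) by case: (hN i).
have cut i j : i != j -> cuts (c i) (N i) (c j) (N j).
  move=> /std_e[h _ _]; apply: transverse_cuts => //.
  by rewrite -eC -eP.
have dis i j x : i != j -> circ (c i) (N i) x -> circ (c j) (N j) x -> False.
  move=> /link_e; rewrite !eC => h xi xj.
  by have : (circ (c i) (N i) `&` circ (c j) (N j)) x by []; rewrite h.
split=> [/(borromean_piercing uN eC eD cut dis)[tp [s hs]]|[tp [s [h0 h1 h2]]]].
  split=> //; exists s.
  by have := hs 0; have := hs 1; have := hs 2; rewrite !ord3_num.
apply: (piercing_borromean uN eC eD tp); exists s.
by apply: ord3P; rewrite !ord3_num.
Qed.
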